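(* Let $\Gamma$ be a regular metric tree and let $\Psi(x)=\psi(|x|)>0$ be a symmetric, normalized Hardy weight on $\mathcal H^\circ(\Gamma)$. Put $\Phi(x)=|x|\Psi(x)$ and let $p>1$. Then there is a constant $C>0$, not depending on $V$ and $\alpha$, such that the following holds for every measurable potential $V\ge 0$ on $\Gamma$ with $V\Psi^{-1}\in L_{p,w}(\Gamma,\Phi)$: $$N_-(\mathbf H_{\alpha V})\le C\alpha^p\sup_{t>0}\Bigl(t^p\int_{\{V(x)>t\Psi(x)\}}\Phi(x)\,dx\Bigr),\qquad\forall\alpha>0,$$ and $$\limsup_{\alpha\to\infty}\alpha^{-p}N_-(\mathbf H_{\alpha V})\le C\limsup_{t+t^{-1}\to\infty}\Bigl(t^p\int_{\{V(x)>t\Psi(x)\}}\Phi(x)\,dx\Bigr).$$ In particular, if $\int_{\{V(x)>t\Psi(x)\}}\Phi(x)\,dx=o(t^{-p})$ as $t+t^{-1}\to\infty$, then $N_-(\mathbf H_{\alpha V})=o(\alpha^p)$ as $\alpha\to\infty$. If $V\Psi^{-1}$ belongs to the narrower space $L_p(\Gamma,\Phi)$ (i.e. $\int_\Gamma (V\Psi^{-1})^p\Phi\,dx<\infty$), then $$N_-(\mathbf H_{\alpha V})\le C\alpha^p\int_\Gamma|x|\,V^p\,\Psi^{1-p}\,dx,\qquad\forall\alpha>0,$$ and $N_-(\mathbf H_{\alpha V})=o(\alpha^p)$ as $\alpha\to\infty$.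
   Context: **Trees.** $\Gamma$ is a rooted metric tree with root $o$, with infinitely many vertices and edges, each edge having finite length. $\rho$ is the path distance, $|x|=\rho(o,x)$, and $x\preceq y$ means that $x$ lies on the path from $o$ to $y$ ($x\prec y$ if moreover $x\ne y$). The generation $\mathrm{gen}(v)$ of a vertex $v$ is the number of vertices $w$ with $o\preceq w\prec v$. The branching number $b(v)$ is the number of edges emanating from $v$ (away from the root); it is assumed that $b(o)=1$ and $1<b(v)<\infty$ for every vertex $v\ne o$. The tree is *regular* if all vertices of the same generation have equal branching numbers and lie at equal distance from the root; then $b_n=b(v)$ and $t_n=|v|$ for any vertex $v$ of generation $n=0,1,\dots$ (so $b_0=1$, $t_0=0$). The sequence $\{t_n\}$ is assumed unbounded. $dx$ is the measure on $\Gamma$ induced by Lebesgue measure on the edges. **Sobolev spaces.** $H^1(\Gamma)$ is the space of continuous functions $u$ on $\Gamma$ with $u|_e\in H^1(e)$ for each edge $e$ and $\int_\Gamma(|u'|^2+|u|^2)dx<\infty$; $H^{1,0}(\Gamma)=\{u\in H^1(\Gamma):u(o)=0\}$. $\mathcal H^{1,0}(\Gamma)$ is the space of continuous $u$ with $u(o)=0$, $u|_e\in H^1(e)$ for each edge $e$, and $u'\in L_2(\Gamma)$, normed by $\|u'\|_{L_2(\Gamma)}$; $\mathcal H^\circ(\Gamma)$ is the closure of $H^{1,0}(\Gamma)$ in $\mathcal H^{1,0}(\Gamma)$. **Hardy weights.** A measurable $V\ge0$ is a Hardy weight on $\mathcal H^\circ(\Gamma)$ if $\int_\Gamma V|u|^2dx\le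 C_V\int_\Gamma|u'|^2dx$ for all $u\in H^{1,0}(\Gamma)$ (equivalently all $u\in\mathcal H^\circ(\Gamma)$) with a finite constant; $C_V$ denotes the least such constant. The Hardy weight is *normalized* if $C_V=1$. A weight is *symmetric* if it depends only on $|x|$. **Operator.** $\mathbf H_{\alpha V}=-\Delta_D-\alpha V$ ($\Delta_D$ the Dirichlet Laplacian, $\alpha>0$) is the self-adjoint operator in $L_2(\Gamma)$ defined by the quadratic form $\int_\Gamma(|u'|^2-\alpha V|u|^2)dx$, $u\in H^{1,0}(\Gamma)$ (bounded below and closed under the hypotheses of the claim). $N_-(\mathbf H)$ is the number of negative eigenvalues of $\mathbf H$, counted with multiplicities, when the negative spectrum is finite. **Weak spaces.** For a weight function $\Phi\ge0$ on $\Gamma$ and $0<p<\infty$, $L_{p,w}(\Gamma,\Phi)$ is the space of measurable $f$ with $\sup_{t>0}\bigl(t^p\int_{\{|f(x)|>t\}}\Phi(x)dx\bigr)<\infty$. The notation $t+t^{-1}\to\infty$ (for $t>0$) means that both $t\to0$ and $t\to\infty$ are considered. *)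

(* Defs.v *)
From HB Require Import structures.
From mathcomp Require Import all_boot all_order all_algebra.
From mathcomp Require Import finmap complex.
From mathcomp Require Import all_classical all_reals all_analysis.

Set Implicit Arguments.
Unset Strict Implicit.
Unset Printing Implicit Defensive.
Import Order.TTheory GRing.Theory Num.Theory.
Import numFieldNormedType.Exports.

Local Open Scope classical_set_scope.
Local Open Scope complex_scope.
Local Open Scope ring_scope.

(* A vertex v other than the root also names the edge <parent v, v> that ends
   at it, of length elen v.  There is no such edge for the root, and elen root
   is irrelevant. *)
Record metric_tree (R : realType) := MetricTree {
  vertex : choiceType ;
  root : vertex ;
  parent : vertex -> vertex ;
  elen : vertex -> R ;
  parent_root : parent root = root ;
  reach_root : forall v, exists n, iter n parent v == root ;
  elen_gt0 : forall v, v != root -> 0 < elen v ;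
  children := fun v => [set w | w != root /\ parent w = v] ;
  branching := fun v => #|` fset_set (children v)| ;
  finite_children : forall v, finite_set (children v) ;
  branching_root : branching root = 1%N ;
  branching_gt1 : forall v, v != root -> (1 < branching v)%N
}.
Arguments root {R} _.

Section metric_tree.
Context {R : realType} (G : metric_tree R).
Local Notation V := (vertex G).

(* The vertices strictly before v on the path from the root are
   iter i parent v for 1 <= i <= gen v. *)
Definition gen (v : V) : nat := ex_minn (reach_root v).

Definition vdist (v : V) : R := \sum_(i < gen v) elen (iter i (@parent R G) v).

Definition regular_tree : Prop :=
  (forall v w : V, gen v = gen w ->
     branching v = branching w /\ vdist v = vdist w) /\
  (forall M : R, exists v : V, M < vdist v).

(* The tree as a set of points: the half-open edges (v, s), 0 < s <= elen v,
   where s is the distance to parent v, together with the root (root, 0). *)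
Definition is_point (x : V * R) : bool :=
  (x == (root G, 0)) || [&& x.1 != root G, 0 < x.2 & x.2 <= elen x.1].

Definition points : Type := {x : V * R | is_point x}.
HB.instance Definition _ := Choice.on points.

Lemma root_is_point : is_point (root G, 0).
Proof. by rewrite /is_point eqxx. Qed.
Definition root_pt : points := exist _ (root G, 0) root_is_point.
HB.instance Definition _ := isPointed.Build points root_pt.

Definition vertex_pt (v : V) : points := insubd root_pt (v, elen v).

(* Parametrization of the closed edge <parent v, v> by s in [0, elen v]. *)
Definition edge_pt (v : V) (s : R) : points :=
  if 0 < s then insubd root_pt (v, s) else vertex_pt (parent v).

Definition dist_root (x : points) : R :=
  vdist (parent (val x).1) + (val x).2.

(* Lebesgue (as opposed to Borel) measurable subsets of the line. *)
Definition lebesgueT : measurableType _ :=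
  caratheodory_type ((@wlength R idfun)^*)%mu.

Definition edge_trace (v : V) (A : set points) : set lebesgueT :=
  [set s : R | 0 < s <= elen v /\ A (edge_pt v s)].

Definition measurable_points : set (set points) :=
  [set A | forall v, v != root G -> measurable (edge_trace v A)].

Lemma measurable_edge (v : V) :
  measurable ([set s : R | 0 < s <= elen v] : set lebesgueT).
Proof.
apply: (@sub_caratheodory _ _ _ (@wlength R idfun)).
exact: (@measurable_itv R `]0, elen v]).
Qed.

Lemma edge_trace0 (v : V) : edge_trace v set0 = set0.
Proof. by apply/seteqP; split => s // -[]. Qed.

Lemma edge_traceC (v : V) (A : set points) :
  edge_trace v (~` A) = [set s : R | 0 < s <= elen v] `\` edge_trace v A.
Proof.
apply/seteqP; split=> s /= [h1 h2]; split=> //; first by case.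
by move=> As; apply: h2; split.
Qed.

Lemma edge_trace_bigcup (v : V) (F : (set points)^nat) :
  edge_trace v (\bigcup_i F i) = \bigcup_i edge_trace v (F i).
Proof.
apply/seteqP; split => s /=; first by move=> [? [i _ ?]]; exists i.
by move=> [i _ [? ?]]; split => //; exists i.
Qed.

Fact measurable_points0 : measurable_points set0.
Proof. by move=> v _; rewrite edge_trace0. Qed.

Fact measurable_pointsC (A : set points) :
  measurable_points A -> measurable_points (~` A).
Proof.
move=> mA v v0; rewrite edge_traceC; apply: measurableD; last exact: mA.
exact: measurable_edge.
Qed.

Fact measurable_points_bigcup (F : (set points)^nat) :
  (forall i, measurable_points (F i)) -> measurable_points (\bigcup_i F i).
Proof.
move=> mF v v0; rewrite edge_trace_bigcup.
by apply: bigcupT_measurable => i; exact: mF.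
Qed.

HB.instance Definition _ := @isMeasurable.Build default_measure_display points
  measurable_points measurable_points0 measurable_pointsC
  measurable_points_bigcup.

Definition dx (A : set points) : \bar R :=
  \esum_(v in [set v : V | v != root G])
    completed_lebesgue_measure (edge_trace v A).

Fact dx0 : dx set0 = 0%E.
Proof. by rewrite /dx esum1// => v _; rewrite edge_trace0 measure0. Qed.

Fact dx_ge0 (A : set points) : (0 <= dx A)%E.
Proof. by apply: esum_ge0 => v _; exact: measure_ge0. Qed.

Fact dx_sigma_additive : semi_sigma_additive dx.
Proof.
move=> F mF tF mUF.
have -> : dx (\bigcup_n F n) = (\sum_(0 <= n <oo) dx (F n))%E; last first.
  by apply: is_cvg_nneseries => n _ _; exact: dx_ge0.
rewrite nneseries_esumT; last by move=> n; exact: dx_ge0.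
rewrite esum_esum; last by move=> *; exact: measure_ge0.
rewrite (reindex_esum ([set v : V | v != root G] `*` [set: nat]) _
  (fun k => (k.2, k.1))); last first.
  split => [[v n] [? _]|[v n] [v' n'] _ _ [-> ->]|[n v] [_ ?]]//=.
  by exists (v, n).
rewrite -(@esum_esum _ _ _ _ (fun=> setT) (fun v n =>
  completed_lebesgue_measure (edge_trace v (F n)))); last first.
  by move=> *; exact: measure_ge0.
apply: eq_esum => v v0.
rewrite edge_trace_bigcup measure_semi_bigcup.
- by rewrite nneseries_esumT// => n; exact: measure_ge0.
- by move=> n; exact: mF.
- move=> i j _ _ [s [[_ Fi] [_ Fj]]].
  by apply: (tF i j) => //; exists (edge_pt v s).
- by rewrite -edge_trace_bigcup; exact: mUF.
Qed.

HB.instance Definition _ :=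
  isMeasure.Build _ _ _ dx dx0 dx_ge0 dx_sigma_additive.

Definition normsq (z : R[i]) : R := complex.Re z ^+ 2 + complex.Im z ^+ 2.

Definition cmeasurable (f : points -> R[i]) : Prop :=
  measurable_fun setT (fun x => complex.Re (f x)) /\
  measurable_fun setT (fun x => complex.Im (f x)).

Definition cintegral (D : set points) (f : points -> R[i]) : R[i] :=
  (\int[dx]_(x in D) complex.Re (f x)) +i* (\int[dx]_(x in D) complex.Im (f x)).

Definition L2 (f : points -> R[i]) : Prop :=
  cmeasurable f /\ (\int[dx]_x (normsq (f x))%:E < +oo)%E.

Definition L2norm (f : points -> R[i]) : R :=
  Num.sqrt (\int[dx]_x normsq (f x)).

Definition dotL2 (f g : points -> R[i]) : R[i] :=
  cintegral setT (fun x => f x * (g x)^*).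

Definition segment (v : V) (s : R) : set points := edge_pt v @` `]0, s].

(* g is the derivative of u, where u|_e is in H^1(e) for each closed edge e,
   that is, u|_e is the primitive of some g in L_2(e).  This makes u|_e
   continuous; as closed edges meeting at a vertex share that vertex, and
   only finitely many do, u is then continuous on the tree. *)
Definition is_deriv (u g : points -> R[i]) : Prop :=
  cmeasurable g /\
  forall v : V, v != root G ->
    (\int[dx]_(x in segment v (elen v)) (normsq (g x))%:E < +oo)%E /\
    forall s : R, 0 <= s <= elen v ->
      u (edge_pt v s) =
      u (vertex_pt (parent v)) + cintegral (segment v s) g.

(* The derivative is only determined almost everywhere: deriv u is one of its
   representatives. *)
Definition deriv (u : points -> R[i]) : points -> R[i] :=
  xget (fun=> 0) (is_deriv u).

Definition H1 (u : points -> R[i]) : Prop :=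
  (exists g, is_deriv u g) /\
  (\int[dx]_x (normsq (deriv u x) + normsq (u x))%:E < +oo)%E.

Definition H10 (u : points -> R[i]) : Prop := H1 u /\ u root_pt = 0.

Definition weight (W : points -> R) : Prop :=
  measurable_fun setT W /\ forall x, 0 <= W x.

Definition hardy_inequality (W : points -> R) (c : R) : Prop :=
  forall u, H10 u ->
    (\int[dx]_x (W x * normsq (u x))%:E <=
     c%:E * \int[dx]_x (normsq (deriv u x))%:E)%E.

Definition normalized_hardy_weight (W : points -> R) : Prop :=
  [/\ weight W, hardy_inequality W 1 &
      forall c, hardy_inequality W c -> 1 <= c].

(* An operator is represented by its graph: T u f means that u is in the
   domain of T and T u = f. *)
Definition operator := (points -> R[i]) -> (points -> R[i]) -> Prop.

(* T - z is a bijection onto L_2 with bounded inverse.  The norm estimate, at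
   f = 0, contains injectivity. *)
Definition resolvent_set (T : operator) (z : R[i]) : Prop :=
  exists K : R, forall f, L2 f ->
    (exists u, T u (fun x => z * u x + f x)) /\
    (forall u, T u (fun x => z * u x + f x) -> L2norm u <= K * L2norm f).

Definition spectrum (T : operator) : set (R[i]) := ~` resolvent_set T.

(* Linear independence in L_2, i.e. up to equality almost everywhere. *)
Definition lin_indep (n : nat) (u : 'I_n -> points -> R[i]) : Prop :=
  forall c : 'I_n -> R[i],
    {ae dx, forall x, \sum_(i < n) c i * u i x = 0} -> forall i, c i = 0.

(* Dimension of the kernel of T - z; it is 0 iff z is not an eigenvalue. *)
Definition multiplicity (T : operator) (z : R[i]) : \bar R :=
  ereal_sup [set n%:R%:E | n in [set n : nat |
    exists u : 'I_n -> points -> R[i],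
      (forall i, T (u i) (fun x => z * u i x)) /\ lin_indep u]].

(* In the first case all l < 0 are summed over, since the multiplicity vanishes
   when l is not an eigenvalue. *)
Definition N_minus (T : operator) : \bar R :=
  if `[< finite_set [set l : R | l < 0 /\ spectrum T l%:C] >]
  then \esum_(l in [set l : R | l < 0]) multiplicity T l%:C
  else +oo%E.

(* Sesquilinear form whose diagonal is the quadratic form
   int (|u'|^2 - a W |u|^2) dx with domain H10. *)
Definition hform (a : R) (W : points -> R) (u w : points -> R[i]) : R[i] :=
  cintegral setT
    (fun x => deriv u x * (deriv w x)^* - (a * W x)%:C * (u x * (w x)^*)).

(* The operator associated with this form by the first representation
   theorem. *)
Definition schrodinger (a : R) (W : points -> R) : operator := fun u f =>
  [/\ H10 u, L2 f & forall w, H10 w -> hform a W u w = dotL2 f w].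

Definition Lp (p : R) (Phi : points -> R) (f : points -> R) : Prop :=
  measurable_fun setT f /\
  (\int[dx]_x (`|f x| `^ p * Phi x)%:E < +oo)%E.

Definition weak_Lp (p : R) (Phi : points -> R) (f : points -> R) : Prop :=
  measurable_fun setT f /\
  (ereal_sup [set (t `^ p)%:E *
     \int[dx]_(x in [set x | (t < `|f x|)%R]) (Phi x)%:E |
     t in [set t : R | (0 < t)%R]] < +oo)%E.

(* int_{W > t Psi} |x| Psi(x) dx *)
Definition level_integral (Psi W : points -> R) (t : R) : \bar R :=
  (\int[dx]_(x in [set x | (t * Psi x < W x)%R]) (dist_root x * Psi x)%:E)%E.

End metric_tree.

Arguments points {R} G.

(* The filter "t + 1/t --> +oo, t > 0". *)
Definition zero_or_infty {R : realType} : set_system R :=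
  filter_from [set: R] (fun M => [set t : R | 0 < t /\ M < t + t^-1]).

(* Main.v *)
(** Only the Hardy inequality with constant 1 is used.  Let D be the Dirichlet
    form and let e_1, ..., e_n be D-orthonormal.  Where 4 a V <= Psi, the Hardy
    inequality bounds the integral of a V sum_i e_i^2 by n / 4; where
    4 a V > Psi, Bessel's inequality sum_i e_i(x)^2 <= |x| does.  Hence D can
    be at most twice the form of a V only on subspaces of dimension at most
    4 a int_{4 a V > Psi} |x| V dx.  This bounds the total multiplicity of the
    negative eigenvalues; moreover a perturbation of finite rank makes
    D - a V coercive, so that the other negative numbers lie in the resolvent
    set.

    A dyadic decomposition of {V > t Psi}, with t = 1 / (4 a), turns the
    integral into the weak norm, and Chebyshev's inequality into the strong one.
    For the asymptotics, the part of the integral over {V > delta Psi}, delta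
    fixed, is finite and contributes O(a) = o(a^p) only. *)

From HB Require Import structures.
From mathcomp Require Import all_boot all_order all_algebra.
From mathcomp Require Import finmap complex.
From mathcomp Require Import all_classical all_reals all_analysis.
From mathcomp Require Import measurable_realfun ring lra.
Require Import Defs.

Set Implicit Arguments.
Unset Strict Implicit.
Unset Printing Implicit Defensive.
Import Order.TTheory GRing.Theory Num.Theory.
Import numFieldNormedType.Exports.

Local Open Scope classical_set_scope.
Local Open Scope complex_scope.
Local Open Scope ring_scope.

(** [N_minus] is +oo unless the negative spectrum is finite, and [spectrum] is the complement of a
    resolvent set. Bounding the multiplicities of eigenvalues therefore does not suffice: for every
    l < 0 without eigenfunctions the equation with spectral parameter l has to be solved in the weak
    sense, with a norm bound. This needs a representation theorem and the completeness of the form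
    domain.

    The comparison is made with q = D - 2 w, where w is the form of a V, and not with D - w itself:
    as D - w = (D + q) / 2, compensating the finitely many negative directions of q leaves D / 2,
    which is the coercivity that the representation theorem asks for. The threshold 4 a V > Psi is
    tuned to this 2: for n orthonormal vectors with D <= 2 w, the part governed by the Hardy
    inequality contributes 2 (n / 4), which is absorbed by n.

    All of this is carried out over the reals. The form has real coefficients, so the equation
    decouples into real and imaginary parts, and a real basis of the real eigenfunctions spans the
    complex ones. *)

Lemma discriminant_le (R : realFieldType) (a b e : R) : 0 <= a ->
  (forall t, 0 <= t ^+ 2 * a + 2 * t * b + e) -> b ^+ 2 <= a * e.
Proof.
move=> a0 h; have [a00|a_neq0] := eqVneq a 0.
  rewrite a00 mul0r; case: (eqVneq b 0) => [->|b0]; first by rewrite expr0n.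
  (* At this t the polynomial, affine since a = 0, takes the value -1. *)
  have := h (- (e + 1) / (2 * b)); rewrite a00 mulr0 add0r.
  have -> : 2 * (- (e + 1) / (2 * b)) * b = - (e + 1) by field; rewrite b0.
  lra.
have := h (- b / a).
have -> : (- b / a) ^+ 2 * a + 2 * (- b / a) * b + e = (a * e - b ^+ 2) / a by field.
by rewrite pmulr_lge0 ?subr_ge0// invr_gt0 lt_neqAle eq_sym a_neq0.
Qed.

(** * Symmetric bilinear forms on a real vector space and their orthonormal families *)

Section Forms.
Variables (R : realType) (E : lmodType R).
Implicit Types (B : E -> E -> R) (u v x : E) (I : finType).

Definition sym_bilinear B :=
  (forall u v, B u v = B v u) /\
  (forall a u v x, B (a *: u + v) x = a * B u x + B v x).

Section Expansion.
Variables (B : E -> E -> R) (bB : sym_bilinear B).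

Lemma formC u v : B u v = B v u. Proof. exact: bB.1. Qed.

Lemma form0l u : B 0 u = 0.
Proof. by have := bB.2 1 0 0 u; rewrite scaler0 addr0 mul1r; lra. Qed.

Lemma formDl u v x : B (u + v) x = B u x + B v x.
Proof. by rewrite -[u in LHS]scale1r bB.2 mul1r. Qed.

Lemma formZl a u x : B (a *: u) x = a * B u x.
Proof. by rewrite -[a *: u]addr0 bB.2 form0l addr0. Qed.

Lemma formBl u v x : B (u - v) x = B u x - B v x.
Proof. by rewrite formDl -scaleN1r formZl mulN1r. Qed.

Lemma formDr u v x : B x (u + v) = B x u + B x v.
Proof. by rewrite formC formDl !(formC _ x). Qed.

Lemma formZr a u x : B x (a *: u) = a * B x u.
Proof. by rewrite formC formZl (formC _ x). Qed.

Lemma formBr u v x : B x (u - v) = B x u - B x v.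
Proof. by rewrite formC formBl !(formC _ x). Qed.

Lemma form_suml I (f : I -> E) x : B (\sum_i f i) x = \sum_i B (f i) x.
Proof.
apply: (big_ind2 (fun a b => B a x = b)); first exact: form0l.
  by move=> u1 ? u2 ? <- <-; rewrite formDl.
by [].
Qed.

Lemma form_sumr I (f : I -> E) x : B x (\sum_i f i) = \sum_i B x (f i).
Proof. by rewrite formC form_suml; apply: eq_bigr => i _; rewrite formC. Qed.

Lemma form_sumZl I (c : I -> R) (f : I -> E) x :
  B (\sum_i c i *: f i) x = \sum_i c i * B (f i) x.
Proof. by rewrite form_suml; apply: eq_bigr => i _; rewrite formZl. Qed.

Lemma form_sumZr I (c : I -> R) (f : I -> E) x :
  B x (\sum_i c i *: f i) = \sum_i c i * B x (f i).
Proof. by rewrite form_sumr; apply: eq_bigr => i _; rewrite formZr. Qed.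

Lemma form_scale_sqr a u : B (a *: u) (a *: u) = a ^+ 2 * B u u.
Proof. by rewrite formZl formZr mulrA. Qed.

Lemma form_add_sqr u v : B (u + v) (u + v) = B u u + 2 * B u v + B v v.
Proof. by rewrite formDl !formDr (formC v u); ring. Qed.

Lemma form_sub_sqr u v : B (u - v) (u - v) = B u u - 2 * B u v + B v v.
Proof. by rewrite formBl !formBr (formC v u); ring. Qed.

Lemma form_CauchySchwarz (B_ge0 : forall u, 0 <= B u u) u v :
  B u v ^+ 2 <= B u u * B v v.
Proof.
apply: discriminant_le => // t.
have := B_ge0 (t *: u + v); rewrite form_add_sqr form_scale_sqr formZl.
by rewrite mulrA.
Qed.

End Expansion.

Definition orthonormal_family B I (e : I -> E) :=
  forall i j, B (e i) (e j) = (i == j)%:R.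

(** Extension by one vector, indexed by [None]: option types spare any renumbering. *)
Lemma orthonormal_option B I (e : I -> E) v : sym_bilinear B ->
  orthonormal_family B e -> (forall i, B v (e i) = 0) -> B v v = 1 ->
  orthonormal_family B (fun i => oapp e v i).
Proof.
move=> bB oe ve vv [i|] [j|] /=; first exact: oe.
- by rewrite formC.
- exact: ve.
- exact: vv.
Qed.

Lemma orthonormal_unit B u : sym_bilinear B -> 0 < B u u ->
  B ((Num.sqrt (B u u))^-1 *: u) ((Num.sqrt (B u u))^-1 *: u) = 1.
Proof.
by move=> bB u0; rewrite form_scale_sqr// exprVn sqr_sqrtr ?ltW// mulVf ?gt_eqF.
Qed.

Definition independent I (x : I -> E) :=
  forall c : I -> R, \sum_i c i *: x i = 0 -> forall i, c i = 0.

Lemma exists_kernel_row (F : fieldType) n k (A : 'M[F]_(n, k)) : (k < n)%N ->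
  exists2 c : 'rV[F]_n, c != 0 & c *m A = 0.
Proof.
move=> kn; have /rowV0Pn[c cA c0] : kermx A != 0.
  rewrite -mxrank_eq0 mxrank_ker subn_eq0 -ltnNge.
  exact: leq_ltn_trans (rank_leq_col A) kn.
by exists c => //; apply/eqP; rewrite -sub_kermx.
Qed.

(** Homogeneous systems with more unknowns than equations. The field is arbitrary, because real
    coefficients serve the orthonormalization and complex ones the count of eigenfunctions. *)
Lemma exists_kernel (F : fieldType) (I J : finType) (A : I -> J -> F) :
  (#|J| < #|I|)%N ->
  exists c : I -> F, (exists i, c i != 0) /\ forall j, \sum_i c i * A i j = 0.
Proof.
move=> JI; have [c c0 cA] := exists_kernel_row
  (\matrix_(i < #|I|, j < #|J|) A (enum_val i) (enum_val j)) JI.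
exists (fun i => c 0 (enum_rank i)); split.
  have /rV0Pn[k ck] := c0.
  by exists (enum_val k); rewrite enum_valK.
move=> j; have /rowP/(_ (enum_rank j)) := cA; rewrite !mxE; apply: etrans.
rewrite [RHS](reindex (@enum_rank I)) /=; last exact/onW_bij/enum_rank_bij.
by apply: eq_bigr => i _; rewrite mxE !enum_rankK.
Qed.

(* As long as an orthonormal family in the span of x has fewer elements than x,
   the span contains a nonzero vector orthogonal to it. *)
Lemma independent_orthonormal B I (x : I -> E) : sym_bilinear B ->
  (forall u, u != 0 -> 0 < B u u) -> independent x ->
  exists (J : finType) (e : J -> E),
    [/\ #|J| = #|I|, orthonormal_family B e &
        forall j, exists c : I -> R, e j = \sum_i c i *: x i].
Proof.
move=> bB B_gt0 ix.
suff H k : (k <= #|I|)%N -> exists (J : finType) (e : J -> E),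
    [/\ #|J| = k, orthonormal_family B e &
        forall j, exists c : I -> R, e j = \sum_i c i *: x i] by exact: H.
elim: k => [_|k IH kI].
  by exists void, (fun v : void => match v with end); split;
    [rewrite card_void|case|case].
have [J [e [cJ oe espan]]] := IH (ltnW kI).
have [|c [[i0 ci0] cA]] := @exists_kernel R I J (fun i j => B (x i) (e j)).
  by rewrite cJ.
pose u := \sum_i c i *: x i.
have u0 : u != 0.
  by apply: contra ci0 => /eqP /ix ->.
have ue j : B u (e j) = 0 by rewrite form_sumZl.
exists (option J : finType), (fun i => oapp e ((Num.sqrt (B u u))^-1 *: u) i).
split.
- by rewrite card_option cJ.
- apply: orthonormal_option => //; last exact/orthonormal_unit/B_gt0.
  by move=> i; rewrite formZl// ue mulr0.
- move=> [j|] /=; first exact: espan.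
  exists (fun i => (Num.sqrt (B u u))^-1 * c i).
  by rewrite scaler_sumr; apply: eq_bigr => i _; rewrite scalerA.
Qed.

Lemma orthonormal_independent B I (e : I -> E) : sym_bilinear B ->
  orthonormal_family B e -> independent e.
Proof.
move=> bB oe c ce0 i.
have := form0l bB (e i); rewrite -ce0 form_sumZl// (bigD1 i)//= oe eqxx mulr1.
rewrite big1 ?addr0// => j ji; by rewrite oe (negbTE ji) mulr0.
Qed.

Lemma orthonormal_sum B I (e : I -> E) (c : I -> R) j : sym_bilinear B ->
  orthonormal_family B e -> B (\sum_i c i *: e i) (e j) = c j.
Proof.
move=> bB oe; rewrite form_sumZl// (bigD1 j)//= oe eqxx mulr1.
by rewrite big1 ?addr0// => i ij; rewrite oe (negbTE ij) mulr0.
Qed.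

Lemma orthonormal_sum_sqr B I (e : I -> E) (c : I -> R) : sym_bilinear B ->
  orthonormal_family B e ->
  B (\sum_i c i *: e i) (\sum_i c i *: e i) = \sum_i c i ^+ 2.
Proof.
move=> bB oe; rewrite form_sumZr//.
by apply: eq_bigr => i _; rewrite orthonormal_sum.
Qed.

(* Take a longest orthonormal family: a positive vector orthogonal to it would
   extend it. *)
Lemma maximal_orthonormal B (S : E -> Prop) (N : nat) : sym_bilinear B ->
  (forall a u v, S u -> S v -> S (a *: u + v)) -> S 0 ->
  (forall I (e : I -> E), orthonormal_family B e -> (forall i, S (e i)) ->
     (#|I| <= N)%N) ->
  exists (I : finType) (e : I -> E),
    [/\ orthonormal_family B e, (forall i, S (e i)) &
        forall u, S u -> B u u <= \sum_i B u (e i) ^+ 2].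
Proof.
move=> bB SL S0 bound.
pose P n := `[< exists (I : finType) (e : I -> E),
  [/\ #|I| = n, orthonormal_family B e & forall i, S (e i)] >].
have exP : exists n, P n.
  exists 0%N; apply/asboolP; exists void, (fun v : void => match v with end).
  by split; [rewrite card_void|case|case].
have ubP n : P n -> (n <= N)%N.
  by move=> /asboolP[I [e [<- oe Se]]]; exact: bound oe Se.
case: (ex_maxnP exP ubP) => n /asboolP[I [e [cI oe Se]]] maxn.
exists I, e; split => // u Su; rewrite leNgt; apply/negP => lt_u.
pose v := u - \sum_i B u (e i) *: e i.
have Ssum : S (\sum_i B u (e i) *: e i).
  by apply: big_ind => // [a b Sa Sb|i _];
    [rewrite -[a]scale1r; exact: SL|rewrite -[_ *: _]addr0; exact: SL].
have Sv : S v by rewrite /v addrC -scaleN1r; exact: SL.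
have ve j : B v (e j) = 0 by rewrite formBl// orthonormal_sum// subrr.
have v0 : 0 < B v v.
  (* Since v is orthogonal to the family, B v v = B v u = B u u - sum_i B u (e i)^2. *)
  rewrite /v formBr// -/v form_sumZr// [X in _ - X]big1 ?subr0; last first.
    by move=> i _; rewrite ve mulr0.
  rewrite /v formBl// form_sumZl// subr_gt0 (le_lt_trans _ lt_u)//.
  by apply: ler_sum => i _; rewrite expr2 (formC bB (e i)).
have : P n.+1.
  apply/asboolP.
  exists (option I : finType), (fun i => oapp e ((Num.sqrt (B v v))^-1 *: v) i).
  split.
  - by rewrite card_option cI.
  - apply: orthonormal_option => //; last exact/orthonormal_unit.
    by move=> i; rewrite formZl// ve mulr0.
  - move=> [j|] //=; rewrite -[_ *: _]addr0; exact: SL.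
by move=> /maxn; rewrite ltnn.
Qed.

End Forms.

(** * Riesz representation by approximate minimization *)

Section Riesz.
Variables (R : realType) (E : lmodType R).
Implicit Types (B P H : E -> E -> R) (u v x : E) (I : finType).

Definition linear_functional (F : E -> R) :=
  forall a u v, F (a *: u + v) = a * F u + F v.

(* Completeness is only asked for sequences converging geometrically. *)
Definition complete_form H := forall u : nat -> E,
  (forall i j, (i <= j)%N -> H (u i - u j) (u i - u j) <= 4^-1 ^+ i) ->
  exists l, forall e, 0 < e -> exists n, forall i, (n <= i)%N ->
    H (u i - l) (u i - l) <= e.

Section Solve.
Variables (H P : E -> E -> R) (k K : R) (F : E -> R) (c : R).
Hypotheses (bP : sym_bilinear P) (linF : linear_functional F).
Hypotheses (H_ge0 : forall u, 0 <= H u u) (k_gt0 : 0 < k) (K_gt0 : 0 < K).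
Hypotheses (le_kP : forall u, k * H u u <= P u u).
Hypotheses (le_PK : forall u, P u u <= K * H u u).
Hypotheses (complH : complete_form H) (c_ge0 : 0 <= c).
Hypotheses (leF : forall v, F v ^+ 2 <= c * P v v).

Let P_ge0 u : 0 <= P u u.
Proof. by apply: le_trans (le_kP u); rewrite mulr_ge0// ltW. Qed.

Let F0 : F 0 = 0.
Proof. by have := linF 1 0 0; rewrite scaler0 addr0 mul1r; lra. Qed.

(* A near-minimizer of P v v - 2 F v is a near-solution. *)
Lemma riesz_near (e : R) : 0 < e ->
  exists u, forall v, (P u v - F v) ^+ 2 <= P v v * e.
Proof.
move=> e0; pose J v := P v v - 2 * F v.
have J_lb v : - c <= J v.
  have h := leF v; have hP := P_ge0 v; rewrite /J.
  (* Arithmetic-geometric mean: 4 (F v)^2 <= 4 c P v v <= (c + P v v)^2. *)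
  have h1 : (2 * F v) ^+ 2 <= (c + P v v) ^+ 2.
    by have := sqr_ge0 (c - P v v); rewrite !expr2 in h *; lra.
  have h2 : 0 <= c + P v v by exact: addr_ge0.
  have : 2 * F v <= c + P v v.
    have [F_le0|F_gt0] := leP (2 * F v) 0; first exact: le_trans h2.
    by rewrite -ler_sqr ?nnegrE// ltW.
  lra.
have hasinf : has_inf (range J).
  split; first by exists (J 0), 0.
  by exists (- c) => _ [v _ <-].
have [_ [u _ <-] uinf] := inf_adherent e0 hasinf.
(* As J (t v + u) >= inf J > J u - e for all t, the polynomial t^2 P v v + 2 t (P u v - F v) + e is
   nonnegative. *)
exists u => v; apply: discriminant_le => // t.
have : inf (range J) <= J (t *: v + u).
  by apply: ge_inf; [exact: hasinf.2|exists (t *: v + u)].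
rewrite /J (form_add_sqr bP) (form_scale_sqr bP) (formZl bP) (formC bP v u) linF.
by move: uinf; rewrite /J; lra.
Qed.

(** Near-solutions with errors of order 4^-n are geometrically Cauchy: for the difference d of two
    of them, P d d is a difference of two residuals tested with d, hence controlled by the errors.
    The residual then passes to the limit. *)
Lemma riesz_solve : exists u, forall v, P u v = F v.
Proof.
(* Chosen so that 4 eps n = k 4^-n: the 4 comes from squaring a difference of two residuals, the k
   from comparing P with H. *)
pose eps n : R := k * 4^-1 ^+ n / 4.
have eps_gt0 n : 0 < eps n by rewrite divr_gt0// mulr_gt0// exprn_gt0// invr_gt0.
have /choice[u hu] : forall n, exists u, forall v,
  (P u v - F v) ^+ 2 <= P v v * eps n by move=> n; exact: riesz_near.
have cau i j : (i <= j)%N -> H (u i - u j) (u i - u j) <= 4^-1 ^+ i.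
  move=> ij; set d := u i - u j.
  have eij : eps j <= eps i.
    rewrite /eps ler_pM2r ?invr_gt0// ler_pM2l//.
    by apply: ler_wiXn2l => //; lra.
  have : P d d ^+ 2 <= P d d * (4 * eps i).
    rewrite [X in X ^+ 2](_ : P d d = (P (u i) d - F d) - (P (u j) d - F d)).
      have := hu i d; have := hu j d; have := P_ge0 d.
      set x := P (u i) d - F d; set y := P (u j) d - F d.
      have := sqr_ge0 (x + y); nra.
    by rewrite {1}/d (formBl bP); ring.
  have := le_kP d; have [d0|d0] := eqVneq (P d d) 0.
    rewrite d0 => hd _; apply: (@le_trans _ _ 0); last by rewrite exprn_ge0.
    by rewrite -(ler_pM2l k_gt0) mulr0.
  have {}d0 : 0 < P d d by rewrite lt_neqAle eq_sym d0 P_ge0.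
  rewrite expr2 ler_pM2l// /eps => hd hP.
  have : k * H d d <= k * 4^-1 ^+ i.
    by apply: le_trans hd _; apply: le_trans hP _; rewrite mulrC divfK.
  by rewrite ler_pM2l.
have [l hl] := complH cau.
exists l => v; apply/eqP; rewrite -subr_eq0 -sqrf_eq0 eq_le sqr_ge0 andbT.
apply/ler_addgt0Pl => e e0; rewrite addr0.
(* The added 1 keeps the tolerance e / (4 (P v v + 1)) meaningful when P v v vanishes. *)
have Pv1 : 0 < P v v + 1 by rewrite ltr_wpDl.
have e2 : 0 < e / (4 * (P v v + 1)) / K by rewrite !divr_gt0// mulr_gt0.
have [n hn] := hl _ e2.
have [n' hn'] : exists n', eps n' <= e / (4 * (P v v + 1)).
  have x0 : 0 < e / (4 * (P v v + 1)) / k.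
    by rewrite !divr_gt0// mulr_gt0.
  have : (fun n => 4^-1 ^+ n : R) @ \oo --> (0 : R).
    by apply: cvg_expr; rewrite ger0_norm ?invr_ge0//; lra.
  move=> /cvgrPdist_lt/(_ _ x0)[n' _ /(_ n' (leqnn _))].
  rewrite sub0r normrN ger0_norm ?exprn_ge0// ltr_pdivlMr// => h.
  exists n'; rewrite /eps; have := eps_gt0 n'; rewrite /eps; lra.
pose N := maxn n n'.
have hN := hu N v.
have eN : eps N <= e / (4 * (P v v + 1)).
  apply: le_trans hn'; rewrite /eps ler_pM2r ?invr_gt0// ler_pM2l//.
  by apply: ler_wiXn2l; rewrite ?leq_maxr//; lra.
have {}hn := hn N (leq_maxl _ _).
set d := u N - l in hn.
have hd : P d d <= e / (4 * (P v v + 1)).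
  apply: le_trans (le_PK d) _; rewrite mulrC -ler_pdivlMr//.
have CS := form_CauchySchwarz bP P_ge0 d v.
have -> : P l v - F v = (P (u N) v - F v) - P d v by rewrite /d (formBl bP); ring.
have sq2 (a b : R) : (a - b) ^+ 2 <= 2 * a ^+ 2 + 2 * b ^+ 2.
  by have := sqr_ge0 (a + b); rewrite !expr2; lra.
apply: le_trans (sq2 _ _) _.
have -> : e = 2 * ((P v v + 1) * (e / (4 * (P v v + 1)))) +
              2 * ((e / (4 * (P v v + 1))) * (P v v + 1)).
  by field; rewrite gt_eqF.
have lePv : P v v <= P v v + 1 by rewrite lerDl.
apply: lerD; rewrite ler_pM2l//.
  by apply: le_trans hN _; apply: ler_pM => //; exact: ltW.
by apply: le_trans CS _; apply: ler_pM.
Qed.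

Lemma riesz_solve_le u : (forall v, P u v = F v) -> P u u <= c.
Proof.
move=> hu; have := leF u; rewrite -hu expr2.
have [->|P0] := eqVneq (P u u) 0; first by [].
by rewrite ler_pM2r// lt_neqAle eq_sym P0 P_ge0.
Qed.

End Solve.
End Riesz.

Section FormBounds.
Variables (R : realType) (E : lmodType R) (B : E -> E -> R).
Hypotheses (bB : sym_bilinear B) (B_ge0 : forall u, 0 <= B u u).

Lemma form_add_le u v : B (u + v) (u + v) <= 2 * B u u + 2 * B v v.
Proof.
by have := B_ge0 (u - v); rewrite (form_sub_sqr bB) (form_add_sqr bB); lra.
Qed.

(** The crude factor 2^n is harmless: it enters the norm bound of the solution operator only, never
    the count of eigenvalues. *)
Lemma form_sum_le n (x : 'I_n -> E) :
  B (\sum_i x i) (\sum_i x i) <= 2 ^+ n * \sum_i B (x i) (x i).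
Proof.
elim: n x => [|n IH] x; first by rewrite !big_ord0 mulr0 (form0l bB).
rewrite !big_ord_recl; apply: le_trans (form_add_le _ _) _.
rewrite exprS mulrDr -mulrA; apply: lerD.
  by rewrite ler_pM2l// ler_peMl// exprn_ege1// ler1n.
by rewrite -mulrA ler_pM2l// IH.
Qed.

End FormBounds.

(** * Forms with finitely many negative directions: counting eigenvectors and solving equations *)

Section FiniteIndex.
Variables (R : realType) (E : lmodType R) (D m w : E -> E -> R).
Variables (kappa : R) (N : nat).
Implicit Types (u v x : E) (I J : finType).
Hypotheses (bD : sym_bilinear D) (bm : sym_bilinear m) (bw : sym_bilinear w).
Hypotheses (D_gt0 : forall u, u != 0 -> 0 < D u u).
Hypotheses (m_ge0 : forall u, 0 <= m u u) (w_ge0 : forall u, 0 <= w u u).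
Hypotheses (w_null : forall u, m u u = 0 -> w u u = 0).
Hypotheses (w_le : forall u, w u u <= kappa * D u u).
Hypothesis bound : forall I (e : I -> E), orthonormal_family D e ->
  (forall i, D (e i) (e i) <= 2 * w (e i) (e i)) -> (#|I| <= N)%N.

Let D_ge0 u : 0 <= D u u.
Proof.
by case: (eqVneq u 0) => [->|/D_gt0/ltW//]; rewrite (form0l bD).
Qed.

(** [bound] speaks of D-orthonormal families. Orthonormalizing the span carries it over to
    independent families, since D <= 2 w is imposed on all their combinations. *)
Lemma nonpositive_size I (x : I -> E) : independent x ->
  (forall (c : I -> R) u, u = \sum_i c i *: x i -> D u u <= 2 * w u u) ->
  (#|I| <= N)%N.
Proof.
move=> ix h; have [J [e [<- oe espan]]] := independent_orthonormal bD D_gt0 ix.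
by apply: bound oe _ => j; have [c ->] := espan j; exact: h.
Qed.

Definition eigen l u := forall v, D u v - w u v = l * m u v.

Lemma eigen_lin l a u v : eigen l u -> eigen l v -> eigen l (a *: u + v).
Proof. by move=> eu ev x; rewrite bD.2 bw.2 bm.2 mulrDr -ev mulrCA -eu; ring. Qed.

Lemma eigen_orth l k u v : l != k -> eigen l u -> eigen k v -> m u v = 0.
Proof.
move=> lk eu ev; have := eu v; rewrite (formC bD) (formC bw) ev (formC bm v u).
move/eqP; rewrite -subr_eq0 -mulrBl mulf_eq0 subr_eq0 eq_sym (negbTE lk) /=.
by move/eqP.
Qed.

(** Tested with u itself: if m u u = 0, then w u u = 0, so D u u = 0 and u = 0. *)
Lemma eigen_gt0 l u : eigen l u -> u != 0 -> 0 < m u u.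
Proof.
move=> eu u0; rewrite lt_neqAle m_ge0 andbT eq_sym.
apply: contraL (D_gt0 u0) => /eqP m0.
by have := eu u; rewrite m0 mulr0 (w_null m0) subr0 => ->; rewrite ltxx.
Qed.

(** On the span, D - w is a sum of squares with the nonpositive coefficients l i; as w >= 0, this
    gives D <= w <= 2 w there. *)
Lemma eigen_size I (x : I -> E) (l : I -> R) : orthonormal_family m x ->
  (forall i, l i <= 0) -> (forall i, eigen (l i) (x i)) -> (#|I| <= N)%N.
Proof.
move=> ox l0 ex; apply: nonpositive_size (orthonormal_independent bm ox) _ => c u uE.
have : D u u - w u u <= 0.
  rewrite {1 3}uE (form_suml bD) (form_suml bw) -sumrB.
  apply: sumr_le0 => i _; rewrite (formZl bD) (formZl bw) -mulrBr ex.
  rewrite mulrCA -(formZl bm) {1}uE (form_sumr bm) (bigD1 i)//= big1 ?addr0.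
    by rewrite mulr_le0_ge0// m_ge0.
  by move=> j ji; rewrite (formZl bm) (formZr bm) ox eq_sym (negbTE ji) !mulr0.
by have := w_ge0 u; lra.
Qed.

(** A maximal m-orthonormal family exists because [eigen_size] bounds the size of all of them, and
    maximality reverses Bessel's inequality. The remainder has m-norm zero, which for the L_2 form
    means zero almost everywhere. *)
Lemma eigenbasis l : l < 0 -> exists (I : finType) (e : I -> E),
  [/\ orthonormal_family m e, forall i, eigen l (e i) &
      forall u, eigen l u -> let v := u - \sum_i m u (e i) *: e i in m v v = 0].
Proof.
move=> l0; have [|||I [e [oe ee emax]]] :=
  @maximal_orthonormal R E m (eigen l) N bm.
- by move=> a u v; exact: eigen_lin.
- by move=> v; rewrite (form0l bD) (form0l bw) (form0l bm) mulr0 subrr.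
- move=> I e oe ee; apply: (eigen_size (l := fun=> l)) => // _; exact: ltW.
exists I, e; split => // u eu v.
apply/eqP; rewrite eq_le m_ge0 andbT /v (form_sub_sqr bm).
rewrite (orthonormal_sum_sqr _ bm oe) (form_sumZr bm).
have := emax u eu; under [X in _ <= X]eq_bigr do rewrite expr2.
under [X in _ + X]eq_bigr do rewrite expr2.
lra.
Qed.

(** Eigenvectors of distinct eigenvalues are m-orthogonal, so the disjoint union of the families,
    indexed by a sigma type, is again orthonormal. *)
Lemma eigen_total_size (K : finType) (l : K -> R) (I : K -> finType)
    (e : forall k, I k -> E) : injective l -> (forall k, l k <= 0) ->
  (forall k, orthonormal_family m (@e k)) ->
  (forall k i, eigen (l k) (@e k i)) -> (\sum_k #|I k| <= N)%N.
Proof.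
move=> il l0 oe ee.
have := @eigen_size {k : K & I k} (fun s => e (tag s) (tagged s)) (fun s => l (tag s)).
rewrite card_tagged sumnE big_map big_enum; apply => // [[j i] [k i']] /=.
have [jk|jk] := eqVneq j k; last first.
  rewrite (eigen_orth _ (ee j i) (ee k i')); last by rewrite (inj_eq il).
  by case: eqVneq => // /(congr1 tag)/= /eqP; rewrite (negbTE jk).
by move: i'; case: k / jk => i'; rewrite oe eq_Tagged.
Qed.

(** With F the m-product with some f and c the squared norm of f, this is the surjectivity of the
    operator plus lam, and K bounds the square of the norm of a right inverse. *)
Definition form_solvable lam := exists K : R, 0 <= K /\
  forall F c, linear_functional F -> 0 <= c ->
    (forall v, F v ^+ 2 <= c * m v v) ->
    exists u, (forall v, D u v - w u v + lam * m u v = F v) /\ m u u <= K * c.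

Section Solve.
Variable lam : R.
Hypotheses (lam_gt0 : 0 < lam).
Hypothesis complH : complete_form (fun u v => D u v + m u v).
Hypothesis ker0 : forall u, eigen (- lam) u -> u = 0.

(** The condition D <= 2 w in [bound] reads q <= 0. *)
Let q u v := D u v - 2 * w u v.

Let bq : sym_bilinear q.
Proof.
split=> [u v|a u v x]; first by rewrite /q (formC bD) (formC bw).
by rewrite /q bD.2 bw.2; ring.
Qed.

Let bqN : sym_bilinear (fun u v => - q u v).
Proof.
split=> [u v|a u v x]; first by rewrite (formC bq).
by rewrite bq.2; ring.
Qed.

(** The constant comes from (x - 2 y)^2 <= 2 x^2 + 8 y^2. *)
Let q_sqr_le u v : q u v ^+ 2 <= (2 + 8 * kappa ^+ 2) * (D u u * D v v).
Proof.
have h1 := form_CauchySchwarz bD D_ge0 u v.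
have h2 : w u v ^+ 2 <= kappa ^+ 2 * (D u u * D v v).
  apply: le_trans (form_CauchySchwarz bw w_ge0 u v) _.
  by rewrite expr2 mulrACA; apply: ler_pM.
have := sqr_ge0 (D u v + 2 * w u v); rewrite /q; move: h1 h2.
rewrite !expr2; set a := D u v; set b := w u v; set z := D u u * D v v.
move: (kappa * kappa) => k2; lra.
Qed.

(* The finitely many q-negative directions are compensated by a finite rank
   perturbation, which makes the form coercive. *)
Lemma finite_index_solve : form_solvable lam.
Proof.
have [|||I [e' [oe' _ emax']]] :=
    @maximal_orthonormal R E (fun u v => - q u v) (fun=> True) N bqN => //.
  (* On the span of an orthonormal family of - q, the form q is minus a sum of squares, so D <= 2 w
     there and N bounds its size. *)
  move=> I e oe _; apply: nonpositive_size (orthonormal_independent bqN oe) _ => c u uE.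
  have := orthonormal_sum_sqr c bqN oe; rewrite -uE /q => h.
  have : 0 <= \sum_i c i ^+ 2 by apply: sumr_ge0 => i _; exact: sqr_ge0.
  by rewrite -h; lra.
pose n := #|I|; pose e (i : 'I_n) := e' (enum_val i).
have emax u : - q u u <= \sum_i q u (e i) ^+ 2.
  apply: le_trans (emax' u Logic.I) _.
  rewrite (reindex (@enum_val I I)) /=; last exact/onW_bij/enum_val_bij.
  by apply: ler_sum => i _; rewrite sqrrN.
(* By [emax], half of the sum of squares outweighs the negative part of q / 2 in D - w = (D + q) /
   2, whence P >= D / 2 + lam m. *)
pose P u v := D u v - w u v + lam * m u v + 2^-1 * \sum_i q u (e i) * q v (e i).
have bP : sym_bilinear P.
  split=> [u v|a u v x]; rewrite /P.
    rewrite (formC bD) (formC bw) (formC bm); congr (_ + _ * _).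
    by apply: eq_bigr => i _; rewrite mulrC.
  rewrite bD.2 bw.2 bm.2.
  have -> : \sum_i q (a *: u + v) (e i) * q x (e i) =
      a * (\sum_i q u (e i) * q x (e i)) + \sum_i q v (e i) * q x (e i).
    rewrite mulr_sumr -big_split /=; apply: eq_bigr => i _.
    by rewrite bq.2; ring.
  ring.
pose H u v := D u v + m u v.
pose k := Num.min 2^-1 lam.
have k0 : 0 < k by rewrite lt_min lam_gt0 invr_gt0 ltr0n.
have P_ge u : 2^-1 * D u u + lam * m u u <= P u u.
  rewrite /P; have := emax u; rewrite {1}/q.
  under eq_bigr do rewrite expr2.
  move: (\sum_i _) => S; lra.
have le_kP u : k * H u u <= P u u.
  apply: le_trans (P_ge u); rewrite /H mulrDr; apply: lerD.
    by rewrite ler_wpM2r// ge_min lexx.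
  by rewrite ler_wpM2r// ge_min lexx orbT.
pose K := 1 + lam + (2 + 8 * kappa ^+ 2) * \sum_i D (e i) (e i).
have SD : 0 <= \sum_i D (e i) (e i) by apply: sumr_ge0.
have k8 : 0 <= 2 + 8 * kappa ^+ 2 by rewrite addr_ge0// mulr_ge0// sqr_ge0.
have K0 : 0 < K.
  by rewrite /K -addrA ltr_pwDl// addr_ge0 ?mulr_ge0// ltW.
have le_PK u : P u u <= K * H u u.
  have h : \sum_i q u (e i) * q u (e i) <=
      (2 + 8 * kappa ^+ 2) * (\sum_i D (e i) (e i)) * D u u.
    rewrite mulrAC mulr_sumr; apply: ler_sum => i _; rewrite -expr2.
    by apply: le_trans (q_sqr_le _ _) _; rewrite mulrA.
  rewrite /P /K /H; move: h; set S := \sum_i _; set S' := (_ * _) * D u u.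
  have -> : (1 + lam + (2 + 8 * kappa ^+ 2) * (\sum_i D (e i) (e i))) *
     (D u u + m u u) = D u u + m u u + lam * D u u + lam * m u u + S' +
     (2 + 8 * kappa ^+ 2) * (\sum_i D (e i) (e i)) * m u u.
    by rewrite /S'; ring.
  have h1 : 0 <= lam * D u u by rewrite mulr_ge0// ltW.
  have h2 : 0 <= (2 + 8 * kappa ^+ 2) * (\sum_i D (e i) (e i)) * m u u.
    by rewrite !mulr_ge0.
  have h3 : 0 <= S' by rewrite !mulr_ge0.
  have := w_ge0 u; have := m_ge0 u; move: h1 h2 h3.
  move: (_ * m u u) (lam * D u u) S S' => *; lra.
have P_ge0 u : 0 <= P u u.
  apply: le_trans (P_ge u); rewrite addr_ge0// mulr_ge0// ?invr_ge0//; exact: ltW.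
have H_ge0 u : 0 <= H u u by rewrite addr_ge0.
have Dle u : D u u <= 2 * P u u.
  by have := P_ge u; have : 0 <= lam * m u u by [rewrite mulr_ge0// ltW]; lra.
pose qc i := (2 + 8 * kappa ^+ 2) * (2 * D (e i) (e i)).
have qc0 i : 0 <= qc i by rewrite !mulr_ge0.
have q_le i v : q v (e i) ^+ 2 <= qc i * P v v.
  apply: le_trans (q_sqr_le _ _) _; rewrite /qc -!mulrA.
  apply: ler_wpM2l => //; rewrite mulrC mulrCA; apply: ler_wpM2l => //.
have /choice[g hg] : forall i, exists u, forall v, P u v = q v (e i).
  move=> i; apply: (@riesz_solve R E H P k K (fun v => q v (e i)) (qc i)) => //.
  by move=> a u v; rewrite bq.2.
(* If u0 solves the problem for P, the unperturbed problem is solved by u0 + sum_i cc_i g_i as soon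
   as cc_i = q u (e i) / 2 for this very u. That is a linear system for cc with matrix T. A vector
   in the kernel of T produces an eigenvector for - lam, excluded by [ker0]. *)
pose T : 'M[R]_n := \matrix_(i, j) ((i == j)%:R - 2^-1 * q (g i) (e j)).
have T_unit : T \in unitmx.
  rewrite -row_free_unit -kermx_eq0; apply/rowV0P => c /sub_kermxP cT.
  pose u := \sum_i c 0 i *: g i.
  have qu j : q u (e j) = 2 * c 0 j.
    have /rowP/(_ j) := cT; rewrite !mxE.
    under eq_bigr do rewrite !mxE mulrBr.
    rewrite sumrB (bigD1 j)//= eqxx mulr1 big1 ?addr0; last first.
      by move=> i ij; rewrite (negbTE ij) mulr0.
    move/eqP; rewrite subr_eq0 => /eqP ->.
    rewrite /u (form_sumZl bq) mulr_sumr; apply: eq_bigr => i _.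
    by field.
  have u0 : u = 0.
    apply: ker0 => v.
    have : P u v = \sum_i c 0 i * q v (e i).
      by rewrite /u (form_sumZl bP); apply: eq_bigr => i _; rewrite hg.
    rewrite /P; have -> : \sum_i q u (e i) * q v (e i) =
        2 * \sum_i c 0 i * q v (e i).
      by rewrite mulr_sumr; apply: eq_bigr => i _; rewrite qu mulrA.
    by move: (\sum_i _) => S; lra.
  apply/rowP => j; rewrite mxE.
  by have := qu j; rewrite u0 (form0l bq); lra.
(* Regrouped along [h], the correction has the coefficients q u0 (e j) / 2, which are bounded
   functionals of u0. The resulting norm bound depends on F through c only. *)
pose h j := \sum_i invmx T j i *: g i.
exists (2 * (lam^-1 * lam^-1) +
  2 * (2 ^+ n * \sum_j (qc j * lam^-1 * m (h j) (h j)))); split.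
  have il : 0 <= lam^-1 by rewrite invr_ge0 ltW.
  rewrite addr_ge0 ?mulr_ge0// ?exprn_ge0//; apply: sumr_ge0 => j _.
  by rewrite !mulr_ge0.
move=> F c linF c0 leF.
have mP u : m u u <= lam^-1 * P u u.
  rewrite -(ler_pM2l lam_gt0) mulrA divff ?gt_eqF// mul1r.
  by have := P_ge u; have : 0 <= 2^-1 * D u u by [rewrite mulr_ge0// invr_ge0]; lra.
have leFP v : F v ^+ 2 <= (c * lam^-1) * P v v.
  by apply: le_trans (leF v) _; rewrite -mulrA ler_wpM2l.
have cl0 : 0 <= c * lam^-1 by rewrite mulr_ge0// invr_ge0 ltW.
have [u0 hu0] := @riesz_solve R E H P k K F (c * lam^-1)
  bP linF H_ge0 k0 K0 le_kP le_PK complH cl0 leFP.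
have Pu0 : P u0 u0 <= c * lam^-1.
  exact: (@riesz_solve_le R E H P k F (c * lam^-1)).
pose d : 'rV[R]_n := \row_j (2^-1 * q u0 (e j)).
pose u := u0 + \sum_j d 0 j *: h j.
pose cc := d *m invmx T.
have uE : u = u0 + \sum_i cc 0 i *: g i.
  rewrite /u; congr (_ + _); rewrite /h.
  under eq_bigr do rewrite scaler_sumr.
  rewrite exchange_big /=; apply: eq_bigr => i _.
  by rewrite mxE scaler_suml; apply: eq_bigr => j _; rewrite scalerA.
have qu j : q u (e j) = 2 * cc 0 j.
  have : cc *m T = d by rewrite /cc mulmxKV.
  move/rowP/(_ j); rewrite mxE [RHS]mxE.
  under eq_bigr do rewrite [T _ _]mxE mulrBr.
  rewrite sumrB (bigD1 j)//= eqxx mulr1 big1 ?addr0; last first.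
    by move=> i ij; rewrite (negbTE ij) mulr0.
  rewrite uE (formDl bq) (form_sumZl bq).
  have -> : \sum_i cc 0 i * (2^-1 * q (g i) (e j)) =
      2^-1 * \sum_i cc 0 i * q (g i) (e j).
    by rewrite mulr_sumr; apply: eq_bigr => i _; rewrite mulrCA.
  by move: (\sum_i _) => S; lra.
exists u; split.
  move=> v.
  have : P u v = F v + \sum_i cc 0 i * q v (e i).
    rewrite uE (formDl bP) hu0 (form_sumZl bP); congr (_ + _).
    by apply: eq_bigr => i _; rewrite hg.
  rewrite /P; have -> : \sum_i q u (e i) * q v (e i) =
      2 * \sum_i cc 0 i * q v (e i).
    by rewrite mulr_sumr; apply: eq_bigr => i _; rewrite qu mulrA.
  by move: (\sum_i _) => S; lra.
apply: le_trans (form_add_le bm m_ge0 _ _) _.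
rewrite [leRHS]mulrDl; apply: lerD; rewrite -!mulrA ler_pM2l//.
  apply: le_trans (mP u0) _; rewrite ler_wpM2l ?invr_ge0 ?(ltW lam_gt0)//.
  by rewrite mulrC.
apply: le_trans (form_sum_le bm m_ge0 _) _.
rewrite ler_pM2l ?exprn_gt0// mulr_suml; apply: ler_sum => j _.
rewrite (form_scale_sqr bm) [leRHS]mulrAC; apply: ler_wpM2r => //.
rewrite mxE exprMn; apply: (@le_trans _ _ (q u0 (e j) ^+ 2)).
  by rewrite ler_piMl ?sqr_ge0// exprn_ile1// ?invr_ge0// invf_le1// ler1n.
apply: le_trans (q_le _ _) _; have -> : qc j / lam * c = qc j * (c / lam).
  by move: (qc j) => a; ring.
exact: ler_wpM2l.
Qed.

End Solve.
End FiniteIndex.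

(** * Real square-integrable functions on a measure space *)

Section SquareIntegrable.
Context d (T : measurableType d) (R : realType).
Variable mu : {measure set T -> \bar R}.
Implicit Types f g h : T -> R.

Definition sqint f :=
  measurable_fun setT f /\ (\int[mu]_x (f x ^+ 2)%:E < +oo)%E.

Definition dot f g : R := \int[mu]_x (f x * g x).

Lemma measurable_EFin_sqr f : measurable_fun setT f ->
  measurable_fun setT (fun x => (f x ^+ 2)%:E).
Proof. by move=> mf; apply/measurable_EFinP; exact: measurable_funX. Qed.

Lemma sqint_mul_integrable f g : sqint f -> sqint g ->
  mu.-integrable setT (EFin \o (fun x => f x * g x)).
Proof.
move=> [mf f2] [mg g2]; apply/integrableP; split.
  by apply/measurable_EFinP; exact: measurable_funM.
apply: (@le_lt_trans _ _ (\int[mu]_x ((f x ^+ 2)%:E + (g x ^+ 2)%:E))%E).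
  apply: ge0_le_integral => //.
  - apply: measurableT_comp => //; apply/measurable_EFinP.
    exact: measurable_funM.
  - by apply: emeasurable_funD; exact: measurable_EFin_sqr.
  - move=> x _ /=; rewrite -EFinD lee_fin ler_norml.
    have h1 := sqr_ge0 (f x + g x); have h2 := sqr_ge0 (f x - g x).
    have h3 := sqr_ge0 (f x); have h4 := sqr_ge0 (g x).
    rewrite !expr2 in h1 h2 h3 h4 *; apply/andP; split; lra.
rewrite ge0_integralD//; last 4 first.
- by move=> x _; rewrite lee_fin sqr_ge0.
- exact: measurable_EFin_sqr.
- by move=> x _; rewrite lee_fin sqr_ge0.
- exact: measurable_EFin_sqr.
exact: lte_add_pinfty.
Qed.

Lemma dotE f : sqint f -> (dot f f)%:E = (\int[mu]_x (f x ^+ 2)%:E)%E.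
Proof.
move=> [mf f2]; rewrite /dot /Rintegral fineK; last first.
  rewrite ge0_fin_numE//; apply: integral_ge0 => x _.
  by rewrite lee_fin -expr2 sqr_ge0.
by apply: eq_integral => x _; rewrite expr2.
Qed.

Lemma sqint0 : sqint (fun=> 0).
Proof.
split=> //; rewrite (eq_integral (cst 0%E)) ?integral0//.
by move=> x _; rewrite expr0n.
Qed.

Lemma sqint_lin a f g : sqint f -> sqint g -> sqint (fun x => a * f x + g x).
Proof.
move=> [mf f2] [mg g2]; split.
  by apply: measurable_funD => //; exact: measurable_funM.
apply: (@le_lt_trans _ _ (\int[mu]_x ((2 * a ^+ 2)%:E * (f x ^+ 2)%:E +
    2%:E * (g x ^+ 2)%:E))%E).
  apply: ge0_le_integral => //.
  - by move=> x _; rewrite lee_fin sqr_ge0.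
  - apply: measurable_EFin_sqr.
    by apply: measurable_funD => //; exact: measurable_funM.
  - by apply: emeasurable_funD; apply: measurable_funeM;
      exact: measurable_EFin_sqr.
  - move=> x _; rewrite -!EFinM -EFinD lee_fin.
    have := sqr_ge0 (a * f x - g x); rewrite !expr2; lra.
rewrite ge0_integralD//; last 4 first.
- by move=> x _; rewrite -EFinM lee_fin mulr_ge0 ?sqr_ge0// mulr_ge0 ?sqr_ge0.
- by apply: measurable_funeM; exact: measurable_EFin_sqr.
- by move=> x _; rewrite -EFinM lee_fin mulr_ge0// sqr_ge0.
- by apply: measurable_funeM; exact: measurable_EFin_sqr.
rewrite ge0_integralZl//; last 3 first.
- exact: measurable_EFin_sqr.
- by move=> x _; rewrite lee_fin sqr_ge0.
- by rewrite lee_fin mulr_ge0// sqr_ge0.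
rewrite ge0_integralZl//; last 2 first.
- exact: measurable_EFin_sqr.
- by move=> x _; rewrite lee_fin sqr_ge0.
apply: lte_add_pinfty.
  by apply: lte_mul_pinfty => //; rewrite lee_fin mulr_ge0// sqr_ge0.
exact: lte_mul_pinfty.
Qed.

Lemma sqintB f g : sqint f -> sqint g -> sqint (fun x => f x - g x).
Proof.
move=> sf sg; have := sqint_lin (-1) sg sf.
by congr sqint; apply/funext => x; rewrite mulN1r addrC.
Qed.

Lemma dotC f g : dot f g = dot g f.
Proof. by apply: eq_Rintegral => x _; rewrite mulrC. Qed.

Lemma dot_lin a f g h : sqint f -> sqint g -> sqint h ->
  dot (fun x => a * f x + g x) h = a * dot f h + dot g h.
Proof.
move=> sf sg sh; rewrite /dot -RintegralZl//; last exact: sqint_mul_integrable.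
rewrite -RintegralD//; last 2 first.
- have := sqint_mul_integrable (sqint_lin a sf sqint0) sh.
  by apply: eq_integrable => // x _ /=; rewrite addr0 mulrA.
- exact: sqint_mul_integrable.
by apply: eq_Rintegral => x _; rewrite mulrDl mulrA.
Qed.

Lemma dot_ge0 f : 0 <= dot f f.
Proof. by apply: Rintegral_ge0 => x _; rewrite -expr2 sqr_ge0. Qed.

Lemma dot_CauchySchwarz f g : sqint f -> sqint g ->
  dot f g ^+ 2 <= dot f f * dot g g.
Proof.
move=> sf sg; apply: discriminant_le => [|t]; first exact: dot_ge0.
have := dot_ge0 (fun x => t * f x + g x).
have sh := sqint_lin t sf sg.
rewrite (dot_lin _ sf sg sh) !(dotC _ (fun x => t * f x + g x)).
rewrite (dot_lin _ sf sg sf) (dot_lin _ sf sg sg) (dotC g f).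
move=> le0; apply: (le_trans le0); rewrite le_eqVlt; apply/orP; left; apply/eqP.
ring.
Qed.

Lemma dot_ae f g f' g' : sqint f -> sqint g -> sqint f' -> sqint g' ->
  {ae mu, forall x, f x = f' x} -> {ae mu, forall x, g x = g' x} ->
  dot f g = dot f' g'.
Proof.
move=> sf sg sf' sg' ff' gg'; rewrite /dot /Rintegral; congr fine.
apply: ae_eq_integral => //.
- exact/(measurable_int mu)/(sqint_mul_integrable sf sg).
- exact/(measurable_int mu)/(sqint_mul_integrable sf' sg').
by apply: filterS2 ff' gg' => x -> ->.
Qed.

Lemma dot_eq0 f : sqint f -> dot f f = 0 -> {ae mu, forall x, f x = 0}.
Proof.
move=> sf f0; have := dotE sf; rewrite f0 => /esym.
have [mf _] := sf.
rewrite (eq_integral (fun x => `|(f x ^+ 2)%:E|%E)); last first.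
  by move=> x _; rewrite /= ger0_norm ?sqr_ge0.
move/ae_eq_integral_abs => /(_ measurableT (measurable_EFin_sqr mf)).
by apply: filterS => x /(_ Logic.I) [] /eqP; rewrite sqrf_eq0 => /eqP.
Qed.

Lemma sqint_indic (A : set T) : measurable A -> (mu A < +oo)%E ->
  sqint (\1_A).
Proof.
move=> mA Aoo; split=> //.
rewrite (eq_integral (fun x => (\1_A x)%:E)).
  by rewrite integral_indic// setIT.
by move=> x _; rewrite indicE; case: (_ \in _); rewrite ?expr1n ?expr0n.
Qed.

(** Turns integrals over sets into inner products, to which the Cauchy-Schwarz inequality and L_2
    limits apply. *)
Lemma dot_indic (A : set T) f : measurable A ->
  \int[mu]_(x in A) f x = dot f \1_A.
Proof.
move=> mA; rewrite Rintegral_mkcond; apply: eq_Rintegral => x _.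
by rewrite patchE indicE; case: ifPn => _; rewrite ?mulr1 ?mulr0.
Qed.

Lemma dot_indicE (A : set T) : measurable A -> (mu A < +oo)%E ->
  (dot \1_A \1_A)%:E = mu A.
Proof.
move=> mA Aoo; rewrite (dotE (sqint_indic mA Aoo)).
rewrite (eq_integral (fun x => (\1_A x)%:E)).
  by rewrite integral_indic// setIT.
by move=> x _; rewrite indicE; case: (_ \in _); rewrite ?expr1n ?expr0n.
Qed.

End SquareIntegrable.

(** * Completeness of L_2 along geometrically convergent sequences *)

Section Completeness.
Context d (T : measurableType d) (R : realType).
Variable mu : {measure set T -> \bar R}.
Local Notation sqint := (sqint mu).
Local Notation dot := (dot mu).
Variable f : nat -> T -> R.
Hypothesis sf : forall i, sqint (f i).
Hypothesis cauchy : forall i j, (i <= j)%N ->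
  dot (fun x => f i x - f j x) (fun x => f i x - f j x) <= 4^-1 ^+ i.

Let g k x : R := 2 ^+ k * (f k x - f k.+1 x) ^+ 2.
Let G x : \bar R := (\sum_(k <oo) (g k x)%:E)%E.

Let g_ge0 k x : 0 <= g k x.
Proof. by rewrite mulr_ge0 ?sqr_ge0 ?exprn_ge0. Qed.

Let mg k : measurable_fun setT (fun x => (g k x)%:E).
Proof.
apply/measurable_EFinP; apply: measurable_funM => //.
apply: measurable_funX; apply: measurable_funB; first exact: (sf _).1.
exact: (sf _).1.
Qed.

Let mG : measurable_fun setT G.
Proof.
by apply: ge0_emeasurable_sum => // k x _ _; rewrite lee_fin g_ge0.
Qed.

Let int_g k : (\int[mu]_x (g k x)%:E <= (2^-1 ^+ k)%:E)%E.
Proof.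
have sd := sqintB (sf k) (sf k.+1).
rewrite (eq_integral (fun x => (2 ^+ k)%:E *
  ((f k x - f k.+1 x) ^+ 2)%:E)%E)//.
rewrite ge0_integralZl//; last 2 first.
- exact/measurable_EFin_sqr/sd.1.
- by move=> x _; rewrite lee_fin sqr_ge0.
rewrite -dotE// -EFinM lee_fin.
apply: (@le_trans _ _ (2 ^+ k * 4^-1 ^+ k)).
  by rewrite ler_pM2l ?exprn_gt0// cauchy.
by rewrite -exprMn (_ : 2 * 4^-1 = 2^-1 :> R)//; field.
Qed.

Let int_G : (\int[mu]_x G x <= 2%:E)%E.
Proof.
rewrite integral_nneseries//; last by move=> k x _; rewrite lee_fin g_ge0.
apply: lime_le.
  by apply: is_cvg_nneseries => k _ _; apply: integral_ge0 => x _; rewrite lee_fin g_ge0.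
apply: nearW => n; apply: (@le_trans _ _ (\sum_(0 <= k < n) (2^-1 ^+ k)%:E)%E).
  by apply: lee_sum => k _; exact: int_g.
rewrite sumEFin lee_fin.
suff -> : \sum_(0 <= k < n) 2^-1 ^+ k = 2 - 2 * 2^-1 ^+ n :> R.
  by rewrite lerBlDr lerDl mulr_ge0// exprn_ge0// invr_ge0.
elim: n => [|n IH]; first by rewrite big_nil expr0 mulr1 subrr.
by rewrite big_nat_recr//= IH exprS; field.
Qed.

Let G_ge0 x : (0 <= G x)%E.
Proof. by apply: nneseries_ge0 => k _ _; rewrite lee_fin g_ge0. Qed.

(** Telescoping with (x + y)^2 <= 2 x^2 + 2 y^2: the factor 2 lost at each step is what the weight
    2^k in [g] pays for. *)
Let diff_le i n x : (((f i x - f (i + n)%N x) ^+ 2)%:E <=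
  (2 * 2^-1 ^+ i)%:E * \sum_(i <= k < i + n) (g k x)%:E)%E.
Proof.
rewrite sumEFin -EFinM lee_fin.
elim: n i => [|n IH] i.
  by rewrite addn0 subrr expr0n/= mulr_ge0 ?mulr_ge0 ?exprn_ge0 ?invr_ge0// sumr_ge0.
rewrite big_ltn ?ltnS ?leq_addr//; last by rewrite -[X in (X < _)%N]addn0 ltn_add2l.
have := IH i.+1; rewrite addSnnS; set S := \sum_(_ <= k < _) _.
set a := f i x; set b := f i.+1 x; set c := f (i + n.+1)%N x => h.
have -> : 2 * 2^-1 ^+ i * (g i x + S) = 2 * (a - b) ^+ 2 + 2 * (2 * 2^-1 ^+ i.+1 * S).
  rewrite /g -/a -/b mulrDr (exprS _ i); congr (_ + _); last by field.
  rewrite mulrA -(mulrA 2 _ (2 ^+ i)) -exprMn mulVf ?expr1n ?mulr1//.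
have := sqr_ge0 ((a - b) - (b - c)); move: h; set X := _ * S.
rewrite !expr2; lra.
Qed.

Let diff_leG i n x : (((f i x - f (i + n)%N x) ^+ 2)%:E <= (2 * 2^-1 ^+ i)%:E * G x)%E.
Proof.
apply: le_trans (diff_le i n x) _; apply: lee_wpmul2l.
  by rewrite lee_fin mulr_ge0// exprn_ge0// invr_ge0.
apply: (@le_trans _ _ (\sum_(0 <= k < i + n) (g k x)%:E)%E).
  rewrite [leRHS](big_cat_nat (n := i))//= ?leq_addr// leeDr//.
  by apply: sume_ge0 => k _; rewrite lee_fin g_ge0.
by apply: nneseries_lim_ge => k _ _; rewrite lee_fin g_ge0.
Qed.

Let A := [set x | (G x < +oo)%E].

Let mA : measurable A.
Proof. by rewrite -[A]setTI; exact: emeasurable_fun_lt. Qed.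

Let half_cvg0 : (fun i => 2^-1 ^+ i : R) @ \oo --> (0 : R).
Proof. by apply: cvg_expr; rewrite ger0_norm ?invr_ge0//; lra. Qed.

Let small_diff x e : A x -> 0 < e ->
  exists i, forall n, (f i x - f (i + n)%N x) ^+ 2 < e.
Proof.
move=> Ax e0; have Gf : G x \is a fin_num by rewrite ge0_fin_numE.
have c0 : 0 < 2 * (fine (G x) + 1).
  by rewrite mulr_gt0// ltr_wpDl// fine_ge0.
have ec : 0 < e / (2 * (fine (G x) + 1)) by rewrite divr_gt0.
have /cvgrPdist_lt/(_ _ ec)[i _ /(_ i (leqnn _))] := half_cvg0.
rewrite sub0r normrN ger0_norm ?exprn_ge0 ?invr_ge0// ltr_pdivlMr// => h.
exists i => n; apply: le_lt_trans h.
have := diff_leG i n x; rewrite -[G x]fineK// -EFinM lee_fin => /le_trans; apply.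
rewrite -mulrA mulrCA ler_wpM2l ?exprn_ge0 ?invr_ge0//.
by rewrite ler_pM2l// lerDl.
Qed.

Let cvgA x : A x -> cvgn (f ^~ x).
Proof.
move=> Ax; apply/cauchy_cvgP; apply: cauchy_exP => e e0.
have e2 : 0 < e ^+ 2 by rewrite exprn_gt0.
have [i hi] := small_diff Ax e2.
exists (f i x); exists i => // j /= ij; rewrite /ball_ /=.
have := hi (j - i)%N; rewrite subnKC// -(real_normK (num_real (_ - _))).
by rewrite ltr_pXn2r// nnegrE// ltW.
Qed.

(** The sequence is cut off outside [A], so that the limit exists everywhere and is measurable. *)
Let l x : R := limn (fun i => f i x * \1_A x).

Let cvg_l x : (fun i => f i x * \1_A x) @ \oo --> l x.
Proof.
rewrite /l; suff : cvgn (fun i => f i x * \1_A x) by [].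
rewrite indicE; have [/set_mem Ax|nAx] := boolP (x \in A).
  by apply: is_cvgM; [exact: cvgA|exact: is_cvg_cst].
rewrite (_ : (fun i => _) = (fun=> 0)); first exact: is_cvg_cst.
by apply/funext => i; rewrite mulr0.
Qed.

Let ml : measurable_fun setT l.
Proof.
apply: (@measurable_fun_cvg _ _ _ setT (fun i x => f i x * \1_A x)).
  move=> i; apply: measurable_funM; first exact: (sf _).1.
  exact: measurable_indic.
by move=> x _; exact: cvg_l.
Qed.

Let lim_leG i x : A x -> (((f i x - l x) ^+ 2)%:E <= (2 * 2^-1 ^+ i)%:E * G x)%E.
Proof.
move=> Ax; have Gf : G x \is a fin_num by rewrite ge0_fin_numE.
rewrite -[G x]fineK// -EFinM lee_fin.
have cl : (fun n => (f i x - f (i + n)%N x) ^+ 2) @ \oo --> (f i x - l x) ^+ 2.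
  under eq_fun do rewrite expr2.
  rewrite expr2; have h : (fun n => f i x - f (i + n)%N x) @ \oo --> f i x - l x.
    apply: cvgB; first exact: cvg_cst.
    have := @cvg_l x; rewrite indicE mem_set// => h.
    have hf : f ^~ x @ \oo --> l x by move: h; under eq_fun do rewrite mulr1.
    by apply: cvg_comp hf; exact: cvg_addnl.
  exact: cvgM.
rewrite -(cvg_lim _ cl)//; apply: limr_le; first by apply/cvg_ex; eexists; exact: cl.
apply: nearW => n.
by have := diff_leG i n x; rewrite -[G x]fineK// -EFinM lee_fin.
Qed.

Let A_ae : {ae mu, forall x, A x}.
Proof.
have iG : mu.-integrable setT G.
  apply/integrableP; split=> //.
  rewrite (eq_integral G); last by move=> x _; rewrite gee0_abs.
  exact: le_lt_trans int_G (ltry _).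
by apply: filterS (integrable_ae measurableT iG) => x /(_ Logic.I) h;
  rewrite /A /= -ge0_fin_numE.
Qed.

Let int_lim i : (\int[mu]_x ((f i x - l x) ^+ 2)%:E <= (4 * 2^-1 ^+ i)%:E)%E.
Proof.
have c0 : (0 <= (2 * 2^-1 ^+ i)%:E :> \bar R)%E.
  by rewrite lee_fin mulr_ge0// exprn_ge0// invr_ge0.
apply: (@le_trans _ _ (\int[mu]_x ((2 * 2^-1 ^+ i)%:E * G x))%E).
  apply: ae_ge0_le_integral => //.
  - by move=> x _; rewrite lee_fin sqr_ge0.
  - by apply: measurable_EFin_sqr; apply: measurable_funB => //; exact: (sf _).1.
  - by move=> x _; exact: mule_ge0.
  - exact: measurable_funeM.
  - by apply: filterS A_ae => x Ax _; exact: lim_leG.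
rewrite ge0_integralZl//; apply: le_trans (lee_wpmul2l c0 int_G) _.
by rewrite -EFinM lee_fin; lra.
Qed.

(* The squared increments, weighted by 2^k, have a summable integral; this
   forces pointwise convergence almost everywhere at a geometric rate. *)
Lemma sqint_complete : exists l,
  [/\ sqint l, {ae mu, forall x, f ^~ x @ \oo --> l x} &
    forall e, 0 < e -> exists n, forall i, (n <= i)%N ->
      dot (fun x => f i x - l x) (fun x => f i x - l x) <= e].
Proof.
have sd i : sqint (fun x => f i x - l x).
  split; first by apply: measurable_funB => //; exact: (sf _).1.
  exact: le_lt_trans (int_lim i) (ltry _).
exists l; split.
- have := sqintB (sf 0%N) (sd 0%N).
  by congr sqint; apply/funext => x; rewrite opprB addrC subrK.
- apply: filterS A_ae => x Ax; have := @cvg_l x.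
  by rewrite indicE mem_set//; under eq_fun do rewrite mulr1.
move=> e e0; have e4 : 0 < e / 4 by rewrite divr_gt0.
have /cvgrPdist_lt/(_ _ e4)[n _ hn] := half_cvg0.
exists n => i /hn /=; rewrite sub0r normrN ger0_norm ?exprn_ge0 ?invr_ge0// => h.
rewrite -lee_fin dotE//; apply: le_trans (int_lim i) _; rewrite lee_fin.
by rewrite mulrC -ler_pdivlMr// ltW.
Qed.

End Completeness.

(** * Edges of the tree and the measure on them *)

Section TreeMeasure.
Context {R : realType} (G : metric_tree R).
Local Notation V := (vertex G).
Local Notation lebT := (@lebesgueT R).
Local Notation clm := (@completed_lebesgue_measure R).
Implicit Types (v w : V) (s t : R) (S : set R) (x : points G).

(** A section of [edge_trace v]. It is empty at the root, which names no edge. *)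
Definition edge_set v S : set (points G) :=
  [set x | [/\ v != root G, (val x).1 = v & S (val x).2]].

Lemma point_edge x : (val x).1 != root G -> 0 < (val x).2 <= elen (val x).1.
Proof.
by have := valP x; rewrite /is_point => /orP[/eqP -> /=|/and3P[_ -> ->//]];
  rewrite eqxx.
Qed.

Lemma point_root x : (val x).1 = root G -> x = root_pt G.
Proof.
move=> x1; apply/val_inj; have := valP x.
by rewrite /is_point x1 eqxx orbF => /eqP.
Qed.

Lemma val_edge_pt v s : v != root G -> 0 < s <= elen v ->
  val (edge_pt v s) = (v, s).
Proof.
move=> v0 /andP[s0 sl]; rewrite /edge_pt s0 insubdK//.
by rewrite unfold_in /is_point/= v0 s0 sl orbT.
Qed.

Lemma edge_pt_val x : (val x).1 != root G -> edge_pt (val x).1 (val x).2 = x.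
Proof.
move=> x0; apply/val_inj; rewrite val_edge_pt ?point_edge//.
by case: (val x).
Qed.

Lemma edge_trace_edge_set v S : v != root G ->
  edge_trace v (edge_set v S) = [set s | 0 < s <= elen v] `&` S.
Proof.
move=> v0; apply/seteqP; split => s /= [sv].
  by move=> [_ _]; rewrite val_edge_pt.
by move=> Ss; split=> //; split=> //; rewrite val_edge_pt.
Qed.

Lemma edge_trace_edge_set_neq v w S : v != w -> v != root G ->
  edge_trace v (edge_set w S) = set0.
Proof.
move=> vw v0; apply/seteqP; split => s //= [sv] [_].
by rewrite val_edge_pt//= => /eqP; rewrite (negbTE vw).
Qed.

Lemma edge_setK v (A : set (points G)) : v != root G -> A `<=` edge_set v setT ->
  edge_set v (edge_trace v A) = A.
Proof.
move=> v0 Av; apply/seteqP; split => x /=.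
  by move=> [v0' xv [sl]]; rewrite -{1}xv edge_pt_val// xv.
move=> Ax; have [_ xv _] := Av _ Ax; subst v.
split=> //; split; first exact: point_edge.
by rewrite edge_pt_val.
Qed.

Lemma measurable_edge_set v S : measurable (S : set lebT) ->
  measurable (edge_set v S).
Proof.
move=> mS; have [v0|v0] := eqVneq v (root G).
  have -> : edge_set v S = set0 by apply/seteqP; split => [x [/eqP]|x []].
  exact: measurable0.
move=> w w0; have [->|wv] := eqVneq w v; last by rewrite edge_trace_edge_set_neq.
by rewrite edge_trace_edge_set//; apply: measurableI => //; exact: measurable_edge.
Qed.

Lemma dx_edge_set v S : v != root G ->
  dx (edge_set v S) = clm ([set s | 0 < s <= elen v] `&` S).
Proof.
move=> v0; rewrite /dx -(@esum_set1 R V v (fun=> clm ([set s | 0 < s <= elen v] `&` S)))//.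
rewrite [LHS]esum_mkcond [RHS]esum_mkcond; apply: eq_esum => w _.
case: ifPn => [/set_mem/= w0|/negP w0]; last first.
  case: ifPn => // /set_mem/= wv; exfalso; apply: w0.
  by apply/mem_set; rewrite wv.
have [->|wv] := eqVneq w v.
  by rewrite edge_trace_edge_set// mem_set.
rewrite edge_trace_edge_set_neq// measure0 memNset//= => wv'.
by rewrite wv' eqxx in wv.
Qed.

Lemma borel_lebesgue S : measurable S -> measurable (S : set lebT).
Proof. exact: sub_caratheodory. Qed.

Lemma segment_edge_set v s : v != root G -> 0 <= s <= elen v ->
  segment v s = edge_set v `]0, s].
Proof.
move=> v0 /andP[s0 sl]; apply/seteqP; split => x.
  move=> [t]; rewrite /= in_itv/= => /andP[t0 ts] <-.
  by split; rewrite ?val_edge_pt ?t0 ?(le_trans ts)//= in_itv/= t0.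
move=> [_ xv xs]; exists (val x).2 => //.
by rewrite -xv edge_pt_val// xv.
Qed.

Lemma measurable_segment v s : v != root G -> 0 <= s <= elen v ->
  measurable (segment v s).
Proof.
move=> v0 sl; rewrite segment_edge_set//; apply: measurable_edge_set.
exact: borel_lebesgue.
Qed.

Lemma edge_itvI v a b : [set s | 0 < s <= elen v] `&` `]a, b] =
  `](Num.max 0 a), (Num.min (elen v) b)]%classic.
Proof.
by apply/seteqP; split => s /=; rewrite !in_itv/= gt_max le_min;
  [move=> [/andP[-> ->] /andP[-> ->]]|move=> /andP[/andP[-> ->] /andP[-> ->]]].
Qed.

Lemma dx_edge_itv v a b : v != root G ->
  (dx (edge_set v `]a, b]) <= (Num.max 0 (b - a))%:E)%E.
Proof.
move=> v0; rewrite dx_edge_set//.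
apply: (@le_trans _ _ (@lebesgue_measure R `]a, b]%classic)).
  exact: (@le_outer_measure _ _ ((@wlength R idfun)^*)%mu _ _ (@subIsetr _ _ _)).
rewrite lebesgue_measure_itv/= lte_fin; case: ifPn => ab.
  by rewrite -EFinB lee_fin le_max lexx orbT.
by rewrite lee_fin le_max lexx.
Qed.

Lemma dx_segment v s : v != root G -> 0 <= s <= elen v ->
  dx (segment v s) = s%:E.
Proof.
move=> v0 /andP[s0 sl]; rewrite segment_edge_set ?s0// dx_edge_set// edge_itvI.
rewrite maxxx (min_r sl).
transitivity (@lebesgue_measure R `]0, s]%classic); first by [].
rewrite lebesgue_measure_itv/= lte_fin; case: ltgtP s0 => // [s0 _|<-//].
by rewrite sube0.
Qed.

Lemma edge_setU v S S' : edge_set v (S `|` S') = edge_set v S `|` edge_set v S'.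
Proof.
apply/seteqP; split=> x /=; first by move=> [v0 xv [?|?]]; [left|right].
by move=> [[v0 xv ?]|[v0 xv ?]]; split=> //; [left|right].
Qed.

Lemma edge_setI v S S' : edge_set v (S `&` S') = edge_set v S `&` edge_set v S'.
Proof.
apply/seteqP; split=> x /=; first by move=> [v0 xv [? ?]].
by move=> [[v0 xv ?]] [_ _ ?].
Qed.

(** Measurability is defined edge by edge. The comparison function [h] lives on the whole line, so
    that a continuous extension of the restriction to an edge suffices. *)
Lemma measurable_fun_edgewise (f : points G -> R) :
  (forall v, v != root G -> exists h : R -> R, measurable_fun setT h /\
     forall s, 0 < s <= elen v -> f (edge_pt v s) = h s) ->
  measurable_fun setT f.
Proof.
move=> H _ B mB; rewrite setTI; change (measurable_points (f @^-1` B)) => v v0.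
have [h [mh fh]] := H v v0.
rewrite (_ : edge_trace v _ = [set s | 0 < s <= elen v] `&` (h @^-1` B)); last first.
  by apply/seteqP; split => s [sl Bs]; split=> //; move: Bs; rewrite /preimage/= fh.
apply: measurableI; first exact: measurable_edge.
by apply: borel_lebesgue; rewrite -[_ @^-1` _]setTI; exact: mh.
Qed.

Lemma vdist_ge0 v : 0 <= vdist v.
Proof.
apply: sumr_ge0 => i _; apply/ltW/elen_gt0.
(* By minimality of [gen v], the path has not reached the root before that step. *)
move: (nat_of_ord i) (ltn_ord i : (i < gen v)%N) => {}i ilt.
apply/negP => h; move: ilt; rewrite /gen; case: ex_minnP => n _ /(_ _ h).
by rewrite leqNgt => /negbTE ->.
Qed.

Lemma dist_root_ge0 x : 0 <= dist_root x.
Proof.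
rewrite addr_ge0 ?vdist_ge0//; have := valP x.
by rewrite /is_point => /orP[/eqP->//|/and3P[_ /ltW]].
Qed.

Lemma gen_root : gen (root G) = 0%N.
Proof.
rewrite /gen; case: ex_minnP => n _ /(_ 0%N) /=.
by rewrite eqxx leqn0 => /(_ isT)/eqP.
Qed.

Lemma dist_root_root : dist_root (root_pt G) = 0.
Proof. by rewrite /dist_root/= parent_root /vdist gen_root big_ord0 addr0. Qed.

Lemma measurable_dist_root : measurable_fun setT (@dist_root R G).
Proof.
apply: measurable_fun_edgewise => v v0.
exists (fun s => vdist (parent v) + s); split; first exact: measurable_funD.
by move=> s sl; rewrite /dist_root val_edge_pt.
Qed.

End TreeMeasure.

(** * Derivatives of real functions on the tree and their uniqueness *)

Section RealDerivative.
Context {R : realType} (G : metric_tree R).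
Local Notation V := (vertex G).
Local Notation lebT := (@lebesgueT R).
Implicit Types (v w : V) (s t : R) (S : set R) (x : points G) (u g h : points G -> R).

Definition edge_sqint v g :=
  (\int[@dx R G]_(x in segment v (elen v)) (g x ^+ 2)%:E < +oo)%E.

(** Real counterpart of [is_deriv], to be applied to real and imaginary parts. *)
Definition real_deriv u g :=
  measurable_fun setT g /\
  forall v, v != root G -> edge_sqint v g /\
    forall s, 0 <= s <= elen v ->
      u (edge_pt v s) =
      u (vertex_pt (parent v)) + \int[@dx R G]_(x in segment v s) g x.

Lemma elen_ge0 v : v != root G -> 0 <= elen v <= elen v.
Proof. by move=> v0; rewrite lexx andbT ltW// elen_gt0. Qed.

Lemma segment_setT v : v != root G -> segment v (elen v) = edge_set v setT.
Proof.
move=> v0; rewrite segment_edge_set ?elen_ge0//; apply/seteqP; split=> x /=.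
  by move=> [_ xv _].
move=> [_ xv _]; split=> //; rewrite /= in_itv/= -xv; apply: point_edge.
by rewrite xv.
Qed.

Lemma measurable_edge_setT v : v != root G -> measurable (segment v (elen v)).
Proof. by move=> v0; exact/measurable_segment/elen_ge0. Qed.

Lemma sqint_restrict v g : v != root G -> measurable_fun setT g ->
  edge_sqint v g -> sqint (@dx R G) (fun x => g x * \1_(segment v (elen v)) x).
Proof.
move=> v0 mg gv; have mA := measurable_edge_setT v0; split.
  by apply: measurable_funM => //; exact: measurable_indic.
apply: le_lt_trans gv; rewrite [leRHS]integral_mkcond.
rewrite le_eqVlt; apply/orP; left; apply/eqP; apply: eq_integral => x _.
rewrite patchE indicE; case: ifPn => _; first by rewrite mulr1.
by rewrite mulr0 expr0n.
Qed.

Lemma dx_sub_edge v (A : set (points G)) : v != root G -> measurable A ->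
  A `<=` segment v (elen v) -> (dx A < +oo)%E.
Proof.
move=> v0 mA Av; apply: (@le_lt_trans _ _ (dx (segment v (elen v)))).
  by apply: le_measure => //; apply/mem_set => //; exact: measurable_edge_setT.
by rewrite dx_segment ?elen_ge0// ltry.
Qed.

Lemma edge_integrable v g : v != root G -> measurable_fun setT g ->
  edge_sqint v g -> (@dx R G).-integrable (segment v (elen v)) (EFin \o g).
Proof.
move=> v0 mg gv; have mA := measurable_edge_setT v0.
have := sqint_mul_integrable (sqint_restrict v0 mg gv)
  (sqint_indic mA (dx_sub_edge v0 mA (@subset_refl _ _))).
move=> /(integrableS measurableT mA (@subsetT _ _)).
apply: eq_integrable => // x xA /=.
by rewrite indicE xA !mulr1.
Qed.

Lemma edge_Rintegral v g (A : set (points G)) : v != root G -> measurable A ->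
  A `<=` segment v (elen v) ->
  \int[@dx R G]_(x in A) g x =
  dot (@dx R G) (fun x => g x * \1_(segment v (elen v)) x) \1_A.
Proof.
move=> v0 mA Av; rewrite Rintegral_mkcond; apply: eq_Rintegral => x _.
rewrite patchE !indicE; case: ifPn => [xA|_]; last by rewrite mulr0.
by rewrite mem_set ?mulr1//; apply: Av; exact: set_mem.
Qed.

Section Uniqueness.
Variables (v : V) (h : points G -> R).
Hypotheses (v0 : v != root G) (mh : measurable_fun setT h) (hv : edge_sqint v h).
Hypothesis h0 : forall s, 0 <= s <= elen v ->
  \int[@dx R G]_(x in segment v s) h x = 0.

Let mEh : measurable_fun setT (EFin \o h).
Proof. exact/measurable_EFinP. Qed.

Let I S := (\int[@dx R G]_(x in edge_set v S) (h x)%:E)%E.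

Let int_sub (A : set (points G)) : measurable A -> A `<=` segment v (elen v) ->
  (@dx R G).-integrable A (EFin \o h).
Proof.
move=> mA Av; apply: integrableS (edge_integrable v0 mh hv) => //.
exact: measurable_edge_setT.
Qed.

Let sub_edge S : edge_set v S `<=` segment v (elen v).
Proof. by rewrite segment_setT// => x [? ? _]; split. Qed.

Let segI s : 0 <= s <= elen v -> I `]0, s] = 0%E.
Proof.
move=> sl; have ms := measurable_segment v0 sl.
have sub : segment v s `<=` segment v (elen v).
  by rewrite (segment_edge_set v0 sl); exact: sub_edge.
have fin := integrable_fin_num ms (int_sub ms sub).
by rewrite /I -(segment_edge_set v0 sl) -(fineK fin); have := h0 sl; rewrite /Rintegral => ->.
Qed.

Let IT : I setT = 0%E.
Proof.
by rewrite /I -segment_setT// segment_edge_set ?elen_ge0//; apply/segI/elen_ge0.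
Qed.

Let IC S : measurable S -> I S = 0%E -> I (~` S) = 0%E.
Proof.
move=> mS S0; have := IT; rewrite /I -(setUv S) edge_setU integral_setU.
- by rewrite -/(I S) S0 add0e.
- exact/measurable_edge_set/borel_lebesgue.
- by apply/measurable_edge_set/borel_lebesgue; exact: measurableC.
- exact: measurable_funTS mEh.
- by apply/disj_setPS; rewrite -edge_setI setICr => x [].
Qed.

(** The sets with vanishing integral form a Dynkin system, by integrability of h on the edge, and
    contain the open rays, which are stable under intersection. *)
Let I_borel S : measurable S -> I S = 0%E.
Proof.
move=> mS; apply: (@dynkin_induction _ _ (@RGenOInfty.G R) (fun S => I S = 0%E)).
- exact: RGenOInfty.measurableE.
- move=> _ _ [a ->] [b ->]; exists (Num.max a b).
  apply/seteqP; split => s /=; rewrite !in_itv/= !andbT gt_max.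
    by move=> [-> ->].
  by move=> /andP[].
- exact: IT.
- move=> _ [a ->]; rewrite -setCitvl; apply: IC => //.
  (* The complement of an open ray meets the edge in an initial segment, possibly empty or full:
     hence the two-sided clipping of a. *)
  have -> : I `]-oo, a] = I `]0, (Num.max 0 (Num.min (elen v) a))].
    rewrite /I; congr (integral _ _ _); apply/seteqP; split => x /= [_ xv xa];
      split=> //; move: xa; rewrite /= !in_itv/=.
      have := @point_edge _ _ x; rewrite xv => /(_ v0)/andP[-> xl] xa.
      by rewrite le_max le_min xl xa orbT.
    by move=> /andP[xp]; rewrite le_max leNgt xp/= le_min => /andP[].
  apply: segI; rewrite le_max lexx/= ge_max ge_min lexx/= andbT.
  by have /andP[] := elen_ge0 v0.
- by move=> A mA; exact: IC.
- move=> F mF tF F0.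
  have EF : edge_set v (\bigcup_k F k) = \bigcup_k edge_set v (F k).
    apply/seteqP; split => x /=.
      by move=> [_ xv [k _ Fk]]; exists k.
    by move=> [k _ [_ xv Fk]]; split=> //; exists k.
  rewrite /I EF integral_bigcup.
  - by rewrite eseries0// => k _ _; exact: F0.
  - move=> i j _ _ [x [[_ _ xi] [_ _ xj]]].
    by apply: (tF i j) => //; exists (val x).2.
  - by move=> k; exact/measurable_edge_set/borel_lebesgue.
  - apply: int_sub; last by rewrite -EF; exact: sub_edge.
    rewrite -EF; apply/measurable_edge_set/borel_lebesgue.
    exact: bigcup_measurable.
- by have : (@ocitv R).-sigma.-measurable S := mS; rewrite RGenOInfty.measurableE.
Qed.

(** Traces of measurable sets are Lebesgue sets. Such a set is a Borel set X together with a subset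
    of a Borel null set B, and the integrals over S and X agree off B. *)
Let I_lebesgue (S : set R) : measurable (S : set lebT) -> I S = 0%E.
Proof.
have -> : measurable (S : set lebT) =
    completed_algebra_gen (@lebesgue_measure R) S.
  by rewrite -g_sigma_completed_algebra_genE completed_caratheodory_measurable.
move=> [X mX [N [B [mB B0 NB]]]] SE.
have dxB : dx (edge_set v B) = 0%E.
  apply/eqP; rewrite eq_le dx_ge0 andbT dx_edge_set// -B0.
  exact: (@le_outer_measure _ _ ((@wlength R idfun)^*)%mu _ _ (@subIsetr _ _ _)).
have mBe : measurable (edge_set v B) by exact/measurable_edge_set/borel_lebesgue.
have mXe : measurable (edge_set v X) by exact/measurable_edge_set/borel_lebesgue.
have mNe : measurable (N : set lebT).
  apply: negligible_sub_caratheodory; exists B; split=> //.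
  exact: borel_lebesgue.
have mSe : measurable (edge_set v S).
  rewrite -SE edge_setU; apply: measurableU => //; exact: measurable_edge_set.
have E : edge_set v S `\` edge_set v B = edge_set v X `\` edge_set v B.
  rewrite -SE edge_setU setDUl [X in _ `|` X](_ : _ = set0) ?setU0//.
  apply/seteqP; split => x //= [[_ xv xN]]; apply; split=> //; exact: NB.
rewrite /I (negligible_integral mBe mSe)//; last exact: int_sub.
rewrite E -(negligible_integral mBe mXe)//; last exact: int_sub.
exact: I_borel.
Qed.

Lemma segment_integral_eq0 :
  {ae (@dx R G), forall x, segment v (elen v) x -> h x = 0}.
Proof.
have mA := measurable_edge_setT v0.
have := @integral_ae_eq _ _ _ (@dx R G) _ mA (cst 0%E) (EFin \o h)
  (edge_integrable v0 mh hv) (measurable_cst _).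
have H E : E `<=` segment v (elen v) -> measurable E ->
    (\int[@dx R G]_(x in E) (EFin \o h) x = \int[@dx R G]_(x in E) cst 0 x)%E.
  move=> Ev mE; rewrite integral0.
  have -> : E = edge_set v (edge_trace v E).
    by rewrite edge_setK//; rewrite -segment_setT.
  by apply: I_lebesgue; exact: mE.
by move=> /(_ H); apply: filterS => x /[apply] -[].
Qed.

End Uniqueness.

(** Measurability of the exceptional set lets its measure be computed as a sum over the edges, each
    term of which vanishes. *)
Lemma ae_edgewise (P : points G -> Prop) :
  (forall v, v != root G -> {ae (@dx R G), forall x, segment v (elen v) x -> P x}) ->
  measurable [set x | ~ P x] -> {ae (@dx R G), forall x, P x}.
Proof.
move=> h mP; apply/(negligibleP _ mP); change (dx [set x | ~ P x] = 0%E).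
rewrite /dx esum1// => v /= v0.
have [N [mN N0 PN]] := h v v0.
apply/eqP; rewrite eq_le measure_ge0 andbT.
apply: (@le_trans _ _ (dx (edge_set v (edge_trace v [set x | ~ P x])))).
  rewrite dx_edge_set//.
  apply: (@le_outer_measure _ _ ((@wlength R idfun)^*)%mu) => s sP.
  by split=> //; case: sP.
rewrite -N0; apply: le_measure; rewrite ?inE//.
  exact/measurable_edge_set/mP.
apply: subset_trans PN => x /= [_ xv [sl Px]].
rewrite segment_setT// => h'; apply: Px; rewrite -{1}xv edge_pt_val ?xv//.
exact: h'.
Qed.

(** Makes the choice of a derivative immaterial in integrals, and hence makes the Dirichlet form
    bilinear. *)
Lemma real_deriv_unique u g1 g2 : real_deriv u g1 -> real_deriv u g2 ->
  {ae (@dx R G), forall x, g1 x = g2 x}.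
Proof.
move=> [mg1 d1] [mg2 d2].
have mB : measurable_fun setT (g1 \- g2) by exact: measurable_funB.
apply: ae_edgewise => [v v0|]; last first.
  have -> : [set x | ~ g1 x = g2 x] = (g1 \- g2) @^-1` [set~ 0].
    apply/seteqP; split=> x h; first by move=> /eqP; rewrite /= subr_eq0 => /eqP.
    by move=> e; apply: h; rewrite /= e subrr.
  rewrite -[_ @^-1` _]setTI; apply: mB => //; exact: measurableC.
have [i1 e1] := d1 v v0; have [i2 e2] := d2 v v0.
have si1 := edge_integrable v0 mg1 i1; have si2 := edge_integrable v0 mg2 i2.
have iB : edge_sqint v (g1 \- g2).
  have [_] := sqintB (sqint_restrict v0 mg1 i1) (sqint_restrict v0 mg2 i2).
  apply: le_lt_trans; rewrite [leLHS]integral_mkcond.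
  rewrite le_eqVlt; apply/orP; left; apply/eqP; apply: eq_integral => x _.
  rewrite patchE indicE; case: ifPn => _; first by rewrite !mulr1.
  by rewrite !mulr0 subrr expr0n.
have h0 s : 0 <= s <= elen v ->
    \int[@dx R G]_(x in segment v s) (g1 \- g2) x = 0.
  move=> sl; have ms := measurable_segment v0 sl.
  have sub : segment v s `<=` segment v (elen v).
    rewrite segment_setT// segment_edge_set// => x [? ? _]; by split.
  have mA := measurable_edge_setT v0.
  rewrite RintegralB//; last 2 first.
  - exact: integrableS si1.
  - exact: integrableS si2.
  by have := e1 s sl; have := e2 s sl => ->; lra.
apply: filterS (segment_integral_eq0 v0 mB iB h0) => x /[apply] /eqP.
by rewrite subr_eq0 => /eqP.
Qed.

End RealDerivative.

(** * Paths from the root and the fundamental theorem of calculus along them *)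

Section Paths.
Context {R : realType} (G : metric_tree R).
Local Notation V := (vertex G).
Local Notation mu := (@dx R G).
Implicit Types (v w : V) (s t : R) (x : points G) (u g : points G -> R).

Lemma gen_parent v : v != root G -> gen v = (gen (parent v)).+1.
Proof.
move=> v0; rewrite /gen; case: ex_minnP => m mv minm; case: ex_minnP => n nv minn.
apply/eqP; rewrite eqn_leq minm ?iterSr//=.
case: m mv minm => [|m] mv minm; first by rewrite mv in v0.
by rewrite ltnS minn// -iterSr.
Qed.

Lemma vdist_parent v : v != root G -> vdist v = vdist (parent v) + elen v.
Proof.
move=> v0; rewrite /vdist (gen_parent v0) big_ord_recl addrC; congr (_ + _).
by apply: eq_bigr => i _; rewrite iterSr.
Qed.

Lemma vertex_pt_root : vertex_pt (root G) = root_pt G.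
Proof.
apply: point_root; rewrite /vertex_pt /insubd; case: insubP => [x _ ->|_]//=.
Qed.

Lemma vertex_ptE v : v != root G -> vertex_pt v = edge_pt v (elen v).
Proof. by move=> v0; rewrite /edge_pt elen_gt0. Qed.

Lemma sqint_integrable_set g (A : set (points G)) : sqint mu g -> measurable A ->
  (mu A < +oo)%E -> mu.-integrable setT (EFin \o (fun x => g x * \1_A x)).
Proof. by move=> sg mA Aoo; exact: sqint_mul_integrable sg (sqint_indic mA Aoo). Qed.

Lemma dot_indicU g (A B : set (points G)) : sqint mu g -> measurable A ->
  measurable B -> (mu A < +oo)%E -> (mu B < +oo)%E -> A `&` B = set0 ->
  dot mu g \1_(A `|` B) = dot mu g \1_A + dot mu g \1_B.
Proof.
move=> sg mA mB Aoo Boo AB.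
have iA := sqint_integrable_set sg mA Aoo; have iB := sqint_integrable_set sg mB Boo.
rewrite /dot -(RintegralD measurableT iA iB); apply: eq_Rintegral => x _.
rewrite -mulrDr !indicE in_setU; congr (_ * _).
case: (boolP (x \in A)) => xA; case: (boolP (x \in B)) => xB /=.
- have : (A `&` B) x by split; exact: set_mem.
  by rewrite AB.
- by rewrite addr0.
- by rewrite add0r.
- by rewrite addr0.
Qed.

Lemma sqint_edge v g : v != root G -> sqint mu g -> edge_sqint v g.
Proof.
move=> v0 [mg g2]; apply: le_lt_trans g2.
have g0 x : setT x -> (0 <= (g x ^+ 2)%:E)%E by rewrite lee_fin sqr_ge0.
exact: (ge0_subset_integral mu (measurable_edge_setT v0) measurableT
  (measurable_EFin_sqr mg) g0 (@subsetT _ _)).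
Qed.

(** [A] stands for the path from the root to x. The inclusion in a ball serves the induction: it
    makes the next segment disjoint from the path to the vertex where it starts. The last clause
    turns evaluation at x into an inner product with the derivative. *)
Definition is_path x (A : set (points G)) :=
  [/\ measurable A, mu A = (dist_root x)%:E, A `<=` [set y | dist_root y <= dist_root x] &
      forall u g, real_deriv u g -> sqint mu g -> u x = u (root_pt G) + dot mu g \1_A].

Lemma path_edge v s A : v != root G -> 0 < s <= elen v ->
  is_path (vertex_pt (parent v)) A -> is_path (edge_pt v s) (A `|` segment v s).
Proof.
move=> v0 sl [mA muA subA uA]; have /andP[s0 sv] := sl.
have sl' : 0 <= s <= elen v by rewrite ltW.
have mS := measurable_segment v0 sl'.
have dp : dist_root (vertex_pt (parent v)) = vdist (parent v).
  have [->|p0] := eqVneq (parent v) (root G).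
    by rewrite vertex_pt_root dist_root_root /vdist gen_root big_ord0.
  rewrite vertex_ptE// /dist_root val_edge_pt ?elen_gt0 ?lexx//=.
  by rewrite -vdist_parent.
have ds t : 0 < t <= elen v -> dist_root (edge_pt v t) = vdist (parent v) + t.
  by move=> tl; rewrite /dist_root val_edge_pt.
have AS : A `&` segment v s = set0.
  apply/seteqP; split => // x [/subA/= xA].
  move=> [t]; rewrite /= in_itv/= => /andP[t0 ts] xt.
  move: xA; rewrite -xt ds ?t0 ?(le_trans ts)// dp leNgt ltrDl => /negP; exact.
have Aoo : (mu A < +oo)%E by rewrite muA ltry.
have Soo : (mu (segment v s) < +oo)%E by rewrite /= dx_segment// ltry.
split.
- exact: measurableU.
- have -> : (dist_root (edge_pt v s))%:E =
      ((dist_root (vertex_pt (parent v)))%:E + s%:E)%E by rewrite ds// dp.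
  rewrite -muA -(dx_segment v0 sl'); exact: measureU mA mS AS.
- move=> x [/subA/= h|[t]]; rewrite /= ds//.
    by rewrite (le_trans h)// dp lerDl ltW.
  rewrite in_itv/= => /andP[t0 ts] <-.
  by rewrite ds ?t0 ?(le_trans ts)// lerD2l.
- move=> u g [mg dg] sg; rewrite (dot_indicU sg mA mS Aoo Soo AS) addrA -uA//.
  have [_ ->//] := dg v v0.
  by congr (_ + _); exact: dot_indic.
Qed.

Lemma path_exists x : exists A, is_path x A.
Proof.
suff H v : exists A, is_path (vertex_pt v) A.
  have [x0|x0] := eqVneq (val x).1 (root G).
    by have [A] := H (root G); rewrite vertex_pt_root (point_root x0); exists A.
  have [A hA] := H (parent (val x).1).
  exists (A `|` segment (val x).1 (val x).2); rewrite -{1}(edge_pt_val x0).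
  exact/path_edge/hA/point_edge.
move: {2}(gen v) (erefl (gen v)) => n; elim: n v => [|n IH] v gv.
  have -> : v = root G.
    by apply: contra_eq gv => v0; rewrite gen_parent.
  rewrite vertex_pt_root; exists set0; split=> //.
  - by rewrite measure0 dist_root_root.
  - move=> u g _ _; rewrite -dot_indic// Rintegral_set0 addr0//.
have v0 : v != root G by apply: contra_eq_neq gv => ->; rewrite gen_root.
have [|A hA] := IH (parent v); first by move: gv; rewrite gen_parent// => -[].
exists (A `|` segment v (elen v)); rewrite vertex_ptE//.
by apply: path_edge => //; rewrite elen_gt0//= lexx.
Qed.

(* On each edge u is Hoelder continuous of exponent 1/2. *)
Lemma real_deriv_measurable u g : real_deriv u g -> measurable_fun setT u.
Proof.
move=> [mg dg]; apply: measurable_fun_edgewise => v v0.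
have [gv ug] := dg v v0.
pose k x := g x * \1_(segment v (elen v)) x.
have sk : sqint mu k by exact: sqint_restrict.
have mI (a b : R) : measurable (edge_set v `]a, b]).
  exact/measurable_edge_set/borel_lebesgue.
have Ioo (a b : R) : (mu (edge_set v `]a, b]) < +oo)%E.
  exact: le_lt_trans (dx_edge_itv _ _ v0) (ltry _).
(* [edge_set] confines the interval to the edge, so h continues u by constants to the whole line. *)
pose h s := u (vertex_pt (parent v)) + dot mu k \1_(edge_set v `]0, s]).
exists h; split; last first.
  move=> s /andP[s0 sl]; rewrite ug ?(ltW s0)// /h segment_edge_set ?(ltW s0)//.
  congr (_ + _); apply: edge_Rintegral => //.
  by rewrite segment_setT// => x [].
apply: continuous_measurable_fun => s.
have hS (a b : R) : a <= b -> (h b - h a) ^+ 2 <= dot mu k k * (b - a).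
  move=> ab; have [b0|b0] := leP b 0.
    have E c : c <= 0 -> edge_set v `]0, c] = set0.
      move=> c0; apply/seteqP; split=> // x [_ _]; rewrite /= in_itv/= => /andP[h1 h2].
      by have := lt_le_trans h1 (le_trans h2 c0); rewrite ltxx.
    rewrite /h !E ?(le_trans ab)// subrr expr0n.
    by rewrite mulr_ge0 ?subr_ge0// dot_ge0.
  (* The point c is the positive part of a: h is constant to the left of 0. *)
  have [c [c1 c2 c3]] : exists c, [/\ a <= c, c <= b & h a = h c /\ 0 <= c].
    have [a0|a0] := leP 0 a; first by exists a.
    exists 0; split; [exact: ltW|exact: ltW|split=> //].
    rewrite /h; congr (_ + dot _ _ _); congr (\1_ _); congr edge_set.
    apply/seteqP; split=> x; rewrite /= !in_itv/= => /andP[h1 h2].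
      by have := lt_le_trans h1 (le_trans h2 (ltW a0)); rewrite ltxx.
    by have := lt_le_trans h1 h2; rewrite ltxx.
  case: c3 => -> c0.
  have -> : h b - h c = dot mu k \1_(edge_set v `]c, b]).
    rewrite /h; have -> : edge_set v `]0, b] = edge_set v `]0, c] `|` edge_set v `]c, b] :> set (points G).
      rewrite -edge_setU; congr edge_set; apply/seteqP; split=> x; rewrite /= !in_itv/=.
        by move=> /andP[x0 xb]; have [xc|xc] := leP x c; [left; rewrite x0|right].
      by move=> [/andP[-> xc]|/andP[cx ->]]; rewrite ?(le_trans xc) ?(le_lt_trans c0).
    rewrite dot_indicU//; first by ring.
    rewrite -edge_setI; apply/seteqP; split=> x //= [_ _ []].
    by rewrite /= !in_itv/= => /andP[_ xc] /andP[cx _]; have := lt_le_trans cx xc; rewrite ltxx.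
  apply: le_trans (dot_CauchySchwarz sk (sqint_indic (mI _ _) (Ioo _ _))) _.
  apply: ler_wpM2l; first exact: dot_ge0.
  apply: (@le_trans _ _ (b - c)); last by rewrite lerB.
  rewrite -lee_fin (dot_indicE (mI c b) (Ioo c b)).
  apply: (@le_trans _ _ (Num.max 0 (b - c))%:E); first exact: dx_edge_itv.
  by rewrite max_r// subr_ge0.
have hS' y z : (h z - h y) ^+ 2 <= dot mu k k * `|z - y|.
  have [yz|zy] := leP y z; first by rewrite ger0_norm ?subr_ge0// hS.
  by rewrite -sqrrN opprB distrC ger0_norm ?subr_ge0 ?hS// ltW.
apply/cvgrPdist_lt => e e0.
have C0 : 0 < dot mu k k + 1 by rewrite ltr_wpDl// dot_ge0.
have d0 : 0 < e ^+ 2 / (dot mu k k + 1) by rewrite divr_gt0// exprn_gt0.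
near=> t.
have ht : `|s - t| < e ^+ 2 / (dot mu k k + 1).
  by near: t; apply: cvgr_dist_lt.
rewrite -ltr_sqr ?nnegrE ?normr_ge0 ?(ltW e0)// real_normK ?num_real//.
apply: (@le_lt_trans _ _ ((dot mu k k + 1) * `|s - t|)).
  by apply: le_trans (hS' _ _) _; rewrite ler_wpM2r// lerDl.
by rewrite mulrC -ltr_pdivlMr.
Unshelve. all: by end_near. Qed.

End Paths.

(** * The real Sobolev space with its Dirichlet form *)

Section SobolevSpace.
Context {R : realType} (G : metric_tree R).
Local Notation mu := (@dx R G).
Implicit Types (x : points G) (g : points G -> R).

(** The elements are functions and not classes modulo null sets: they can be evaluated at points,
    and the Dirichlet form is definite on them. The codomain [R^o] provides the module structure. *)
Definition h10_pred : {pred points G -> R^o} := fun u =>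
  `[< [/\ u (root_pt G) = 0, sqint mu u &
      exists g, real_deriv u g /\ sqint mu g] >].

Lemma sub_segment (v : vertex G) (s : R) : v != root G -> 0 <= s <= elen v ->
  segment v s `<=` segment v (elen v).
Proof. by move=> v0 sl x; rewrite segment_setT// segment_edge_set// => -[]. Qed.

Lemma segment_Rintegral (v : vertex G) (s : R) g : v != root G ->
  0 <= s <= elen v -> \int[mu]_(x in segment v s) g x = dot mu g \1_(segment v s).
Proof. by move=> v0 sl; apply/dot_indic/measurable_segment. Qed.

Lemma segment_sqint (v : vertex G) (s : R) : v != root G ->
  0 <= s <= elen v -> sqint mu \1_(segment v s).
Proof.
move=> v0 sl; have ms := measurable_segment v0 sl.
exact: sqint_indic ms (dx_sub_edge v0 ms (sub_segment v0 sl)).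
Qed.

Lemma real_deriv_lin (a : R) (u v g h : points G -> R) : real_deriv u g ->
  real_deriv v h -> sqint mu g -> sqint mu h ->
  real_deriv (fun x => a * u x + v x) (fun x => a * g x + h x).
Proof.
move=> [mg dg] [mh dh] sg sh; have sl := sqint_lin a sg sh.
split; first exact: sl.1.
move=> w w0; split; first exact: sqint_edge.
move=> s sw; have [_ /(_ s sw) ->] := dg w w0; have [_ /(_ s sw) ->] := dh w w0.
rewrite !(segment_Rintegral _ w0 sw) (dot_lin a sg sh (segment_sqint w0 sw)).
by ring.
Qed.

Fact h10_submod_closed : submod_closed h10_pred.
Proof.
split=> [|a u v].
  apply/asboolP; split; [by []|exact: sqint0|].
  exists (fun=> 0); split; last exact: sqint0.
  split=> [|w w0]; first exact: measurable_cst.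
  split; first exact: sqint_edge w0 (sqint0 mu).
  move=> s sw; rewrite (segment_Rintegral _ w0 sw) /dot.
  under eq_Rintegral do rewrite mul0r.
  by rewrite (Rintegral_cst mu measurableT) mul0r addr0.
move=> /asboolP[u0 su [g [dg sg]]] /asboolP[v0 sv [h [dh sh]]].
apply/asboolP; split.
- have -> : (a *: u + v) (root_pt G) = a * u (root_pt G) + v (root_pt G) by [].
  by rewrite u0 v0 mulr0 addr0.
- exact: sqint_lin.
- exists (fun x => a * g x + h x); split; last exact: sqint_lin.
  exact: real_deriv_lin.
Qed.

HB.instance Definition _ :=
  GRing.isSubmodClosed.Build R (points G -> R^o) h10_pred h10_submod_closed.

Record sobolev := Sobolev {
  sobolev_fun :> points G -> R^o;
  sobolev_h10 : sobolev_fun \in h10_pred }.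

HB.instance Definition _ := [isSub for sobolev_fun].
HB.instance Definition _ := [Choice of sobolev by <:].
HB.instance Definition _ := [SubChoice_isSubLmodule of sobolev by <:].

Implicit Types u v w : sobolev.

Lemma sobolevP u : [/\ u (root_pt G) = 0, sqint mu u &
  exists g, real_deriv u g /\ sqint mu g].
Proof. exact/asboolP/(sobolev_h10 u). Qed.

Lemma sobolev_root u : u (root_pt G) = 0. Proof. by case: (sobolevP u). Qed.

Lemma sobolev_sqint u : sqint mu u. Proof. by case: (sobolevP u). Qed.

(** Unlike for [deriv], the representative is chosen square-integrable, so that [dot] applies to it
    directly. *)
Definition weak_deriv u : points G -> R :=
  xget (fun=> 0) [set g | real_deriv u g /\ sqint mu g].

Lemma weak_derivP u : real_deriv u (weak_deriv u) /\ sqint mu (weak_deriv u).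
Proof.
have [_ _ [g dg]] := sobolevP u.
exact: (@xgetI _ (fun=> 0) [set g | real_deriv u g /\ sqint mu g] g dg).
Qed.

Lemma weak_deriv_sqint u : sqint mu (weak_deriv u).
Proof. exact: (weak_derivP u).2. Qed.

Lemma weak_deriv_lin (a : R) u v :
  {ae mu, forall x, weak_deriv (a *: u + v) x = a * weak_deriv u x + weak_deriv v x}.
Proof.
apply: real_deriv_unique (weak_derivP _).1 _.
exact: (real_deriv_lin a (weak_derivP u).1 (weak_derivP v).1
  (weak_derivP u).2 (weak_derivP v).2).
Qed.

Lemma weak_derivB u v :
  {ae mu, forall x, weak_deriv (u - v) x = weak_deriv u x - weak_deriv v x}.
Proof.
have := weak_deriv_lin (-1) v u; rewrite scaleN1r addrC.
by apply: filterS => x ->; rewrite mulN1r addrC.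
Qed.

Definition dirichlet u v := dot mu (weak_deriv u) (weak_deriv v).

Definition l2dot u v := dot mu u v.

Lemma dirichlet_sym_bilinear : sym_bilinear dirichlet.
Proof.
split=> [u v|a u v w]; first exact: dotC.
have [su sv sw] := And3 (weak_deriv_sqint u) (weak_deriv_sqint v) (weak_deriv_sqint w).
rewrite /dirichlet -(dot_lin a su sv sw).
apply: (dot_ae (weak_deriv_sqint _) sw (sqint_lin a su sv) sw).
  exact: weak_deriv_lin.
exact: aeW.
Qed.

Lemma l2dot_sym_bilinear : sym_bilinear l2dot.
Proof.
split=> [u v|a u v w]; first exact: dotC.
by rewrite /l2dot -(dot_lin a (sobolev_sqint u) (sobolev_sqint v) (sobolev_sqint w)).
Qed.

Lemma sobolev_path u x A : is_path x A -> u x = dot mu (weak_deriv u) \1_A.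
Proof.
move=> [_ _ _ uA]; have [du su] := weak_derivP u.
by rewrite (uA _ _ du su) sobolev_root add0r.
Qed.

Lemma path_finite x A : is_path x A -> (mu A < +oo)%E.
Proof. by move=> [_ muA _ _]; rewrite muA ltry. Qed.

Lemma path_sqint x A : is_path x A -> sqint mu \1_A.
Proof. by move=> pA; case: (pA) => mA _ _ _; exact: sqint_indic mA (path_finite pA). Qed.

Lemma path_dot x A : is_path x A -> dot mu \1_A \1_A = dist_root x.
Proof.
move=> pA; case: (pA) => mA muA _ _; apply: EFin_inj; rewrite -muA.
exact: dot_indicE mA (path_finite pA).
Qed.

(** Cauchy-Schwarz between the derivative and the indicator of the path to x, whose squared norm is
    |x|. *)
Lemma pointwise_sqr_le u x : u x ^+ 2 <= dist_root x * dirichlet u u.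
Proof.
have [A pA] := path_exists x; rewrite (sobolev_path u pA).
apply: le_trans (dot_CauchySchwarz (weak_deriv_sqint u) (path_sqint pA)) _.
by rewrite (path_dot pA) mulrC.
Qed.

Lemma dirichlet_gt0 u : u != 0 -> 0 < dirichlet u u.
Proof.
move=> u0; rewrite lt_neqAle dot_ge0 andbT eq_sym.
apply: contra u0 => /eqP D0; apply/eqP/val_inj/funext => x /=.
apply/eqP; rewrite -sqrf_eq0 eq_le sqr_ge0 andbT.
by have := pointwise_sqr_le u x; rewrite D0 mulr0.
Qed.

Lemma dot_limit (f : nat -> points G -> R) g k : (forall i, sqint mu (f i)) ->
  sqint mu g -> sqint mu k ->
  (forall e, 0 < e -> exists n, forall i, (n <= i)%N ->
      dot mu (fun x => f i x - g x) (fun x => f i x - g x) <= e) ->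
  (fun i => dot mu (f i) k) @ \oo --> dot mu g k.
Proof.
move=> sf sg sk fg; apply/cvgrPdist_lt => e e0.
have C0 : 0 < dot mu k k + 1 by rewrite ltr_wpDl// dot_ge0.
have d0 : 0 < e ^+ 2 / 2 / (dot mu k k + 1) by rewrite !divr_gt0// exprn_gt0.
have [n hn] := fg _ d0; exists n => // i /= /hn {}hn.
rewrite distrC -ltr_sqr ?nnegrE ?normr_ge0 ?(ltW e0)// real_normK ?num_real//.
have sd := sqintB (sf i) sg.
have -> : dot mu (f i) k - dot mu g k = dot mu (fun x => f i x - g x) k.
  have := dot_lin (-1) sg (sf i) sk; rewrite mulN1r addrC => <-.
  by apply: eq_Rintegral => x _; rewrite mulN1r [in RHS]addrC.
apply: le_lt_trans (dot_CauchySchwarz sd sk) _.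
apply: (@le_lt_trans _ _ (e ^+ 2 / 2)).
  apply: (@le_trans _ _ (e ^+ 2 / 2 / (dot mu k k + 1) * (dot mu k k + 1))).
    by apply: ler_pM => //; rewrite ?dot_ge0// lerDl.
  by rewrite divfK// gt_eqF.
by rewrite ltr_pdivrMr// ltr_pMr ?exprn_gt0// ltr1n.
Qed.

(** The L_2 limit f of the functions is determined almost everywhere only. The limit in the space is
    the integral l along paths of the limit g of the derivatives: it is the everywhere pointwise
    limit, hence has derivative g, and it equals f almost everywhere because f is an almost
    everywhere limit of the same functions. *)
Lemma sobolev_complete : complete_form (fun u v => dirichlet u v + l2dot u v).
Proof.
move=> u cau.
have subE i j x : (u i - u j) x = u i x - u j x by [].
have mE i j : l2dot (u i - u j) (u i - u j) =
  dot mu (fun x => u i x - u j x) (fun x => u i x - u j x) by [].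
have sD i j : sqint mu (fun x => weak_deriv (u i) x - weak_deriv (u j) x).
  by apply: sqintB; exact: weak_deriv_sqint.
have DE i j : dirichlet (u i - u j) (u i - u j) =
  dot mu (fun x => weak_deriv (u i) x - weak_deriv (u j) x)
         (fun x => weak_deriv (u i) x - weak_deriv (u j) x).
  exact: (dot_ae (weak_deriv_sqint _) (weak_deriv_sqint _) (sD i j) (sD i j)
    (weak_derivB _ _) (weak_derivB _ _)).
have [|f [sf fae fc]] := @sqint_complete _ _ R mu (fun i => u i : points G -> R)
    (fun i => sobolev_sqint (u i)).
  move=> i j ij; apply: le_trans (cau i j ij); rewrite -mE.
  by rewrite lerDr dot_ge0.
have [|g [sg _ gc]] := @sqint_complete _ _ R mu (fun i => weak_deriv (u i))
    (fun i => weak_deriv_sqint (u i)).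
  move=> i j ij; apply: le_trans (cau i j ij); rewrite -DE.
  by rewrite lerDl dot_ge0.
have lim_g k : sqint mu k ->
    (fun i => dot mu (weak_deriv (u i)) k) @ \oo --> dot mu g k.
  by move=> sk; exact: (dot_limit (fun i => weak_deriv_sqint (u i)) sg sk gc).
have /choice[A pA] : forall x, exists A, is_path x A := @path_exists R G.
pose l x := dot mu g \1_(A x).
have lim_l x : (fun i => u i x) @ \oo --> l x.
  under eq_fun do rewrite (sobolev_path _ (pA x)).
  exact/lim_g/path_sqint/pA.
have dl : real_deriv l g.
  split; first exact: sg.1.
  move=> v v0; split; first exact: sqint_edge v0 sg.
  move=> s sl; rewrite (segment_Rintegral _ v0 sl).
  apply: (@cvg_unique R^o _ _ _ _ _ (lim_l (edge_pt v s))); first exact: norm_hausdorff.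
  rewrite (_ : (fun i => u i (edge_pt v s)) = (fun i => u i (vertex_pt (parent v)) +
      dot mu (weak_deriv (u i)) \1_(segment v s))); last first.
    apply/funext => i; have [[_ /(_ v v0)[_ /(_ s sl) e]] _] := weak_derivP (u i); move: e.
    by rewrite (segment_Rintegral _ v0 sl).
  by apply: cvgD; [exact: lim_l|exact/lim_g/segment_sqint].
have l0 : l (root_pt G) = 0.
  apply: (@cvg_unique R^o _ _ _ _ _ (lim_l (root_pt G))); first exact: norm_hausdorff.
  rewrite (_ : (fun i => u i (root_pt G)) = (fun=> 0)); first exact: cvg_cst.
  by apply/funext => i; rewrite sobolev_root.
have fl : {ae mu, forall x, f x = l x}.
  apply: filterS fae => x fx.
  exact: (@cvg_unique R^o _ _ _ _ _ fx (lim_l x)).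
have sl : sqint mu l.
  have ml := real_deriv_measurable dl.
  split; first exact: ml.
  rewrite (_ : (\int[mu]_x _)%E = (\int[mu]_x (f x ^+ 2)%:E)%E); first exact: sf.2.
  have sq_ge0 (h : points G -> R) x : setT x -> (0 <= (h x ^+ 2)%:E)%E.
    by rewrite lee_fin sqr_ge0.
  apply: (ge0_ae_eq_integral measurableT (measurable_EFin_sqr ml)
    (measurable_EFin_sqr sf.1) (sq_ge0 _) (sq_ge0 _)).
  by apply: filterS fl => x -> _.
have hl : l \in h10_pred by apply/asboolP; split=> //; exists g.
pose L := Sobolev hl; exists L => e e0.
have e2 : 0 < e / 2 by rewrite divr_gt0.
have [n1 h1] := fc _ e2; have [n2 h2] := gc _ e2.
exists (maxn n1 n2) => i; rewrite geq_max => /andP[i1 i2].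
rewrite (splitr e); apply: lerD.
  apply: le_trans (h2 i i2); rewrite le_eqVlt; apply/orP; left; apply/eqP.
  have ae : {ae mu, forall x, weak_deriv (u i - L) x = weak_deriv (u i) x - g x}.
    have := real_deriv_unique (weak_derivP L).1 dl.
    by apply: filterS2 (weak_derivB (u i) L) => x -> ->.
  have sB : sqint mu (fun x => weak_deriv (u i) x - g x).
    exact: sqintB (weak_deriv_sqint _) sg.
  exact: (dot_ae (weak_deriv_sqint _) (weak_deriv_sqint _) sB sB ae ae).
apply: le_trans (h1 i i1); rewrite le_eqVlt; apply/orP; left; apply/eqP.
have ae : {ae mu, forall x, (u i - L) x = u i x - f x}.
  by apply: filterS fl => x ->.
have sB : sqint mu (fun x => u i x - f x).
  exact: sqintB (sobolev_sqint _) sf.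
exact: (dot_ae (sobolev_sqint (u i - L)) (sobolev_sqint (u i - L)) sB sB ae ae).
Qed.

End SobolevSpace.

(** * The potential form compared with the Dirichlet form *)

Lemma measurable_lt_set d (T : measurableType d) (R : realType) (f g : T -> R) :
  measurable_fun setT f -> measurable_fun setT g ->
  measurable [set x | f x < g x].
Proof.
move=> mf mg; have := measurable_fun_ltr mf mg.
move=> /(_ measurableT [set true] I); rewrite setTI.
by congr measurable; apply/seteqP; split => x /=.
Qed.

Section Potential.
Context {R : realType} (G : metric_tree R).
Local Notation mu := (@dx R G).
Implicit Types (x : points G) (u v w : sobolev G).

Lemma sobolev_evalD (a : R) u v x : (a *: u + v) x = a * u x + v x. Proof. by []. Qed.

Lemma sobolev_eval_sum (I : finType) (c : I -> R) (e : I -> sobolev G) x :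
  (\sum_i c i *: e i) x = \sum_i c i * e i x.
Proof. by apply: (big_morph (fun u : sobolev G => u x)). Qed.

(* Evaluating sum_i e_i(x) e_i at x itself gives Bessel's inequality for the
   evaluation functional, whose squared norm is |x|. *)
Lemma bessel_pointwise (I : finType) (e : I -> sobolev G) x :
  orthonormal_family (@dirichlet R G) e -> \sum_i e i x ^+ 2 <= dist_root x.
Proof.
move=> oe; set S := \sum_i _.
have := pointwise_sqr_le (\sum_i e i x *: e i) x.
rewrite (orthonormal_sum_sqr _ (@dirichlet_sym_bilinear R G) oe) sobolev_eval_sum.
under eq_bigr do rewrite -expr2.
rewrite -/S expr2; have [->|S0] := eqVneq S 0; first by rewrite dist_root_ge0.
have S_gt0 : 0 < S by rewrite lt_neqAle eq_sym S0 sumr_ge0// => i _; rewrite sqr_ge0.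
by rewrite ler_pM2r.
Qed.

Variables (Psi Q : points G -> R).
Hypotheses (wPsi : weight Psi) (wQ : weight Q).
Hypothesis hardy : forall u,
  (\int[mu]_x (Psi x * u x ^+ 2)%:E <= (dirichlet u u)%:E)%E.

Definition tail := [set x | Psi x < 4 * Q x].

Definition tail_integral : \bar R :=
  (\int[mu]_(x in tail) (dist_root x * Q x)%:E)%E.

Let mPsi : measurable_fun setT Psi. Proof. exact: wPsi.1. Qed.
Let mQ : measurable_fun setT Q. Proof. exact: wQ.1. Qed.
Let Psi_ge0 x : 0 <= Psi x. Proof. exact: wPsi.2. Qed.
Let Q_ge0 x : 0 <= Q x. Proof. exact: wQ.2. Qed.

Let mtail : measurable tail.
Proof.
have m4Q : measurable_fun setT (fun x => 4 * Q x).
  exact: measurable_funM (measurable_cst _) mQ.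
exact: measurable_lt_set mPsi m4Q.
Qed.

Let mu2 u : measurable_fun setT (fun x => u x ^+ 2).
Proof. exact: measurable_funX (sobolev_sqint u).1. Qed.

(** Off [tail] one has Q <= Psi / 4 and the Hardy inequality applies; on [tail] the pointwise
    hypothesis does. A single function, with its Dirichlet energy as c, yields the boundedness of
    the potential form; an orthonormal family, with c = 1, yields the count. *)
Lemma potential_le (I : finType) (e : I -> sobolev G) (c : R) : 0 <= c ->
  (forall x, \sum_i e i x ^+ 2 <= c * dist_root x) ->
  (\int[mu]_x (Q x * \sum_i e i x ^+ 2)%:E <=
   (4^-1 * \sum_i dirichlet (e i) (e i))%:E + c%:E * tail_integral)%E.
Proof.
move=> c0 le_e; pose S x := \sum_i e i x ^+ 2.
have S_ge0 x : 0 <= S x by apply: sumr_ge0 => i _; exact: sqr_ge0.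
have mS : measurable_fun setT S by apply: measurable_sum => i; exact: mu2.
pose T1 x : \bar R := (4^-1%:E * (Psi x * S x)%:E)%E.
pose T2 x : \bar R := (c%:E * (\1_tail x * (dist_root x * Q x))%:E)%E.
have mPS : measurable_fun setT (fun x => (Psi x * S x)%:E).
  by apply/measurable_EFinP; exact: measurable_funM mPsi mS.
have mrQ : measurable_fun setT (fun x => (\1_tail x * (dist_root x * Q x))%:E).
  apply/measurable_EFinP; apply: measurable_funM; first exact: measurable_indic.
  exact: measurable_funM (@measurable_dist_root R G) mQ.
have mT1 : measurable_fun setT T1 by exact: measurable_funeM mPS.
have mT2 : measurable_fun setT T2 by exact: measurable_funeM mrQ.
have PS_ge0 x : (0 <= (Psi x * S x)%:E)%E by rewrite lee_fin mulr_ge0.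
have rQ_ge0 x : (0 <= (\1_tail x * (dist_root x * Q x))%:E)%E.
  by rewrite lee_fin !mulr_ge0// dist_root_ge0.
have T1_ge0 x : (0 <= T1 x)%E by rewrite mule_ge0// lee_fin invr_ge0.
have T2_ge0 x : (0 <= T2 x)%E by rewrite mule_ge0.
have le1 : (\int[mu]_x (Q x * S x)%:E <= \int[mu]_x (T1 x + T2 x))%E.
  have QS_ge0 x : setT x -> (0 <= (Q x * S x)%:E)%E by rewrite lee_fin mulr_ge0.
  have mQS : measurable_fun setT (fun x => (Q x * S x)%:E).
    by apply/measurable_EFinP; exact: measurable_funM mQ mS.
  have mT : measurable_fun setT (fun x => (T1 x + T2 x)%E).
    exact: emeasurable_funD mT1 mT2.
  apply: (@ge0_le_integral _ _ _ mu _ measurableT _ _ QS_ge0 mQS mT) => x _.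
  - rewrite /T1 /T2 -!EFinM -EFinD lee_fin indicE.
    have [/set_mem xt|/negP xt] := boolP (x \in tail).
      have h1 : Q x * S x <= Q x * (c * dist_root x) by exact: ler_wpM2l (le_e x).
      have h2 : 0 <= Psi x * S x by rewrite mulr_ge0.
      by rewrite mul1r; lra.
    have {}xt : 4 * Q x <= Psi x.
      by rewrite leNgt; apply/negP => h; apply: xt; rewrite inE.
    have h1 : 4 * Q x * S x <= Psi x * S x by rewrite ler_wpM2r.
    by rewrite mul0r mulr0; lra.
apply: (le_trans le1); have c0' : (0 <= c%:E)%E by rewrite lee_fin.
have q0' : (0 <= (4^-1 : R)%:E)%E by rewrite lee_fin invr_ge0.
rewrite (ge0_integralD mu measurableT (fun x _ => T1_ge0 x) mT1 (fun x _ => T2_ge0 x) mT2).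
rewrite (ge0_integralZl mu measurableT mrQ (fun x _ => rQ_ge0 x) c0').
rewrite (ge0_integralZl mu measurableT mPS (fun x _ => PS_ge0 x) q0').
apply: leeD; last first.
  apply: lee_wpmul2l; first by rewrite lee_fin.
  rewrite /tail_integral [leRHS]integral_mkcond le_eqVlt; apply/orP; left; apply/eqP.
  apply: eq_integral => x _; rewrite patchE indicE.
  by case: ifPn => _; rewrite ?mul1r ?mul0r.
rewrite EFinM; apply: lee_wpmul2l; first by rewrite lee_fin invr_ge0.
have mPe i : measurable_fun setT (fun x => (Psi x * e i x ^+ 2)%:E).
  by apply/measurable_EFinP; exact: measurable_funM mPsi (mu2 _).
have Pe_ge0 i x : setT x -> (0 <= (Psi x * e i x ^+ 2)%:E)%E.
  by rewrite lee_fin mulr_ge0// sqr_ge0.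
rewrite (eq_integral (fun x => \sum_i (Psi x * e i x ^+ 2)%:E)%E); last first.
  by move=> x _; rewrite sumEFin /S mulr_sumr.
rewrite (ge0_integral_sum mu measurableT mPe Pe_ge0) -sumEFin.
by apply: lee_sum => i _; exact: hardy.
Qed.

(** The square root makes the potential form an inner product in L_2, so that everything about [dot]
    applies to it. *)
Definition potential_fun u x : R := Num.sqrt (Q x) * u x.

Definition potential_form u v := dot mu (potential_fun u) (potential_fun v).

Hypothesis tail_fin : (tail_integral < +oo)%E.

Let b : R := fine tail_integral.

Let tail_ge0 : (0 <= tail_integral)%E.
Proof. by apply: integral_ge0 => x _; rewrite lee_fin mulr_ge0// dist_root_ge0. Qed.

Let tailE : tail_integral = b%:E.
Proof. by rewrite /b fineK// ge0_fin_numE. Qed.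

Let potential_sqrE u x : potential_fun u x ^+ 2 = Q x * u x ^+ 2.
Proof. by rewrite /potential_fun exprMn sqr_sqrtr. Qed.

Let single_le u : (\int[mu]_x (Q x * u x ^+ 2)%:E <=
  ((4^-1 + b) * dirichlet u u)%:E)%E.
Proof.
have := @potential_le unit (fun=> u) (dirichlet u u) (dot_ge0 _ _).
rewrite big_const card_unit /= addr0 tailE -EFinM -EFinD.
have -> : 4^-1 * dirichlet u u + dirichlet u u * b = (4^-1 + b) * dirichlet u u by ring.
have -> : (\int[mu]_x (Q x * u x ^+ 2)%:E)%E =
    (\int[mu]_x (Q x * \sum_(i : unit) u x ^+ 2)%:E)%E.
  by apply: eq_integral => x _; rewrite big_const card_unit /= addr0.
apply=> x; rewrite big_const card_unit /= addr0 mulrC.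
exact: pointwise_sqr_le.
Qed.

Lemma potential_sqint u : sqint mu (potential_fun u).
Proof.
have msqrt : measurable_fun setT (fun x => Num.sqrt (Q x)).
  have ms := continuous_measurable_fun (@sqrt_continuous R).
  exact: (measurable_comp measurableT (@subsetT _ _) ms mQ).
split; first exact: measurable_funM msqrt (sobolev_sqint u).1.
rewrite (eq_integral (fun x => (Q x * u x ^+ 2)%:E)); last first.
  by move=> x _; rewrite potential_sqrE.
exact: le_lt_trans (single_le u) (ltry _).
Qed.

Lemma potential_sym_bilinear : sym_bilinear potential_form.
Proof.
split=> [u v|a u v w]; first exact: dotC.
rewrite /potential_form.
rewrite -(dot_lin a (potential_sqint u) (potential_sqint v) (potential_sqint w)).
by apply: eq_Rintegral => x _; rewrite /potential_fun sobolev_evalD; ring.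
Qed.

Lemma potentialE u :
  (potential_form u u)%:E = (\int[mu]_x (Q x * u x ^+ 2)%:E)%E.
Proof.
rewrite /potential_form (dotE (potential_sqint u)).
by apply: eq_integral => x _; rewrite potential_sqrE.
Qed.

Lemma potential_dirichlet u : potential_form u u <= (4^-1 + b) * dirichlet u u.
Proof. by rewrite -lee_fin potentialE. Qed.

Lemma potential_null u : l2dot u u = 0 -> potential_form u u = 0.
Proof.
move=> /(dot_eq0 (sobolev_sqint u)) u0; have su := potential_sqint u.
rewrite /potential_form (@dot_ae _ _ _ mu _ _ (fun=> 0) (fun=> 0) su su (sqint0 mu) (sqint0 mu)).
- rewrite /dot; under eq_Rintegral do rewrite mul0r.
  by rewrite (Rintegral_cst mu measurableT) mul0r.
- by apply: filterS u0 => x ux; rewrite /potential_fun ux mulr0.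
- by apply: filterS u0 => x ux; rewrite /potential_fun ux mulr0.
Qed.

(** Summing D <= 2 w over the n members gives n <= 2 (n / 4 + b), where n / 2 is absorbed on the
    left. *)
Lemma orthonormal_size (I : finType) (e : I -> sobolev G) :
  orthonormal_family (@dirichlet R G) e ->
  (forall i, dirichlet (e i) (e i) <= 2 * potential_form (e i) (e i)) ->
  (#|I|%:R <= 4 * b).
Proof.
move=> oe le_e.
have sumD : \sum_i dirichlet (e i) (e i) = #|I|%:R.
  under eq_bigr do rewrite oe eqxx.
  by rewrite sumr_const.
have := @potential_le I e 1 ler01; rewrite sumD tailE -EFinM -EFinD mul1r => h.
have {}h : \sum_i potential_form (e i) (e i) <= 4^-1 * #|I|%:R + b.
  rewrite -lee_fin -sumEFin.
  under eq_bigr do rewrite potentialE.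
  have mQe i : measurable_fun setT (fun x => (Q x * e i x ^+ 2)%:E).
    by apply/measurable_EFinP; exact: measurable_funM mQ (mu2 _).
  have Qe_ge0 i x : setT x -> (0 <= (Q x * e i x ^+ 2)%:E)%E.
    by rewrite lee_fin mulr_ge0// sqr_ge0.
  rewrite -(ge0_integral_sum mu measurableT mQe Qe_ge0).
  rewrite (eq_integral (fun x => (Q x * \sum_i e i x ^+ 2)%:E)).
    by apply: h => x; rewrite mul1r; exact: bessel_pointwise.
  by move=> x _; rewrite sumEFin mulr_sumr.
have : \sum_i dirichlet (e i) (e i) <= \sum_i 2 * potential_form (e i) (e i).
  by apply: ler_sum.
rewrite sumD -mulr_sumr; move: h; set n := #|I|%:R; set S := \sum_i _; lra.
Qed.

End Potential.

(** * Reduction of complex functions to their real and imaginary parts *)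

Section ComplexFunctions.
Context {R : realType} (G : metric_tree R).
Local Notation mu := (@dx R G).
Local Notation Re := (@complex.Re R).
Local Notation Im := (@complex.Im R).
Implicit Types (x : points G) (f h p q : points G -> R) (F : points G -> R[i]).

Definition cpx f h : points G -> R[i] := fun x => f x +i* h x.

Lemma cpxE F : F = cpx (fun x => Re (F x)) (fun x => Im (F x)).
Proof. by apply/funext => x; rewrite /cpx; case: (F x). Qed.

Lemma normsq_ge0 (z : R[i]) : 0 <= normsq z.
Proof. by rewrite /normsq addr_ge0// sqr_ge0. Qed.

Lemma measurable_normsq F : cmeasurable F -> measurable_fun setT (fun x => normsq (F x)).
Proof. by move=> [mr mi]; apply: measurable_funD; exact: measurable_funX. Qed.

Lemma cpx_normsq_integral (A : set (points G)) F : measurable A -> cmeasurable F ->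
  (\int[mu]_(x in A) (normsq (F x))%:E = \int[mu]_(x in A) (Re (F x) ^+ 2)%:E +
   \int[mu]_(x in A) (Im (F x) ^+ 2)%:E)%E.
Proof.
move=> mA [mr mi].
have sq_ge0 (k : points G -> R) x : A x -> (0 <= (k x ^+ 2)%:E)%E.
  by rewrite lee_fin sqr_ge0.
have msq (k : points G -> R) : measurable_fun setT k ->
    measurable_fun A (fun x => (k x ^+ 2)%:E).
  by move=> mk; exact: measurable_funTS (measurable_EFin_sqr mk).
rewrite -(@ge0_integralD _ _ _ mu A mA _ _ (sq_ge0 _) (msq _ mr) (sq_ge0 _) (msq _ mi)).
by apply: eq_integral => x _; rewrite -EFinD.
Qed.

Lemma lte_add_pinftyP (a b : \bar R) : (0 <= a)%E -> (0 <= b)%E ->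
  (a + b < +oo)%E <-> (a < +oo)%E /\ (b < +oo)%E.
Proof.
move=> a0 b0; split=> [|[]]; last exact: lte_add_pinfty.
by move=> h; split; apply: le_lt_trans h; [exact: leeDl|exact: leeDr].
Qed.

Lemma integral_sqr_ge0 (A : set (points G)) f :
  (0 <= \int[mu]_(x in A) (f x ^+ 2)%:E)%E.
Proof. by apply: integral_ge0 => x _; rewrite lee_fin sqr_ge0. Qed.

Lemma L2P F : L2 F <-> sqint mu (fun x => Re (F x)) /\ sqint mu (fun x => Im (F x)).
Proof.
split=> [[[mr mi]]|[[mr r2] [mi i2]]].
  rewrite (@cpx_normsq_integral _ F measurableT (conj mr mi)) => /lte_add_pinftyP.
  by move=> /(_ (integral_sqr_ge0 _ _) (integral_sqr_ge0 _ _))[r2 i2].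
split; first exact: conj mr mi.
rewrite (@cpx_normsq_integral _ F measurableT (conj mr mi)).
exact: lte_add_pinfty r2 i2.
Qed.

Lemma is_deriv_cpx f h p q : is_deriv (cpx f h) (cpx p q) <->
  real_deriv f p /\ real_deriv h q.
Proof.
split.
  move=> [[mp mq] dv]; split; split; [exact: mp| |exact: mq|];
    move=> v v0; have [+ uv] := dv v v0;
    rewrite (@cpx_normsq_integral _ (cpx p q) (measurable_edge_setT v0) (conj mp mq));
    move=> /(lte_add_pinftyP (integral_sqr_ge0 _ _) (integral_sqr_ge0 _ _))[ip iq];
    split=> // s sl; have := uv s sl.
  - by move=> /(congr1 Re).
  - by move=> /(congr1 Im).
move=> [[mp dp] [mq dq]]; split; first exact: conj mp mq.
move=> v v0; have [ip up] := dp v v0; have [iq uq] := dq v v0; split.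
  rewrite (@cpx_normsq_integral _ (cpx p q) (measurable_edge_setT v0) (conj mp mq)).
  exact: lte_add_pinfty ip iq.
by move=> s sl; rewrite /cpx up// uq.
Qed.

Lemma is_deriv_parts f h E : is_deriv (cpx f h) E ->
  real_deriv f (fun x => Re (E x)) /\ real_deriv h (fun x => Im (E x)).
Proof. by rewrite [E in is_deriv _ E]cpxE => /is_deriv_cpx. Qed.

Lemma derivP F : (exists g, is_deriv F g) -> is_deriv F (deriv F).
Proof. by move=> [g]; exact: xgetI. Qed.

Lemma H10_sobolev F : H10 F -> exists f h : sobolev G, F = cpx f h.
Proof.
move=> [[dF iF] F0]; have := derivP dF; rewrite {1}(cpxE F) {1}(cpxE (deriv F)).
set f := fun x => Re (F x); set h := fun x => Im (F x).
set p := fun x => Re (deriv F x); set q := fun x => Im (deriv F x).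
move=> /is_deriv_cpx[df dh].
have mf := real_deriv_measurable df; have mh := real_deriv_measurable dh.
have mp := df.1; have mq := dh.1.
have n_ge0 (E : points G -> R[i]) x : setT x -> (0 <= (normsq (E x))%:E)%E.
  by rewrite lee_fin normsq_ge0.
have mn E : cmeasurable E -> measurable_fun setT (fun x => (normsq (E x))%:E).
  by move=> mE; apply/measurable_EFinP; exact: measurable_normsq.
have ndF := mn (deriv F) (conj mp mq); have nF := mn F (conj mf mh).
have : (\int[mu]_x ((normsq (deriv F x))%:E + (normsq (F x))%:E) < +oo)%E.
  by apply: le_lt_trans iF; rewrite le_eqVlt; apply/orP; left; apply/eqP;
    apply: eq_integral => x _; rewrite EFinD.
rewrite (@ge0_integralD _ _ _ mu _ measurableT _ _ (n_ge0 _) ndF (n_ge0 _) nF).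
have in_ge0 E : (0 <= \int[mu]_x (normsq (E x))%:E)%E.
  by apply: integral_ge0 => x; exact: n_ge0.
move=> /(lte_add_pinftyP (in_ge0 _) (in_ge0 _))[].
rewrite (@cpx_normsq_integral _ (deriv F) measurableT (conj mp mq)).
move=> /(lte_add_pinftyP (integral_sqr_ge0 _ _) (integral_sqr_ge0 _ _))[p2 q2].
rewrite (@cpx_normsq_integral _ F measurableT (conj mf mh)).
move=> /(lte_add_pinftyP (integral_sqr_ge0 _ _) (integral_sqr_ge0 _ _))[f2 h2].
have hf : (f : points G -> R^o) \in @h10_pred R G.
  apply/asboolP; split; [by rewrite /f F0|exact: conj mf f2|].
  by exists p; split; [exact: df|exact: conj mp p2].
have hh : (h : points G -> R^o) \in @h10_pred R G.
  apply/asboolP; split; [by rewrite /h F0|exact: conj mh h2|].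
  by exists q; split; [exact: dh|exact: conj mq q2].
by exists (Sobolev hf), (Sobolev hh); rewrite {1}(cpxE F).
Qed.

(** [deriv] is an arbitrary derivative. By uniqueness its parts agree almost everywhere with
    [weak_deriv], and they inherit square-integrability from it. *)
Lemma deriv_cpx (f h : sobolev G) :
  [/\ {ae mu, forall x, Re (deriv (cpx f h) x) = weak_deriv f x},
      {ae mu, forall x, Im (deriv (cpx f h) x) = weak_deriv h x} &
      L2 (deriv (cpx f h))].
Proof.
have [df sf] := weak_derivP f; have [dh sh] := weak_derivP h.
have : is_deriv (cpx f h) (deriv (cpx f h)).
  apply: derivP; exists (cpx (weak_deriv f) (weak_deriv h)).
  exact: (is_deriv_cpx _ _ _ _).2 (conj df dh).
move=> /is_deriv_parts[df' dh'].
have ef := real_deriv_unique df' df; have eh := real_deriv_unique dh' dh.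
split; [exact: ef|exact: eh|apply/L2P].
have ae_sq (k k' : points G -> R) : measurable_fun setT k -> sqint mu k' ->
    {ae mu, forall x, k x = k' x} -> sqint mu k.
  move=> mk [mk' k2] kk'; split; first exact: mk.
  rewrite (_ : (\int[mu]_x _)%E = (\int[mu]_x (k' x ^+ 2)%:E)%E); first exact: k2.
  have sq_ge0 (l : points G -> R) x : setT x -> (0 <= (l x ^+ 2)%:E)%E.
    by rewrite lee_fin sqr_ge0.
  apply: (ge0_ae_eq_integral measurableT (measurable_EFin_sqr mk)
    (measurable_EFin_sqr mk') (sq_ge0 _) (sq_ge0 _)).
  by apply: filterS kk' => x -> _.
by split; [exact: ae_sq df'.1 sf ef|exact: ae_sq dh'.1 sh eh].
Qed.

Lemma H10_cpx (f h : sobolev G) : H10 (cpx f h).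
Proof.
have [ef eh [md id]] := deriv_cpx f h.
split; last by rewrite /cpx !sobolev_root.
split.
  exists (cpx (weak_deriv f) (weak_deriv h)); apply/is_deriv_cpx.
  by split; exact: (weak_derivP _).1.
have [mF iF] : L2 (cpx f h) by apply/L2P; split; exact: sobolev_sqint.
have n_ge0 (E : points G -> R[i]) x : setT x -> (0 <= (normsq (E x))%:E)%E.
  by rewrite lee_fin normsq_ge0.
have mn E : cmeasurable E -> measurable_fun setT (fun x => (normsq (E x))%:E).
  by move=> mE; apply/measurable_EFinP; exact: measurable_normsq.
have := @ge0_integralD _ _ _ mu _ measurableT _ _ (n_ge0 _) (mn _ md) (n_ge0 _) (mn _ mF).
by under eq_integral do rewrite -EFinD; move=> ->; exact: lte_add_pinfty id iF.
Qed.

Lemma L2norm_sqr F : L2 F -> L2norm F ^+ 2 =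
  dot mu (fun x => Re (F x)) (fun x => Re (F x)) +
  dot mu (fun x => Im (F x)) (fun x => Im (F x)).
Proof.
move=> LF; have [sr si] := (L2P F).1 LF.
rewrite /L2norm sqr_sqrtr; last first.
  by apply: Rintegral_ge0 => x _; exact: normsq_ge0.
rewrite -(RintegralD measurableT (sqint_mul_integrable sr sr) (sqint_mul_integrable si si)).
by apply: eq_Rintegral => x _; rewrite /normsq !expr2.
Qed.

Lemma dotL2_cpx F p q : L2 F -> sqint mu p -> sqint mu q ->
  dotL2 F (cpx p q) =
   (dot mu (fun x => Re (F x)) p + dot mu (fun x => Im (F x)) q) +i*
   (dot mu (fun x => Im (F x)) p - dot mu (fun x => Re (F x)) q).
Proof.
move=> /L2P[sr si] sp sq.
rewrite -(RintegralD measurableT (sqint_mul_integrable sr sp) (sqint_mul_integrable si sq)).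
rewrite -(RintegralB measurableT (sqint_mul_integrable si sp) (sqint_mul_integrable sr sq)).
by rewrite /dotL2 /cintegral; congr (_ +i* _); apply: eq_Rintegral => x _;
  rewrite /cpx; case: (F x) => a b /=; ring.
Qed.

Section Form.
Variables (a : R) (V : points G -> R).
Hypotheses (a_gt0 : 0 < a) (wV : weight V).
Let Q x := a * V x.
Hypothesis sQ : forall u : sobolev G, sqint mu (potential_fun Q u).

Definition sform (u v : sobolev G) := dirichlet u v - potential_form Q u v.

Let pot_mul (u v : sobolev G) x :
  potential_fun Q u x * potential_fun Q v x = Q x * (u x * v x).
Proof.
have Q0 : 0 <= Q x by rewrite mulr_ge0 ?wV.2// ltW.
rewrite /potential_fun; move: (Q x) Q0 => r r0.
by rewrite mulrACA -expr2 sqr_sqrtr.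
Qed.

Let pot_integrable (u v : sobolev G) :
  mu.-integrable setT (EFin \o (fun x => Q x * (u x * v x))).
Proof.
have := sqint_mul_integrable (sQ u) (sQ v).
by rewrite (_ : (fun x => _) = (fun x => Q x * (u x * v x)))//; apply/funext => x.
Qed.

Let pot_E (u v : sobolev G) :
  \int[mu]_x (Q x * (u x * v x)) = potential_form Q u v.
Proof. by apply: eq_Rintegral => x _; rewrite pot_mul. Qed.

Lemma hform_cpx (f h p q : sobolev G) : hform a V (cpx f h) (cpx p q) =
  (sform f p + sform h q) +i* (sform h p - sform f q).
Proof.
have [ef eh /L2P[sf sh]] := deriv_cpx f h; have [ep eq /L2P[sp sq]] := deriv_cpx p q.
have [wf wh] := (weak_deriv_sqint f, weak_deriv_sqint h).
have [wp wq] := (weak_deriv_sqint p, weak_deriv_sqint q).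
have Dfp := dot_ae sf sp wf wp ef ep; have Dhq := dot_ae sh sq wh wq eh eq.
have Dhp := dot_ae sh sp wh wp eh ep; have Dfq := dot_ae sf sq wf wq ef eq.
rewrite /sform /dirichlet -Dfp -Dhq -Dhp -Dfq -!pot_E.
have int := sqint_mul_integrable.
have iD := integrableD measurableT.
(* To be used with c = 1 for the real part and c = -1 for the imaginary part. *)
have comb (k1 k2 k3 k4 : points G -> R) c :
    mu.-integrable setT (EFin \o k1) -> mu.-integrable setT (EFin \o k2) ->
    mu.-integrable setT (EFin \o k3) -> mu.-integrable setT (EFin \o k4) ->
    \int[mu]_x (k1 x - k2 x + c * (k3 x - k4 x)) =
    \int[mu]_x k1 x - \int[mu]_x k2 x + c * (\int[mu]_x k3 x - \int[mu]_x k4 x).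
  move=> i1 i2 i3 i4.
  have i12 : mu.-integrable setT (EFin \o (fun x => k1 x - k2 x)).
    have := integrableB measurableT i1 i2.
    by apply: eq_integrable => // x _.
  have i34 : mu.-integrable setT (EFin \o (fun x => k3 x - k4 x)).
    have := integrableB measurableT i3 i4.
    by apply: eq_integrable => // x _.
  have ic34 : mu.-integrable setT (EFin \o (fun x => c * (k3 x - k4 x))).
    have := integrableZl measurableT c i34.
    by apply: eq_integrable => // x _.
  rewrite (RintegralD measurableT i12 ic34) (RintegralZl _ measurableT i34).
  by rewrite (RintegralB measurableT i1 i2) (RintegralB measurableT i3 i4).
rewrite /hform /cintegral; congr (_ +i* _).
- transitivity (\int[mu]_x ((Re (deriv (cpx f h) x) * Re (deriv (cpx p q) x) -
      Q x * (f x * p x)) + 1 * (Im (deriv (cpx f h) x) * Im (deriv (cpx p q) x) -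
      Q x * (h x * q x)))).
    apply: eq_Rintegral => x _; rewrite /cpx.
    by case: (deriv _ x) => a1 b1; case: (deriv _ x) => a2 b2; rewrite /Q /=; ring.
  rewrite comb; first by rewrite mul1r.
  + exact: int sf sp.
  + exact: pot_integrable.
  + exact: int sh sq.
  + exact: pot_integrable.
- transitivity (\int[mu]_x ((Im (deriv (cpx f h) x) * Re (deriv (cpx p q) x) -
      Q x * (h x * p x)) + (-1) * (Re (deriv (cpx f h) x) * Im (deriv (cpx p q) x) -
      Q x * (f x * q x)))).
    apply: eq_Rintegral => x _; rewrite /cpx.
    by case: (deriv _ x) => a1 b1; case: (deriv _ x) => a2 b2; rewrite /Q /=; ring.
  rewrite comb; first by rewrite mulN1r.
  + exact: int sh sp.
  + exact: pot_integrable.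
  + exact: int sf sq.
  + exact: pot_integrable.
Qed.

(** The coefficients of the form are real. Testing with a real v already gives both equations, as
    the real and the imaginary part of one complex identity. *)
Lemma schrodinger_cpx (f h : sobolev G) F : schrodinger a V (cpx f h) F <->
  L2 F /\ forall v : sobolev G, sform f v = dot mu (fun x => Re (F x)) v /\
                                sform h v = dot mu (fun x => Im (F x)) v.
Proof.
split=> [[_ LF Fw]|[LF Fw]].
  split; [exact: LF|move=> v]; have := Fw _ (H10_cpx v 0).
  rewrite hform_cpx (dotL2_cpx LF (sobolev_sqint v) (sobolev_sqint 0)).
  have z (k : points G -> R) : dot mu k (0 : sobolev G) = 0.
    rewrite /dot; under eq_Rintegral do rewrite mulr0.
    by rewrite (Rintegral_cst mu measurableT) mul0r.
  have bD := dirichlet_sym_bilinear G.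
  have s0 u : sform u 0 = 0.
    rewrite /sform (formC bD) (form0l bD) /potential_form /dot.
    under eq_Rintegral do rewrite /potential_fun mulr0 mulr0.
    by rewrite (Rintegral_cst mu measurableT) mul0r subr0.
  by rewrite !z !s0 !addr0 !subr0 => -[].
split; [exact: H10_cpx|exact: LF|] => w /H10_sobolev[p [q ->]].
rewrite hform_cpx (dotL2_cpx LF (sobolev_sqint p) (sobolev_sqint q)).
by have [-> ->] := Fw p; have [-> ->] := Fw q.
Qed.

End Form.

Lemma hardy_sobolev (Psi : points G -> R) : hardy_inequality Psi 1 ->
  forall u : sobolev G,
  (\int[mu]_x (Psi x * u x ^+ 2)%:E <= (dirichlet u u)%:E)%E.
Proof.
move=> hP u; have := hP _ (H10_cpx u 0); rewrite mul1e.
have [eu e0 /L2P[su s0]] := deriv_cpx u 0.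
rewrite (@cpx_normsq_integral _ (deriv (cpx u 0)) measurableT (conj su.1 s0.1)) -(dotE su) -(dotE s0).
have wu := weak_deriv_sqint u; have w0 := weak_deriv_sqint (0 : sobolev G).
rewrite (dot_ae su su wu wu eu eu) (dot_ae s0 s0 w0 w0 e0 e0).
rewrite -/(dirichlet 0 0) (form0l (dirichlet_sym_bilinear G)) adde0.
apply: le_trans; rewrite le_eqVlt; apply/orP; left; apply/eqP.
by apply: eq_integral => x _; rewrite /cpx /normsq /= expr0n addr0.
Qed.

End ComplexFunctions.

(** * Negative spectrum: multiplicities and resolvent *)

Section Spectrum.
Context {R : realType} (G : metric_tree R).
Local Notation mu := (@dx R G).
Local Notation Re := (@complex.Re R).
Local Notation Im := (@complex.Im R).
Variables (Psi V : points G -> R) (a : R).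
Hypotheses (wPsi : weight Psi) (wV : weight V) (a_gt0 : 0 < a).
Hypothesis hardy : hardy_inequality Psi 1.
Local Notation Q := (fun x => a * V x).
Hypothesis tail_fin : (tail_integral Psi Q < +oo)%E.

Let b : R := fine (tail_integral Psi Q).

Let wQ : weight Q.
Proof.
split; first exact: measurable_funM (measurable_cst _) wV.1.
by move=> x; rewrite mulr_ge0 ?wV.2// ltW.
Qed.

Let hP := hardy_sobolev hardy.
Let sQ := potential_sqint wPsi wQ hP tail_fin.
Let T := schrodinger a V.
Let N := Num.truncn (4 * b).
Let D := @dirichlet R G.
Let m := @l2dot R G.
Let w := potential_form Q.
Let bD : sym_bilinear D := @dirichlet_sym_bilinear R G.
Let bm : sym_bilinear m := @l2dot_sym_bilinear R G.
Let bw : sym_bilinear w := potential_sym_bilinear wPsi wQ hP tail_fin.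
Let eig := eigen D m w.

Let tail_ge0 : (0 <= tail_integral Psi Q)%E.
Proof.
apply: integral_ge0 => x _.
by rewrite lee_fin mulr_ge0 ?dist_root_ge0// wQ.2.
Qed.

Let b_ge0 : 0 <= b. Proof. exact: fine_ge0. Qed.

Let bound (I : finType) (e : I -> sobolev G) : orthonormal_family D e ->
  (forall i, D (e i) (e i) <= 2 * w (e i) (e i)) -> (#|I| <= N)%N.
Proof.
move=> oe le_e; rewrite truncn_ge_nat ?mulr_ge0//.
exact: orthonormal_size wPsi wQ hP tail_fin I e oe le_e.
Qed.

Let m_ge0 u : 0 <= m u u. Proof. exact: dot_ge0. Qed.
Let w_ge0 u : 0 <= w u u. Proof. exact: dot_ge0. Qed.
Let w_null u : m u u = 0 -> w u u = 0.
Proof. exact: potential_null wPsi wQ hP tail_fin u. Qed.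

Let sformE (u : sobolev G) v : sform a V u v = D u v - w u v.
Proof. by []. Qed.

Let eigen_basis := eigenbasis bD bm bw (@dirichlet_gt0 R G) m_ge0 w_ge0 bound.
Let eigen_total (K : finType) (l : K -> R) (I : K -> finType)
    (e : forall k, I k -> sobolev G) :=
  @eigen_total_size R (sobolev G) D m w N bD bm bw (@dirichlet_gt0 R G) m_ge0 w_ge0
    bound K l I e.

Let dot_scale l (f v : sobolev G) : dot mu (fun x => l * f x) v = l * m f v.
Proof.
by rewrite /m /l2dot /dot -(RintegralZl _ measurableT (sqint_mul_integrable
  (sobolev_sqint f) (sobolev_sqint v))); apply: eq_Rintegral => x _; rewrite mulrA.
Qed.

Lemma eigenfunction_parts l F : T F (fun x => l%:C * F x) ->
  exists f h : sobolev G, [/\ F = cpx f h, eig l f & eig l h].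
Proof.
move=> TF; have [/H10_sobolev[f [h FE]] _ _] := TF.
exists f, h; split=> //; move: TF; rewrite FE => /(schrodinger_cpx a_gt0 wV sQ)[_ E] v.
  have [+ _] := E v; rewrite sformE => ->; rewrite -dot_scale.
  by apply: eq_Rintegral => x _ /=; ring.
have [_ +] := E v; rewrite sformE => ->; rewrite -dot_scale.
by apply: eq_Rintegral => x _ /=; ring.
Qed.

(** Up to null sets the real family e spans all complex eigenfunctions over the complex numbers.
    More than #|I| of them have linearly dependent coordinate vectors, so a complex multiplicity is
    bounded by a real dimension. *)
Lemma multiplicity_le l (I : finType) (e : I -> sobolev G) :
  (forall u, eig l u -> let v := u - \sum_i m u (e i) *: e i in m v v = 0) ->
  (multiplicity T l%:C <= #|I|%:R%:E)%E.
Proof.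
move=> he; apply: ge_ereal_sup => _ [n [u [Tu iu]] <-]; rewrite lee_fin ler_nat.
rewrite leqNgt; apply/negP => In.
have /choice[f hf] : forall i, exists f : sobolev G * sobolev G,
    [/\ u i = cpx f.1 f.2, eig l f.1 & eig l f.2].
  by move=> i; have [f [h fh]] := eigenfunction_parts (Tu i); exists (f, h).
have [|c [[i0 ci0] cA]] := @exists_kernel R[i] 'I_n I
    (fun i j => m (f i).1 (e j) +i* m (f i).2 (e j)).
  by rewrite card_ord.
have expand u' : eig l u' ->
    {ae mu, forall x, u' x = \sum_j m u' (e j) * e j x}.
  move=> /he /(dot_eq0 (sobolev_sqint _)); apply: filterS => x /eqP.
  set s := \sum_i _; have -> : (u' - s) x = u' x - s x by [].
  by rewrite subr_eq0 => /eqP ->; rewrite /s sobolev_eval_sum.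
have ae1 : {ae mu, forall x, forall i, (f i).1 x = \sum_j m (f i).1 (e j) * e j x}.
  by apply: filter_forall => i; have [_ e1 _] := hf i; exact: expand.
have ae2 : {ae mu, forall x, forall i, (f i).2 x = \sum_j m (f i).2 (e j) * e j x}.
  by apply: filter_forall => i; have [_ _ e2] := hf i; exact: expand.
suff /iu/(_ i0)/eqP : {ae mu, forall x, \sum_(i < n) c i * u i x = 0}.
  by rewrite (negbTE ci0).
apply: filterS2 ae1 ae2 => x e1 e2.
have uE i : u i x = \sum_j (m (f i).1 (e j) +i* m (f i).2 (e j)) * (e j x)%:C.
  have [-> _ _] := hf i; rewrite /cpx e1 e2.
  apply/eqP; rewrite eq_complex; apply/andP; split; apply/eqP => /=.
    rewrite (big_morph Re (id1 := 0) (op1 := +%R)); [|by case=> ? ? [? ?]|by []].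
    by apply: eq_bigr => j _ /=; rewrite mulr0 subr0.
  rewrite (big_morph Im (id1 := 0) (op1 := +%R)); [|by case=> ? ? [? ?]|by []].
  by apply: eq_bigr => j _ /=; rewrite mulr0 add0r.
under eq_bigr do rewrite uE mulr_sumr.
rewrite exchange_big /= big1// => j _.
under eq_bigr do rewrite mulrA.
by rewrite -mulr_suml cA mul0r.
Qed.

(** The two parts of the right-hand side are solved for separately. The trivial kernel identifies
    any solution with the one constructed, so that the norm bound carries over to it. *)
Lemma resolvent_of_kernel l : l < 0 -> (forall u, eig l u -> u = 0) ->
  resolvent_set T l%:C.
Proof.
move=> l0 ker0.
have Nl0 : 0 < - l by rewrite oppr_gt0.
have [|K [K0 solve]] := @finite_index_solve R (sobolev G) D m w (4^-1 + b) N
    bD bm bw (@dirichlet_gt0 R G) m_ge0 w_ge0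
    (potential_dirichlet wPsi wQ hP tail_fin) bound _ Nl0
    (@sobolev_complete R G).
  by move=> u; rewrite opprK; exact: ker0.
have solve1 k : sqint mu k -> exists u : sobolev G,
    (forall v : sobolev G, D u v - w u v = l * m u v + dot mu k v) /\
    m u u <= K * dot mu k k.
  move=> sk; have [|||u [uE mu_le]] := solve (fun v : sobolev G => dot mu k v) (dot mu k k).
  - move=> c u v; rewrite !(dotC _ k).
    exact: dot_lin (sobolev_sqint u) (sobolev_sqint v) sk.
  - exact: dot_ge0.
  - by move=> v; exact: dot_CauchySchwarz sk (sobolev_sqint v).
  by exists u; split=> // v; have := uE v; rewrite mulNr; lra.
have TE (f h : sobolev G) F : L2 F ->
    T (cpx f h) (fun x => l%:C * cpx f h x + F x) <->
    forall v : sobolev G,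
      D f v - w f v = l * m f v + dot mu (fun x => Re (F x)) v /\
      D h v - w h v = l * m h v + dot mu (fun x => Im (F x)) v.
  move=> LF; have [sr si] := (L2P F).1 LF.
  have er : (fun x => Re (l%:C * cpx f h x + F x)) = (fun x => l * f x + Re (F x)).
    by apply/funext => x; case: (F x) => ? ? /=; ring.
  have ei : (fun x => Im (l%:C * cpx f h x + F x)) = (fun x => l * h x + Im (F x)).
    by apply/funext => x; case: (F x) => ? ? /=; ring.
  have sf := sobolev_sqint f; have sh := sobolev_sqint h.
  have L : L2 (fun x => l%:C * cpx f h x + F x).
    apply/L2P; split.
      by have := sqint_lin l sf sr; rewrite -er.
    by have := sqint_lin l sh si; rewrite -ei.
  split=> [/(schrodinger_cpx a_gt0 wV sQ)[_ E] v|E].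
    have := E v; rewrite er ei (dot_lin l sf sr (sobolev_sqint v)).
    by rewrite (dot_lin l sh si (sobolev_sqint v)).
  apply/(schrodinger_cpx a_gt0 wV sQ); split; first exact: L.
  move=> v; rewrite er ei (dot_lin l sf sr (sobolev_sqint v)).
  rewrite (dot_lin l sh si (sobolev_sqint v)); exact: E v.
(* [K] bounds squared norms. *)
exists (Num.sqrt K) => F LF; have [sr si] := (L2P F).1 LF.
have [f [fE mf]] := solve1 _ sr; have [h [hE mh]] := solve1 _ si.
split; first by exists (cpx f h); apply/TE.
move=> u Tu; have [/H10_sobolev[f' [h' uE]] _ _] := Tu.
move: Tu; rewrite uE => /(TE _ _ _ LF) E.
have ff : f' = f.
  apply/eqP; rewrite -subr_eq0; apply/eqP/ker0 => v.
  rewrite (formBl bD) (formBl bw) (formBl bm).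
  by have [e1 _] := E v; have e2 := fE v; lra.
have hh : h' = h.
  apply/eqP; rewrite -subr_eq0; apply/eqP/ker0 => v.
  rewrite (formBl bD) (formBl bw) (formBl bm).
  by have [_ e1] := E v; have e2 := hE v; lra.
rewrite ff hh.
have LU : L2 (cpx f h) by apply/L2P; split; exact: sobolev_sqint.
rewrite -ler_sqr ?nnegrE ?mulr_ge0 ?sqrtr_ge0// exprMn (sqr_sqrtr K0).
by rewrite (L2norm_sqr LU) (L2norm_sqr LF) mulrDr; exact: lerD.
Qed.

(** Bases of all negative eigenspaces are chosen at once, and any finitely many of them have at most
    N elements together. This bounds the number of negative spectral points, so that [N_minus] takes
    its first branch, and then the sum of the multiplicities. *)
Lemma N_minus_le_fin : (N_minus T <= 4%:E * tail_integral Psi Q)%E.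
Proof.
have /choice[B hB] : forall l : R, exists B : {I : finType & I -> sobolev G},
    l < 0 -> [/\ orthonormal_family m (projT2 B), forall i, eig l (projT2 B i) &
      forall u, eig l u ->
        let v := u - \sum_i m u (projT2 B i) *: projT2 B i in m v v = 0].
  (* For l >= 0 nothing is required, and the empty family is a placeholder. *)
  move=> l; have [l0|l0] := ltP l 0; last first.
    by exists (existT _ (void : finType) (fun=> 0)).
  by have [I [e ee]] := eigen_basis l0; exists (existT _ I e).
pose n l := #|projT1 (B l)|.
have total (X : {fset R}) : [set` X] `<=` [set l | l < 0] ->
    (\sum_(l <- X) n l <= N)%N.
  move=> X0; rewrite big_seq_fsetE /=.
  have X0' (l : X) : fsval l < 0 by apply: X0; rewrite /=; exact: fsvalP.
  apply: (@eigen_total X val (fun l => projT1 (B (val l)))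
    (fun l => projT2 (B (val l)))) => [|l|l|l i].
  - exact: val_inj.
  - exact/ltW/X0'.
  - by have [e _ _] := hB _ (X0' l); exact: e.
  - by have [_ e _] := hB _ (X0' l); exact: e.
(* An empty basis means a trivial kernel, which puts l in the resolvent set; so every negative
   spectral point contributes to the total. *)
have spec l : l < 0 -> spectrum T l%:C -> (0 < n l)%N.
  move=> l0 sl; rewrite lt0n; apply: contra_notN sl => /eqP n0.
  apply: resolvent_of_kernel => // u eu; apply/eqP; apply: contraT => u0.
  have := eigen_gt0 (@dirichlet_gt0 R G) m_ge0 w_null eu u0.
  have [_ _ /(_ u eu)] := hB _ l0; rewrite big1 ?subr0 => [-> |]; first by rewrite ltxx.
  by move=> i; have := fintype0 i n0.
have fin : finite_set [set l : R | l < 0 /\ spectrum T l%:C].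
  apply: contrapT => /(infinite_set_fset N.+1)[X Xs NX].
  have := total X (fun l lX => (Xs l lX).1); rewrite leqNgt => /negP; apply.
  apply: leq_trans NX _; rewrite -sum1_size big_seq [leqRHS]big_seq.
  apply: leq_sum => l lX.
  by have [l0 sl] := Xs l lX; exact: spec.
rewrite /N_minus asboolT//; apply: ge_ereal_sup => _ [X [finX X0] <-].
apply: (@le_trans _ _ N%:R%:E); last first.
  have -> : tail_integral Psi Q = b%:E by rewrite fineK// ge0_fin_numE.
  by rewrite -EFinM lee_fin truncn_le mulr_ge0.
rewrite fsbig_finite//; apply: (@le_trans _ _ (\sum_(l <- fset_set X) (n l)%:R%:E)%E).
  rewrite big_seq [leRHS]big_seq; apply: lee_sum => l; rewrite in_fset_set// inE => lX.
  by have [_ _ he] := hB _ (X0 _ lX); exact: multiplicity_le he.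
rewrite sumEFin lee_fin -natr_sum ler_nat; apply: total.
by rewrite fset_setK.
Qed.

End Spectrum.

Lemma N_minus_le {R : realType} (G : metric_tree R) (Psi V : points G -> R) (a : R) :
  weight Psi -> weight V -> 0 < a -> hardy_inequality Psi 1 ->
  (N_minus (schrodinger a V) <= 4%:E * tail_integral Psi (fun x => (a * V x)%R))%E.
Proof.
move=> wPsi wV a0 hP.
have [fin|] := boolP (tail_integral Psi (fun x => (a * V x)%R) < +oo)%E.
  exact: N_minus_le_fin.
by rewrite -leNgt leye_eq => /eqP ->; rewrite gt0_muley ?leey// lte_fin.
Qed.

(** * Tail integrals estimated by weak and strong norms *)

Section LayerCake.
Context d (T : measurableType d) (R : realType).
Variable mu : {measure set T -> \bar R}.
Variables (r Psi : T -> R) (p : R).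
Hypotheses (mr : measurable_fun setT r) (mPsi : measurable_fun setT Psi).
Hypotheses (r_ge0 : forall x, 0 <= r x) (Psi_ge0 : forall x, 0 <= Psi x).
Hypotheses (Psi_gt0 : forall x, 0 < r x -> 0 < Psi x) (p_gt1 : 1 < p).
Implicit Types (W : T -> R) (t : R) (x : T).

Definition level W t : \bar R :=
  (\int[mu]_(x in [set x | (t * Psi x < W x)%R]) (r x * Psi x)%:E)%E.

Definition tail_mass W t : \bar R :=
  (\int[mu]_(x in [set x | (t * Psi x < W x)%R]) (r x * W x)%:E)%E.

(** Twice the sum of the geometric series of ratio 2^(1-p), convergent because p > 1; the 2 is the
    ratio of consecutive dyadic levels. *)
Definition geometric_const : R := 2 / (1 - 2 `^ (1 - p)).

Let q : R := 2 `^ (1 - p).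

Let q_gt0 : 0 < q. Proof. by rewrite powR_gt0. Qed.

Let q_lt1 : q < 1.
Proof.
have -> : q = (2 `^ (p - 1))^-1 by rewrite -powRN opprB.
have p1 : 0 < p - 1 by rewrite subr_gt0.
have h1 : (1 : R) `^ (p - 1) = 1 by rewrite powR1.
rewrite invf_lt1 ?powR_gt0// -[X in X < _]h1.
by apply: gt0_ltr_powR; rewrite ?nnegrE// ltr1n.
Qed.

Lemma geometric_const_ge1 : 1 <= geometric_const.
Proof.
rewrite /geometric_const -/q ler_pdivlMr ?subr_gt0// mul1r.
by have := q_gt0; lra.
Qed.

Let mset W t : measurable_fun setT W -> measurable [set x | t * Psi x < W x].
Proof. by move=> mW; apply: measurable_lt_set => //; exact: measurable_funM. Qed.

Lemma integral_setE (A : set T) (f : T -> R) :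
  (\int[mu]_(x in A) (f x)%:E = \int[mu]_x (\1_A x * f x)%:E)%E.
Proof.
rewrite integral_mkcond; apply: eq_integral => x _; rewrite patchE indicE.
by case: ifPn => _; rewrite ?mul1r ?mul0r.
Qed.

Lemma level_ge0 W t : (0 <= level W t)%E.
Proof. by apply: integral_ge0 => x _; rewrite lee_fin mulr_ge0. Qed.

Lemma tail_mass_ge0 W t : (forall x, 0 <= W x) -> (0 <= tail_mass W t)%E.
Proof. by move=> W0; apply: integral_ge0 => x _; rewrite lee_fin mulr_ge0. Qed.

Let pow2q k : (2 ^+ k) `^ (1 - p) = q ^+ k :> R.
Proof.
elim: k => [|k IH]; first by rewrite expr0 powR1.
by rewrite !exprS powRM ?exprn_ge0// IH.
Qed.

Let level_le W t S : 0 < t -> ((t `^ p)%:E * level W t <= S%:E)%E ->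
  (t%:E * level W t <= (t `^ (1 - p) * S)%:E)%E.
Proof.
move=> t0 h; have E : t = t `^ (1 - p) * t `^ p.
  rewrite -powRD; first by rewrite subrK powRr1// ltW.
  by apply/implyP => _; rewrite gt_eqF.
rewrite [X in (X%:E * _ <= _)%E]E [X in (X * _ <= _)%E]EFinM -muleA [leRHS]EFinM.
by apply: lee_wpmul2l; rewrite ?lee_fin ?powR_ge0.
Qed.

(** On the shell t_k Psi < W <= 2 t_k Psi, the integrand r W is at most 2 t_k r Psi. Each shell may
    be enlarged to the full set W > t_k Psi, since the resulting bounds t_k^(1-p) S still decrease
    geometrically. *)
Lemma tail_weak_le W S t0 : measurable_fun setT W -> (forall x, 0 <= W x) ->
  (forall t, 0 < t -> ((t `^ p)%:E * level W t <= S%:E)%E) -> 0 < t0 ->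
  (tail_mass W t0 <= (geometric_const * (t0 `^ (1 - p) * S))%:E)%E.
Proof.
move=> mW W0 hS t00; pose t k : R := 2 ^+ k * t0.
have tk0 k : 0 < t k by rewrite mulr_gt0// exprn_gt0.
pose A k := [set x | t k * Psi x < W x].
have mA k : measurable (A k) by exact: mset.
pose f k x : \bar R := ((2 * t k)%:E * (\1_(A k) x * (r x * Psi x))%:E)%E.
have mf' k : measurable_fun setT (fun x => (\1_(A k) x * (r x * Psi x))%:E).
  apply/measurable_EFinP; apply: measurable_funM; first exact: measurable_indic.
  exact: measurable_funM.
have f'_ge0 k x : (0 <= (\1_(A k) x * (r x * Psi x))%:E)%E.
  by rewrite lee_fin !mulr_ge0.
have t2 k : (0 <= (2 * t k)%:E)%E by rewrite lee_fin mulr_ge0// ltW.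
have mf k : measurable_fun setT (f k) by exact: measurable_funeM.
have f_ge0 k x : (0 <= f k x)%E by rewrite mule_ge0.
have S0 : 0 <= S.
  have := hS 1 ltr01; rewrite -lee_fin; apply: le_trans.
  by rewrite mule_ge0 ?level_ge0// lee_fin powR_ge0.
have pointwise x : ((\1_[set x | (t0 * Psi x < W x)%R] x * (r x * W x))%:E <=
    \sum_(k <oo) f k x)%E.
  have sum_ge0 : (0 <= \sum_(k <oo) f k x)%E by apply: nneseries_ge0 => k _ _.
  rewrite indicE; have [/set_mem/= xA|_] := boolP (_ \in _); last by rewrite mul0r.
  (* Psi may vanish where r does, but such points carry no weight. *)
  rewrite mul1r; have [->|r0] := eqVneq (r x) 0; first by rewrite mul0r.
  have Px : 0 < Psi x by apply: Psi_gt0; rewrite lt_neqAle eq_sym r0 r_ge0.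
  have tP : 0 < t0 * Psi x by rewrite mulr_gt0.
  have exn : exists n, W x <= t n * Psi x.
    pose n := (Num.truncn (W x / (t0 * Psi x))).+1; exists n.
    have h : W x / (t0 * Psi x) <= 2 ^+ n.
      apply/ltW/(lt_trans (truncnS_gt _)); rewrite -natrX ltr_nat.
      exact: ltn_expl.
    by move: h; rewrite ler_pdivrMr// /t mulrA.
  (* The least exponent is positive because x lies above level t0; its predecessor k gives the shell
     of x. *)
  case: (ex_minnP exn) => -[|k] Wk mink.
    by move: Wk; rewrite /t expr0 mul1r leNgt xA.
  have xk : A k x.
    rewrite /A /= ltNge; apply/negP => /mink.
    by rewrite ltnn.
  apply: (@le_trans _ _ (f k x)).
    rewrite /f indicE mem_set// mul1r -EFinM lee_fin mulrCA ler_wpM2l//.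
    by move: Wk; rewrite /t exprS !mulrA.
  rewrite (nneseriesD1 (n := k))//.
  by apply: leeDl; apply: nneseries_ge0 => i _ _.
have intf k : (\int[mu]_x f k x <= (2 * (t0 `^ (1 - p) * S) * q ^+ k)%:E)%E.
  rewrite /f ge0_integralZl// -integral_setE.
  rewrite EFinM -muleA (_ : 2 * _ * q ^+ k = 2 * (t k `^ (1 - p) * S)).
    rewrite [leRHS]EFinM; apply: lee_wpmul2l; first by rewrite lee_fin.
    exact/level_le/hS.
  by rewrite /t powRM ?exprn_ge0 ?(ltW t00)// pow2q; ring.
rewrite /tail_mass integral_setE.
apply: (@le_trans _ _ (\int[mu]_x \sum_(k <oo) f k x)%E).
  apply: ge0_le_integral => //.
  - by move=> x _; rewrite lee_fin !mulr_ge0.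
  - apply/measurable_EFinP; apply: measurable_funM; last exact: measurable_funM.
    by apply: measurable_indic; exact: mset.
  - exact: ge0_emeasurable_sum.
rewrite integral_nneseries//; apply: lime_le.
  by apply: is_cvg_nneseries => k _ _; exact: integral_ge0.
apply: nearW => n.
apply: (@le_trans _ _ (\sum_(0 <= k < n) (2 * (t0 `^ (1 - p) * S) * q ^+ k)%:E)%E).
  by apply: lee_sum => k _; exact: intf.
rewrite sumEFin lee_fin -mulr_sumr /geometric_const -/q.
have q1 : 0 < 1 - q by rewrite subr_gt0.
have -> : \sum_(0 <= k < n) q ^+ k = (1 - q ^+ n) / (1 - q).
  elim: n => [|n IH]; first by rewrite big_nil expr0 subrr mul0r.
  by rewrite big_nat_recr//= IH exprS; field; rewrite gt_eqF.
have -> : 2 / (1 - q) * (t0 `^ (1 - p) * S) = 2 * (t0 `^ (1 - p) * S) * (1 / (1 - q)).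
  by field; rewrite gt_eqF.
apply: ler_wpM2l; first by rewrite !mulr_ge0// powR_ge0.
by rewrite ler_pM2r ?invr_gt0// gerBl exprn_ge0// ltW.
Qed.

Section Truncation.
Variables (W : T -> R) (delta : R).
Hypotheses (mW : measurable_fun setT W) (W_ge0 : forall x, 0 <= W x).
Hypothesis delta_gt0 : 0 < delta.

(** Cut off to zero instead of capped at delta Psi: W is then the sum of the truncation and of its
    own restriction to W > delta Psi, as [tail_split] requires. *)
Definition truncate x : R := if W x <= delta * Psi x then W x else 0.

Lemma truncateE : truncate = fun x => W x * \1_(~` [set x | delta * Psi x < W x]) x.
Proof.
apply/funext => x; rewrite /truncate indicE in_setC.
case: (leP (W x)) => h; first by rewrite memNset/= ?mulr1// => /lt_geF; rewrite h.
by rewrite mem_set//= mulr0.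
Qed.

Lemma measurable_truncate : measurable_fun setT truncate.
Proof.
rewrite truncateE; apply: measurable_funM => //.
by apply: measurable_indic; apply: measurableC; exact: mset.
Qed.

Lemma truncate_ge0 x : 0 <= truncate x.
Proof. by rewrite /truncate; case: ifP. Qed.

Lemma truncate_le x : truncate x <= W x.
Proof. by rewrite /truncate; case: ifP. Qed.

(** The truncation has no points above level delta, and below delta its level sets lie in those of
    W. The levels of W near 0 thus control all levels of the truncation. *)
Lemma level_truncate_le t S : 0 <= S -> 0 < t ->
  (forall s, 0 < s < delta -> ((s `^ p)%:E * level W s <= S%:E)%E) ->
  ((t `^ p)%:E * level truncate t <= S%:E)%E.
Proof.
move=> S0 t0 h; have [td|td] := ltP t delta.
  apply: le_trans (h t _); last by rewrite t0.
  apply: lee_wpmul2l; first by rewrite lee_fin powR_ge0.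
  apply: ge0_subset_integral; first exact/mset/measurable_truncate.
  - exact: mset.
  - by apply/measurable_EFinP; exact: measurable_funTS (measurable_funM mr mPsi).
  - by move=> x _; rewrite lee_fin mulr_ge0.
  - by move=> x /= /lt_le_trans; apply; exact: truncate_le.
rewrite /level (_ : [set x | _] = set0) ?integral_set0 ?mule0//.
apply/seteqP; split => // x /=; rewrite /truncate; case: ifP => [h1 h2|_].
  have := le_lt_trans (ler_wpM2r (Psi_ge0 x) td) (lt_le_trans h2 h1).
  by rewrite ltxx.
by rewrite ltNge mulr_ge0// ltW.
Qed.

Lemma tail_split t0 :
  (tail_mass W t0 <= tail_mass truncate t0 + tail_mass W delta)%E.
Proof.
rewrite /tail_mass (integral_setE [set x | t0 * Psi x < W x]).
rewrite (integral_setE [set x | t0 * Psi x < truncate x]).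
rewrite (integral_setE [set x | delta * Psi x < W x]).
have m1 (U : T -> R) t : measurable_fun setT U ->
    measurable_fun setT (fun x => (\1_[set x | t * Psi x < U x] x * (r x * U x))%:E).
  move=> mU; apply/measurable_EFinP; apply: measurable_funM.
    by apply: measurable_indic; exact: mset.
  exact: measurable_funM.
have g0 (U : T -> R) t x : (forall x, 0 <= U x) ->
    (0 <= (\1_[set x | t * Psi x < U x] x * (r x * U x))%:E)%E.
  by move=> U0; rewrite lee_fin !mulr_ge0.
have mt := measurable_truncate.
rewrite -ge0_integralD//.
- apply: ge0_le_integral => //.
  + by move=> x _; exact: g0.
  + exact: m1.
  + by apply: emeasurable_funD; exact: m1.
  move=> x _; rewrite -EFinD lee_fin !indicE.
  have [/set_mem/= h|_] := boolP (x \in [set x | t0 * Psi x < W x]); last first.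
    by rewrite mul0r addr_ge0// !mulr_ge0// truncate_ge0.
  have [hd|hd] := ltP (delta * Psi x) (W x).
    rewrite [X in _ + X](_ : _ = 1 * (r x * W x)).
      by rewrite lerDr !mulr_ge0// truncate_ge0.
    by rewrite mem_set.
  rewrite /truncate; rewrite [X in X + _](_ : _ = 1 * (r x * W x)).
    by rewrite lerDl !mulr_ge0.
  by rewrite hd mem_set//= hd.
- by move=> x _; apply: g0 => y; exact: truncate_ge0.
- exact: m1.
- by move=> x _; exact: g0.
- exact: m1.
Qed.

End Truncation.

(** The p-th power of the norm of W / Psi in L_p with weight r Psi, where Psi is positive. *)
Definition strong_integral W : \bar R :=
  (\int[mu]_x (r x * W x `^ p * Psi x `^ (1 - p))%:E)%E.

Let p_gt0 : 0 < p. Proof. exact: lt_trans p_gt1. Qed.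

Let measurable_strong W : measurable_fun setT W ->
  measurable_fun setT (fun x => (r x * W x `^ p * Psi x `^ (1 - p))%:E).
Proof.
move=> mW; apply/measurable_EFinP; apply: measurable_funM.
  by apply: measurable_funM => //; exact: measurableT_comp (measurable_powR p) mW.
exact: measurableT_comp (measurable_powR (1 - p)) mPsi.
Qed.

Let strong_ge0 W x : (0 <= (r x * W x `^ p * Psi x `^ (1 - p))%:E)%E.
Proof. by rewrite lee_fin !mulr_ge0// powR_ge0. Qed.

(** Where W > t0 Psi > 0, the factor (W / (t0 Psi))^(p-1) is at least 1, and multiplying r W by it
    gives t0^(1-p) times the strong integrand. *)
Lemma tail_strong_le W t0 : measurable_fun setT W -> (forall x, 0 <= W x) ->
  0 < t0 -> (tail_mass W t0 <= (t0 `^ (1 - p))%:E * strong_integral W)%E.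
Proof.
move=> mW W0 t00; rewrite /tail_mass integral_setE /strong_integral.
have t1 : (0 <= (t0 `^ (1 - p))%:E)%E by rewrite lee_fin powR_ge0.
have ms := measurable_strong mW.
rewrite -ge0_integralZl//.
apply: ge0_le_integral => //.
- by move=> x _; rewrite lee_fin !mulr_ge0.
- apply/measurable_EFinP; apply: measurable_funM; last exact: measurable_funM.
  by apply: measurable_indic; exact: mset.
- exact: measurable_funeM.
move=> x _; rewrite -EFinM lee_fin indicE.
have [/set_mem/= h|_] := boolP (_ \in _); last first.
  by rewrite mul0r !mulr_ge0// powR_ge0.
rewrite mul1r; have [->|r0] := eqVneq (r x) 0; first by rewrite !mul0r mulr0.
have Px : 0 < Psi x by apply: Psi_gt0; rewrite lt_neqAle eq_sym r0 r_ge0.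
have tP : 0 < t0 * Psi x by rewrite mulr_gt0.
have Wx : 0 < W x by exact: lt_trans h.
rewrite -!mulrA mulrCA ler_wpM2l// mulrCA -(mulr_powRB1 (W0 x) p_gt0) -mulrA ler_peMr//.
rewrite -powRM ?(ltW t00)//.
have -> : (1 - p) = - (p - 1) by ring.
rewrite powRN ler_pdivlMr ?powR_gt0// mul1r.
by rewrite ge0_ler_powR ?nnegrE ?ltW// subr_gt0.
Qed.

(* As delta tends to 0 the truncations tend to 0 wherever r does not vanish. *)
Lemma strong_truncate_small W e : measurable_fun setT W -> (forall x, 0 <= W x) ->
  (strong_integral W < +oo)%E -> 0 < e ->
  exists2 delta, 0 < delta & (strong_integral (truncate W delta) <= e%:E)%E.
Proof.
move=> mW W0 Woo e0; pose dl n : R := n.+1%:R^-1.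
have dl0 n : 0 < dl n by rewrite invr_gt0.
pose f n x := (r x * truncate W (dl n) x `^ p * Psi x `^ (1 - p))%:E.
pose g x := (r x * W x `^ p * Psi x `^ (1 - p))%:E.
have mf n : measurable_fun setT (f n).
  by apply: measurable_strong; exact: measurable_truncate.
have ig : mu.-integrable setT g.
  apply/integrableP; split; first exact: measurable_strong.
  rewrite (eq_integral g); first exact: Woo.
  by move=> x _; rewrite gee0_abs//; exact: strong_ge0.
have fg n x : (`|f n x| <= g x)%E.
  rewrite gee0_abs; last exact: strong_ge0.
  rewrite /f /g lee_fin; apply: ler_wpM2r; first exact: powR_ge0.
  apply: ler_wpM2l => //; apply: ge0_ler_powR; rewrite ?nnegrE ?truncate_ge0//.
    exact: ltW.
  exact: truncate_le.
have f0 x : f ^~ x @ \oo --> 0%E.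
  apply: cvg_near_cst.
  have [r0|r0] := eqVneq (r x) 0; first by apply: nearW => n; rewrite /f r0 !mul0r.
  have Px : 0 < Psi x by apply: Psi_gt0; rewrite lt_neqAle eq_sym r0 r_ge0.
  have [Wx|Wx] := eqVneq (W x) 0.
    apply: nearW => n; rewrite /f /truncate Wx if_same powR0 ?mulr0 ?mul0r//.
    by rewrite gt_eqF.
  have {}Wx : 0 < W x by rewrite lt_neqAle eq_sym Wx W0.
  (* Once [dl n] is below W x / Psi x, the truncation is exactly 0 at x. *)
  near=> n; rewrite /f /truncate ifF; first by rewrite powR0 ?mulr0 ?mul0r// gt_eqF.
  apply/negbTE; rewrite -ltNge -ltr_pdivlMr//; near: n.
  have Wp : 0 < W x / Psi x by rewrite divr_gt0.
  exists (Num.truncn (W x / Psi x)^-1) => // n /= hn.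
  rewrite /dl invf_plt ?posrE//; apply: (lt_le_trans (truncnS_gt _)).
  by rewrite ler_nat ltnS.
have [|_ _ cv] := @dominated_convergence _ _ _ mu _ measurableT f (cst 0%E) g mf
    (measurable_cst _) _ ig (aeW _ (fun x n _ => fg n x)).
  exact: aeW.
move: cv; rewrite integral0 => cv.
have h0 : nbhs (0%E : \bar R) [set y | (y < e%:E)%E].
  by apply: open_ereal_lt'; rewrite lte_fin.
have [n _ /(_ n (leqnn n))/= /ltW h] := cv _ h0.
by exists (dl n).
Unshelve. all: by end_near. Qed.

End LayerCake.

(** * Limits as the coupling constant tends to infinity *)

Section Asymptotics.
Context {R : realType}.
Implicit Types (p B K e : R) (f : R -> \bar R).

Lemma powR_invl (x s : R) : 0 <= x -> x^-1 `^ s = x `^ (- s).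
Proof. by move=> x0; rewrite -powR_inv1// -powRrM mulN1r. Qed.

Lemma powR_near_small p K e : 1 < p -> 0 < e ->
  \forall a \near +oo, 0 < a /\ a `^ (- p) * (K * a) <= e.
Proof.
move=> p1 e0; have p10 : 0 < p - 1 by rewrite subr_gt0.
(* Chosen so that a0^(p-1) = |K| / e + 1; the added 1 keeps a0 positive when K = 0. *)
pose a0 := (`|K| / e + 1) `^ (p - 1)^-1.
have Ke : 0 <= `|K| / e by rewrite divr_ge0// ltW.
have a0_gt0 : 0 < a0 by rewrite powR_gt0// ltr_wpDl.
exists a0; split; first exact: num_real.
move=> a a0a; have a_gt0 : 0 < a := lt_trans a0_gt0 a0a.
split=> //; have ap : 0 < a `^ (p - 1) by rewrite powR_gt0.
have -> : a `^ (- p) * (K * a) = K / a `^ (p - 1).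
  rewrite mulrCA -powRN; congr (_ * _).
  rewrite -[X in _ * X]powRr1 ?ltW// -powRD; first by congr (_ `^ _); ring.
  by apply/implyP => _; rewrite gt_eqF.
rewrite ler_pdivrMr//; apply: (le_trans (ler_norm K)).
rewrite mulrC -ler_pdivrMr//; apply: (@le_trans _ _ (a0 `^ (p - 1))).
  rewrite /a0 -powRrM mulVf ?gt_eqF// powRr1; first by rewrite lerDl.
  by rewrite addr_ge0.
by rewrite ge0_ler_powR ?nnegrE ?ltW.
Qed.

Lemma near_scaled_le p f B K e : 1 < p -> 0 < e ->
  (forall a, 0 < a -> (f a <= (B * a `^ p + K * a)%:E)%E) ->
  \forall a \near +oo, ((a `^ (- p))%:E * f a <= (B + e)%:E)%E.
Proof.
move=> p1 e0 fle; apply: filterS (@powR_near_small p K e p1 e0) => a [a0 ha].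
have h0 : (0 <= (a `^ (- p))%:E)%E by rewrite lee_fin powR_ge0.
apply: le_trans (lee_wpmul2l h0 (fle a a0)) _.
rewrite -EFinM lee_fin mulrDr; apply: lerD => //.
by rewrite mulrCA powRN mulVf ?mulr1// gt_eqF// powR_gt0.
Qed.

Lemma limf_esup_pinfty_le f (B : R) :
  (\forall a \near +oo, (f a <= B%:E)%E) -> (limf_esup f (pinfty_nbhs R) <= B%:E)%E.
Proof.
move=> fB; rewrite limf_esupE; apply: ge_ereal_inf.
exists (ereal_sup (f @` [set a | (f a <= B%:E)%E])); first by exists [set a | (f a <= B%:E)%E].
by apply: ge_ereal_sup => _ [a fa <-].
Qed.

Lemma cvg_pinfty0 f : (forall a, (0 <= f a)%E) ->
  (forall e, 0 < e -> \forall a \near +oo, (f a <= e%:E)%E) ->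
  f a @[a --> +oo] --> 0%E.
Proof.
move=> f0 fe; apply/fine_cvgP; split.
  apply: filterS (fe 1 ltr01) => a fa.
  by rewrite ge0_fin_numE//; exact: le_lt_trans fa (ltry _).
apply/cvgrPdist_le => e e0; apply: filterS (fe e e0) => a fa /=.
rewrite sub0r normrN ger0_norm ?fine_ge0// -lee_fin fineK//.
by rewrite ge0_fin_numE//; exact: le_lt_trans fa (ltry _).
Qed.

End Asymptotics.

(** * Eigenvalue bounds on the tree with explicit constants *)

Section TreeBounds.
Context {R : realType} (G : metric_tree R).
Local Notation mu := (@dx R G).
Local Notation r := (@dist_root R G).
Variables (Psi : points G -> R) (p : R).
Hypotheses (wPsi : weight Psi) (hardy : hardy_inequality Psi 1).
Hypotheses (Psi_gt0 : forall x, 0 < r x -> 0 < Psi x) (p_gt1 : 1 < p).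
Implicit Types (V : points G -> R) (a S K : R).

Let mr := @measurable_dist_root R G.
Let mPsi : measurable_fun setT Psi := wPsi.1.
Let r_ge0 := @dist_root_ge0 R G.
Let Psi_ge0 : forall x, 0 <= Psi x := wPsi.2.
Let p_gt0 : 0 < p. Proof. exact: lt_trans p_gt1. Qed.

Local Notation tailm := (tail_mass mu r Psi).

(** At the level t = 1 / (4 a) one has 4 a t^(1-p) = (4 a)^p, hence the factor 4^p. *)
Definition bound_const : R := geometric_const p * 4 `^ p.

Lemma bound_const_gt0 : 0 < bound_const.
Proof.
by rewrite mulr_gt0 ?powR_gt0//; apply: lt_le_trans ltr01 (geometric_const_ge1 p_gt1).
Qed.

Lemma tail_integral_scale V a : weight V -> 0 < a ->
  tail_integral Psi (fun x => a * V x) = (a%:E * tailm V (4 * a)^-1)%E.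
Proof.
move=> [mV V0] a0; have a4 : 0 < 4 * a by rewrite mulr_gt0.
rewrite /tail_integral /tail_mass.
have -> : tail Psi (fun x => a * V x) = [set x | (4 * a)^-1 * Psi x < V x].
  by apply/seteqP; split => x; rewrite /tail /= mulrA ltr_pdivrMl.
have mA : measurable [set x | (4 * a)^-1 * Psi x < V x].
  exact: measurable_lt_set (measurable_funM (measurable_cst _) mPsi) mV.
have mf : measurable_fun [set x | (4 * a)^-1 * Psi x < V x]
    (fun x => (r x * V x)%:E).
  by apply/measurable_EFinP; exact: measurable_funTS (measurable_funM mr mV).
have f0 x : [set x | (4 * a)^-1 * Psi x < V x] x -> (0 <= (r x * V x)%:E)%E.
  by rewrite lee_fin mulr_ge0 ?r_ge0 ?V0.
have a0' : (0 <= a%:E)%E by rewrite lee_fin ltW.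
rewrite -(ge0_integralZl mu mA mf f0 a0').
by apply: eq_integral => x _; rewrite -EFinM mulrCA.
Qed.

Lemma N_minus_tail V a : weight V -> 0 < a ->
  (N_minus (schrodinger a V) <= (4 * a)%:E * tailm V (4 * a)^-1)%E.
Proof.
move=> wV a0; apply: le_trans (N_minus_le wPsi wV a0 hardy) _.
by rewrite tail_integral_scale// muleA -EFinM.
Qed.

Let scale_const a : 0 < a -> 4 * a * (4 * a)^-1 `^ (1 - p) = 4 `^ p * a `^ p.
Proof.
move=> a0; rewrite powR_invl ?mulr_ge0 ?ltW// opprB.
by rewrite mulr_powRB1 ?powRM ?mulr_ge0 ?ltW.
Qed.

(** S has to bound the levels below delta only, so it can be taken close to the upper limit at 0.
    What lies above delta goes into K, at the price of a term linear in a. *)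
Lemma N_minus_split V S delta K a : weight V -> 0 <= S -> 0 < delta ->
  (forall s, 0 < s < delta -> ((s `^ p)%:E * level_integral Psi V s <= S%:E)%E) ->
  (tailm V delta <= K%:E)%E -> 0 < a ->
  (N_minus (schrodinger a V) <= (bound_const * S * a `^ p + 4 * K * a)%:E)%E.
Proof.
move=> [mV V0] S0 d0 hS hK a0; have a4 : 0 < 4 * a by rewrite mulr_gt0.
have a40 : (0 <= (4 * a)%:E)%E by rewrite lee_fin ltW.
apply: le_trans (N_minus_tail (conj mV V0) a0) _.
have mt := measurable_truncate mPsi delta mV.
have t0 := truncate_ge0 Psi delta V0.
have hl t : 0 < t -> ((t `^ p)%:E * level mu r Psi (truncate Psi V delta) t <= S%:E)%E.
  by move=> tp; apply: level_truncate_le.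
have iv : 0 < (4 * a)^-1 by rewrite invr_gt0.
have h1 := tail_weak_le mr mPsi r_ge0 Psi_ge0 Psi_gt0 p_gt1 mt t0 hl iv.
have h2 := tail_split mu mr mPsi r_ge0 delta mV V0 (4 * a)^-1.
apply: le_trans (lee_wpmul2l a40 (le_trans h2 (leeD h1 hK))) _.
rewrite -EFinD -EFinM lee_fin mulrDr le_eqVlt; apply/orP; left; apply/eqP.
have := scale_const a0; rewrite /bound_const.
move: (_ `^ (1 - p)) (4 `^ p) (a `^ p) (geometric_const p) => x y z g E.
have -> : g * y * S * z = g * (y * z) * S by ring.
by rewrite -E; ring.
Qed.

Lemma tail_mass_finite V S delta : weight V -> 0 < delta ->
  (forall t, 0 < t -> ((t `^ p)%:E * level_integral Psi V t <= S%:E)%E) ->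
  exists K, (tailm V delta <= K%:E)%E.
Proof.
move=> [mV V0] d0 hS; exists (geometric_const p * (delta `^ (1 - p) * S)).
exact: (@tail_weak_le _ _ _ mu _ _ _ mr mPsi r_ge0 Psi_ge0 Psi_gt0 p_gt1 _ _ _ mV V0 hS d0).
Qed.

Lemma N_minus_weak V S a : weight V ->
  (forall t, 0 < t -> ((t `^ p)%:E * level_integral Psi V t <= S%:E)%E) ->
  0 < a -> (N_minus (schrodinger a V) <= (bound_const * a `^ p * S)%:E)%E.
Proof.
move=> [mV V0] hS a0; have a4 : 0 < 4 * a by rewrite mulr_gt0.
apply: le_trans (N_minus_tail (conj mV V0) a0) _.
have iv : 0 < (4 * a)^-1 by rewrite invr_gt0.
have a40 : (0 <= (4 * a)%:E)%E by rewrite lee_fin ltW.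
have h1 := @tail_weak_le _ _ _ mu _ _ _ mr mPsi r_ge0 Psi_ge0 Psi_gt0 p_gt1 _ _ _ mV V0 hS iv.
apply: le_trans (lee_wpmul2l a40 h1) _.
rewrite -EFinM lee_fin le_eqVlt; apply/orP; left; apply/eqP.
have := scale_const a0; rewrite /bound_const.
move: (_ `^ (1 - p)) (4 `^ p) (a `^ p) (geometric_const p) => x y z g E.
have -> : g * y * z * S = g * (y * z) * S by ring.
by rewrite -E; ring.
Qed.

Lemma N_minus_strong V a : weight V -> 0 < a ->
  (N_minus (schrodinger a V) <=
   (bound_const * a `^ p)%:E * strong_integral mu r Psi p V)%E.
Proof.
move=> [mV V0] a0; have a4 : 0 < 4 * a by rewrite mulr_gt0.
apply: le_trans (N_minus_tail (conj mV V0) a0) _.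
have iv : 0 < (4 * a)^-1 by rewrite invr_gt0.
have a40 : (0 <= (4 * a)%:E)%E by rewrite lee_fin ltW.
have h1 := tail_strong_le mu mr mPsi r_ge0 Psi_ge0 Psi_gt0 p_gt1 mV V0 iv.
apply: le_trans (lee_wpmul2l a40 h1) _.
rewrite muleA -EFinM scale_const//; apply: lee_wpmul2r.
  by apply: integral_ge0 => x _; rewrite lee_fin !mulr_ge0 ?powR_ge0 ?r_ge0.
rewrite lee_fin /bound_const -mulrA ler_peMl ?mulr_ge0 ?powR_ge0//.
exact: geometric_const_ge1.
Qed.

Lemma N_minus_strong_split V e a delta K : weight V -> 0 < delta ->
  (strong_integral mu r Psi p (truncate Psi V delta) <= e%:E)%E ->
  (tailm V delta <= K%:E)%E -> 0 < a ->
  (N_minus (schrodinger a V) <= (4 `^ p * e * a `^ p + 4 * K * a)%:E)%E.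
Proof.
move=> [mV V0] d0 he hK a0; have a4 : 0 < 4 * a by rewrite mulr_gt0.
have a40 : (0 <= (4 * a)%:E)%E by rewrite lee_fin ltW.
apply: le_trans (N_minus_tail (conj mV V0) a0) _.
have mt := measurable_truncate mPsi delta mV.
have t0 := truncate_ge0 Psi delta V0.
have iv : 0 < (4 * a)^-1 by rewrite invr_gt0.
have h1 := tail_strong_le mu mr mPsi r_ge0 Psi_ge0 Psi_gt0 p_gt1 mt t0 iv.
have h2 := tail_split mu mr mPsi r_ge0 delta mV V0 (4 * a)^-1.
have x0 : (0 <= ((4 * a)^-1 `^ (1 - p))%:E)%E by rewrite lee_fin powR_ge0.
have h3 := le_trans h1 (lee_wpmul2l x0 he).
apply: le_trans (lee_wpmul2l a40 (le_trans h2 (leeD h3 hK))) _.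
rewrite -[X in (_ * (X + _))%E]EFinM -EFinD -EFinM lee_fin mulrDr le_eqVlt; apply/orP; left; apply/eqP.
have := scale_const a0.
move: (_ `^ (1 - p)) (4 `^ p) (a `^ p) => x y z E.
have -> : y * e * z = (y * z) * e by ring.
by rewrite -E; ring.
Qed.

Lemma N_minus_ge0 (T : operator G) : (0 <= N_minus T)%E.
Proof.
rewrite /N_minus; case: ifP => _ //; apply: esum_ge0 => l _.
(* The empty family realizes n = 0 in the supremum defining the multiplicity. *)
apply: ereal_sup_ubound; exists 0%N => //.
by exists (fun _ => fun=> 0); split=> [[]|c _ []].
Qed.

(** The level sets of V / Psi and those of V relative to Psi can differ only where Psi vanishes,
    hence only where |x| does, and there the weight is zero. *)
Lemma weak_level V : weight V ->
  weak_Lp p (fun x => r x * Psi x) (fun x => V x * (Psi x)^-1) ->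
  (ereal_sup [set (t `^ p)%:E * level_integral Psi V t | t in [set t : R | (0 < t)%R]] < +oo)%E.
Proof.
move=> [mV V0] [_]; apply: le_lt_trans; apply: ge_ereal_sup => _ [t /= t0 <-].
apply: ereal_sup_ubound; exists t => //; congr (_ * _)%E.
rewrite /level_integral (integral_setE mu [set x | t * Psi x < V x]).
rewrite (integral_setE mu [set x | t < `|V x / Psi x|]); apply: eq_integral => x _.
congr (_%:E); have [->|r0] := eqVneq (r x) 0; first by rewrite !mul0r !mulr0.
have Px : 0 < Psi x by apply: Psi_gt0; rewrite lt_neqAle eq_sym r0 r_ge0.
rewrite !indicE; congr ((_ _)%:R * _); apply/idP/idP; rewrite !inE /=;
  by rewrite ger0_norm ?divr_ge0// ltr_pdivlMr.
Qed.

Lemma Lp_strong V : weight V ->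
  Lp p (fun x => r x * Psi x) (fun x => V x * (Psi x)^-1) ->
  (strong_integral mu r Psi p V < +oo)%E.
Proof.
move=> [mV V0] [_]; apply: le_lt_trans; rewrite le_eqVlt; apply/orP; left; apply/eqP.
apply: eq_integral => x _; congr (_%:E).
have [->|r0] := eqVneq (r x) 0; first by rewrite !mul0r mulr0.
have Px : 0 < Psi x by apply: Psi_gt0; rewrite lt_neqAle eq_sym r0 r_ge0.
rewrite ger0_norm ?divr_ge0// powRM ?invr_ge0// powR_invl//.
have -> : 1 - p = - p + 1 by ring.
rewrite powRD ?powRr1//; last by apply/implyP => _; rewrite gt_eqF.
by ring.
Qed.

End TreeBounds.

Theorem theorem4p1 (R : realType) (G : metric_tree R) (regG : regular_tree G)
    (psi : R -> R) (Psi : points G -> R)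
    (Psi_sym : forall x, Psi x = psi (dist_root x))
    (Psi_gt0 : forall x, 0 < dist_root x -> 0 < Psi x)
    (Psi_hardy : normalized_hardy_weight Psi)
    (p : R) (p_gt1 : 1 < p) :
  let Phi := fun x : points G => dist_root x * Psi x in
  exists C : R, 0 < C /\
    (forall V : points G -> R, weight V ->
      weak_Lp p Phi (fun x => V x * (Psi x)^-1) ->
      [/\ (forall a : R, 0 < a ->
            (N_minus (schrodinger a V) <=
            (C * a `^ p)%R%:E *
              ereal_sup [set (t `^ p)%R%:E * level_integral Psi V t |
                         t in [set t : R | (0 < t)%R]])%E),
          (limf_esup (fun a : R => (a `^ (- p))%R%:E * N_minus (schrodinger a V))
             (pinfty_nbhs R) <=
           C%:E * limf_esup (fun t : R => (t `^ p)%R%:E * level_integral Psi V t)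
             zero_or_infty)%E &
          ((t `^ p)%R%:E * level_integral Psi V t)%E @[t --> zero_or_infty]
            --> 0%E ->
          ((a `^ (- p))%R%:E * N_minus (schrodinger a V))%E @[a --> +oo]
            --> 0%E]) /\
    (forall V : points G -> R, weight V ->
      Lp p Phi (fun x => V x * (Psi x)^-1) ->
      (forall a : R, 0 < a ->
         (N_minus (schrodinger a V) <=
          (C * a `^ p)%R%:E *
            \int[@dx R G]_x (dist_root x * V x `^ p * Psi x `^ (1 - p))%:E)%E) /\
      ((a `^ (- p))%R%:E * N_minus (schrodinger a V))%E @[a --> +oo]
        --> 0%E).
Proof.
move=> Phi; have [wPsi hardy _] := Psi_hardy.
exists (bound_const p); split; first exact: bound_const_gt0.
split=> V wV.
- move=> /(weak_level wPsi Psi_gt0 wV) supoo.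
  pose lev t := ((t `^ p)%:E * level_integral Psi V t)%E.
  have lev_ge0 t : (0 <= lev t)%E.
    rewrite mule_ge0 ?lee_fin ?powR_ge0//.
    exact: (level_ge0 (@dx R G) (@dist_root_ge0 R G) wPsi.2 V t).
  set s := ereal_sup _ in supoo *.
  have lev_s t : 0 < t -> (lev t <= s)%E.
    by move=> t0; apply: ereal_sup_ubound; exists t.
  have s_ge0 : (0 <= s)%E := le_trans (lev_ge0 1) (lev_s 1 ltr01).
  have sE : s = (fine s)%:E by rewrite fineK// ge0_fin_numE.
  have lev_fs t : 0 < t -> (lev t <= (fine s)%:E)%E by rewrite -sE; exact: lev_s.
  have N_ge0 a : (0 <= (a `^ (- p))%:E * N_minus (schrodinger a V))%E.
    by rewrite mule_ge0 ?lee_fin ?powR_ge0//; exact: N_minus_ge0.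
  (* Both asymptotic claims rest on this: a bound S for the levels near 0 determines the limit up to
     the constant. *)
  have limit S e : 0 <= S -> 0 < e ->
      (exists2 delta, 0 < delta & forall t, 0 < t < delta -> (lev t <= S%:E)%E) ->
      \forall a \near +oo, ((a `^ (- p))%:E * N_minus (schrodinger a V) <=
        (bound_const p * S + e)%:E)%E.
    move=> S0 e0 [delta d0 hS].
    have [K hK] := tail_mass_finite wPsi Psi_gt0 p_gt1 wV d0 lev_fs.
    apply: (near_scaled_le (K := 4 * K) p_gt1 e0) => a a0.
    exact: (N_minus_split wPsi hardy Psi_gt0 p_gt1 wV S0 d0 hS hK a0).
  (* Every set of the filter contains an interval (0, delta), because 1/t alone exceeds M for small
     t. *)
  have small A : zero_or_infty A ->
      exists2 delta, 0 < delta & forall t : R, 0 < t < delta -> A t.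
    move=> [M _ MA]; exists (`|M| + 1)^-1; first by rewrite invr_gt0 ltr_wpDl.
    move=> t /andP[t0 tM]; apply: MA; split=> //.
    have M1 : 0 < `|M| + 1 by rewrite ltr_wpDl.
    have : `|M| + 1 < t^-1 by rewrite -[X in X < _]invrK ltf_pV2// posrE invr_gt0.
    by have := ler_norm M; lra.
  split.
  + move=> a a0; rewrite sE -EFinM.
    exact: (N_minus_weak wPsi hardy Psi_gt0 p_gt1 wV lev_fs a0).
  + have C0 : 0 < bound_const p by exact: bound_const_gt0.
    set L := limf_esup _ zero_or_infty.
    have L_ge0 : (0 <= L)%E.
      rewrite /L limf_esupE; apply: le_ereal_inf_tmp => _ [A /small[delta d0 hA] <-].
      apply: le_trans (lev_ge0 (delta / 2)) _; apply: ereal_sup_ubound.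
      exists (delta / 2) => //; apply: hA.
      by rewrite divr_gt0//= ltr_pdivrMr// ltr_pMr// ltr1n.
    have [Loo|Loo] := eqVneq L +oo%E; first by rewrite Loo gt0_muley ?leey// lte_fin.
    have LE : L = (fine L)%:E by rewrite fineK// ge0_fin_numE// ltey.
    rewrite LE -EFinM; apply/lee_addgt0Pr => e e0; rewrite -EFinD.
    apply: limf_esup_pinfty_le.
    (* Half of e pays for a bound slightly above the upper limit L, the other half for the term
       linear in a. *)
    have e1 : 0 < e / (2 * bound_const p) by rewrite divr_gt0// mulr_gt0.
    have e2 : 0 < e / 2 by rewrite divr_gt0.
    have -> : bound_const p * fine L + e =
        bound_const p * (fine L + e / (2 * bound_const p)) + e / 2.
      by field; rewrite gt_eqF.
    apply: limit => //; first by rewrite addr_ge0 ?fine_ge0// ltW.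
    have : (L < (fine L + e / (2 * bound_const p))%:E)%E.
      by rewrite [X in (X < _)%E]LE lte_fin ltrDl.
    rewrite {1}/L limf_esupE => /ereal_inf_lt[_ [A /small[delta d0 hA] <-]] supA.
    exists delta => // t td; apply: le_trans (ltW supA).
    by apply: ereal_sup_ubound; exists t => //; exact: hA.
  + move=> lev0; apply: cvg_pinfty0 => // e e0.
    have C0 : 0 < bound_const p by exact: bound_const_gt0.
    have e1 : 0 < e / (2 * bound_const p) by rewrite divr_gt0// mulr_gt0.
    have e2 : 0 < e / 2 by rewrite divr_gt0.
    have -> : e = bound_const p * (e / (2 * bound_const p)) + e / 2.
      by field; rewrite gt_eqF.
    apply: limit => //; first exact: ltW.
    have h0 : nbhs (0%E : \bar R) [set y | (y < (e / (2 * bound_const p))%:E)%E].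
      by apply: open_ereal_lt'; rewrite lte_fin.
    have [delta d0 hA] := small _ (lev0 _ h0).
    by exists delta => // t /hA/ltW.
- move=> /(Lp_strong wPsi Psi_gt0 wV) Ioo; split.
    by move=> a a0; exact: (N_minus_strong wPsi hardy Psi_gt0 p_gt1 wV a0).
  have N_ge0 a : (0 <= (a `^ (- p))%:E * N_minus (schrodinger a V))%E.
    by rewrite mule_ge0 ?lee_fin ?powR_ge0//; exact: N_minus_ge0.
  apply: cvg_pinfty0 => // e e0.
  have p4 : 0 < 4 `^ p :> R by rewrite powR_gt0.
  have e1 : 0 < e / (2 * 4 `^ p) by rewrite divr_gt0// mulr_gt0.
  have e2 : 0 < e / 2 by rewrite divr_gt0.
  have mr := @measurable_dist_root R G; have r0 := @dist_root_ge0 R G.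
  (* Here the strong norm of the truncation is itself made small, so the coefficient of a^p is as
     small as desired. *)
  have [delta d0 hd] := strong_truncate_small mr wPsi.1 r0 Psi_gt0 p_gt1 wV.1 wV.2 Ioo e1.
  pose K := fine (tail_mass (@dx R G) (@dist_root R G) Psi V delta).
  have hK : (tail_mass (@dx R G) (@dist_root R G) Psi V delta <= K%:E)%E.
    rewrite /K fineK// ge0_fin_numE; last exact: (tail_mass_ge0 (@dx R G) Psi r0 delta wV.2).
    apply: le_lt_trans (tail_strong_le (@dx R G) mr wPsi.1 r0 wPsi.2 Psi_gt0 p_gt1
      wV.1 wV.2 d0) _.
    by rewrite lte_mul_pinfty// lee_fin powR_ge0.
  have -> : e = 4 `^ p * (e / (2 * 4 `^ p)) + e / 2.
    by field; rewrite gt_eqF.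
  apply: (near_scaled_le (K := 4 * K) p_gt1 e2) => a a0.
  exact: (N_minus_strong_split wPsi hardy Psi_gt0 p_gt1 wV d0 hd hK a0).
Qed.
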